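(* Let $n\ge 2$, let $u\in S^{n-1}$, and let $H=u^\perp$ be oriented with $u\in H^+$. Let $X=\mathcal{M}(\mathbb{R}^n)$ (or $X=\mathcal{M}_+(\mathbb{R}^n)$) and let $T:X\to X$ be a rearrangement. If the induced map $\diamondsuit_T:\mathcal{L}^n\to\mathcal{L}^n$, defined by $\diamondsuit_TA=\{x:T1_A(x)=1\}$ for $A\in\mathcal{L}^n$, is perimeter preserving on convex bodies and invariant on $H$-symmetric unions of two disjoint balls, then the restriction of $T$ to $\mathcal{S}(\mathbb{R}^n)$ (or to $\mathcal{V}(\mathbb{R}^n)$, respectively) essentially equals $\mathrm{Id}$, $\dagger$, $P_H$, or $P_H^\dagger$.
   Context: $\mathcal{H}^n$ is $n$-dimensional Hausdorff (Lebesgue) measure on $\mathbb{R}^n$; ''essentially'' means up to a set of $\mathcal{H}^n$-measure zero. $\mathcal{L}^n$ is the class of $\mathcal{H}^n$-measurable sets of finite $\mathcal{H}^n$-measure in $\mathbb{R}^n$; $\mathcal{K}^n_n$ is the class of convex bodies (compact convex sets with interior points); $1_A$ is the characteristic function of $A$. $S^{n-1}$ is the unit sphere and $u^\perp$ is the hyperplane through the origin orthogonal to $u$. ''Ball'' means closed $n$-dimensional ball (positive radius). $\mathcal{M}(\mathbb{R}^n)$ (respectively $\mathcal{M}_+(\mathbb{R}^n)$) is the set of real-valued (respectively nonnegative real-valued) $\mathcal{H}^n$-measurable functions on $\mathbb{R}^n$. $\mathcal{S}(\mathbb{R}^n)$ is the set of $f\in\mathcal{M}(\mathbb{R}^n)$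 with $\mathcal{H}^n(\{x:f(x)>t\})<\infty$ for all real $t>\operatorname{ess\,inf} f$ (where $\operatorname{ess\,inf} f=-\infty$ is allowed). $\mathcal{V}(\mathbb{R}^n)$ is the set of $f\in\mathcal{M}_+(\mathbb{R}^n)$ with $\mathcal{H}^n(\{x:f(x)>t\})<\infty$ for all $t>0$. A map $T:X\to X$ is equimeasurable if $\mathcal{H}^n(\{x:Tf(x)>t\})=\mathcal{H}^n(\{x:f(x)>t\})$ for all $f\in X$ and $t\in\mathbb{R}$; monotonic if for $f,g\in X$, $f\le g$ essentially implies $Tf\le Tg$ essentially; a rearrangement if it is equimeasurable and monotonic. Two maps $T_0,T_1$ on a set of functions are essentially equal if for each $f$ in the set, $T_0f(x)=T_1f(x)$ for $\mathcal{H}^n$-almost all $x$ (the exceptional set may depend on $f$). For equimeasurable $T$, $\diamondsuit_T$ is well defined. $\diamondsuit_T$ is perimeter preserving on convex bodies if for each $K\in\mathcal{K}^n_n$, $\diamondsuit_TK$ is a set of finite perimeter and $S(\diamondsuit_TK)=S(K)$, where $S$ denotes perimeter (in the sense of De Giorgi; for a convex body $S(K)$ is its surface area). It is invariant on $H$-symmetric unions of two disjoint balls if $\diamondsuit_TK=K$, essentially, whenever $K$ is a union of two disjoint balls that is symmetric with respect to reflection in $H$. $H^+$ is the closed half-space bounded by $H$ containing $u$, and $H^-$ is the other one. $x^\dagger$ is the reflection of $x$ in $H$ and $f^\dagger(x)=f(x^\dagger)$. $\mathrm{Id}$ is the identity map; $\dagger$ is the map $f\mapsto f^\dagger$; $P_H$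 (polarization) is given by $P_Hf(x)=\max\{f(x),f(x^\dagger)\}$ if $x\in H^+$ and $P_Hf(x)=\min\{f(x),f(x^\dagger)\}$ if $x\in H^-$; $P_H^\dagger f=(P_Hf)^\dagger$. *)

(* Defs.v *)
From HB Require Import structures.
From mathcomp Require Import all_boot all_order all_algebra.
From mathcomp Require Import all_classical all_reals all_analysis.
From mathcomp Require Import ess_sup_inf.

Set Implicit Arguments.
Unset Strict Implicit.
Unset Printing Implicit Defensive.

Import Order.TTheory GRing.Theory Num.Theory.
Import numFieldNormedType.Exports.

Local Open Scope classical_set_scope.
Local Open Scope ring_scope.

(* Lebesgue measure on R^n: the Caratheodory restriction of the outer measure
   given by countable covers by closed boxes. A box is [Some (a, b)], standing
   for the product of the intervals [a_i, b_i], or [None], the empty set; the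
   latter lets a sequence encode a finite cover, also when n = 0. *)

Definition box (R : realType) (n : nat)
    (q : option ('rV[R]_n * 'rV[R]_n)) : set 'rV[R]_n :=
  if q is Some (a, b) then [set x | forall i, a 0 i <= x 0 i <= b 0 i]
  else set0.

Definition box_vol (R : realType) (n : nat)
    (q : option ('rV[R]_n * 'rV[R]_n)) : R :=
  if q is Some (a, b) then \prod_(i < n) Num.max 0 (b 0 i - a 0 i) else 0.

Definition lebesgue_outer (R : realType) (n : nat) (A : set 'rV[R]_n) : \bar R :=
  ereal_inf [set (\sum_(k <oo) (box_vol (q k))%:E)%E
            | q in [set q : nat -> option ('rV[R]_n * 'rV[R]_n)
                   | A `<=` \bigcup_k box (q k)]].

Section lebesgue_outer_is_outer_measure.
Local Open Scope ereal_scope.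
Variables (R : realType) (n : nat).
Local Notation V := 'rV[R]_n.
Local Notation mu := (@lebesgue_outer R n).

Lemma box_vol_ge0 (q : option (V * V)) : (0 <= box_vol q)%R.
Proof.
case: q => [[a b]|] //=; apply: prodr_ge0 => i _.
by rewrite le_max lexx.
Qed.

Let vol_ge0 (q : option (V * V)) : 0 <= (box_vol q)%:E.
Proof. by rewrite lee_fin box_vol_ge0. Qed.

Lemma lebesgue_outer_ge0 (A : set V) : 0 <= mu A.
Proof.
apply: le_ereal_inf_tmp => _ [q _ <-].
by apply: nneseries_ge0 => k _ _; exact: vol_ge0.
Qed.

Lemma lebesgue_outer0 : mu set0 = 0.
Proof.
apply/eqP; rewrite eq_le lebesgue_outer_ge0 andbT.
apply: ereal_inf_lbound; exists (fun=> None); first exact: sub0set.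
by rewrite /= eseries0.
Qed.

Lemma le_lebesgue_outer : {homo mu : A B / A `<=` B >-> A <= B}.
Proof.
move=> A B AB; apply: ereal_inf_le_tmp => _ [q Bq <-].
by exists q => //; exact: subset_trans Bq.
Qed.

Lemma lebesgue_outer_sigma_subadditive : sigma_subadditive mu.
Proof.
move=> A; have [[i ioo]|] := pselect (exists i, mu (A i) = +oo).
  rewrite (eseries_pinfty _ _ ioo) ?leey// => k _.
  by rewrite -ltNye (lt_le_trans _ (lebesgue_outer_ge0 _)).
rewrite -forallNE => Aoo.
suff add2e (e : {posnum R}) :
    mu (\bigcup_k A k) <= \sum_(i <oo) mu (A i) + e%:num%:E.
  by apply/lee_addgt0Pr => _/posnumP[].
rewrite (le_trans _ (epsilon_trick _ _ _))//; last first.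
  by move=> k; exact: lebesgue_outer_ge0.
pose P k (q : nat -> option (V * V)) := A k `<=` \bigcup_j box (q j) /\
  \sum_(j <oo) (box_vol (q j))%:E <= mu (A k) + (e%:num / (2 ^ k.+1)%:R)%:E.
have [G PG] : {G : nat -> nat -> option (V * V) & forall k, P k (G k)}.
  apply: (@choice _ _ P) => k; rewrite /P.
  have fk : mu (A k) \is a fin_num.
    rewrite ge0_fin_numE ?lebesgue_outer_ge0// ltey; exact/eqP/Aoo.
  have ek : (0 < e%:num / (2 ^ k.+1)%:R :> R)%R by [].
  have [_ [q Aq <-] ltq] := lb_ereal_inf_adherent ek fk.
  by exists q; split => //; exact: ltW.
pose w (ij : nat * nat) : \bar R := (box_vol (G ij.1 ij.2))%:E.
have w_ge0 x : 0 <= w x by exact: vol_ge0.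
apply: (@le_trans _ _ (\esum_(i in setT) w i)).
  have /card_esym/ppcard_eqP[f] := card_nat2.
  apply: ereal_inf_lbound; exists (fun k => G (f k).1 (f k).2).
    move=> t [i _ /(PG i).1 [j _ Gt]].
    by exists (f^-1%FUN (i, j)) => //=; rewrite invK ?inE.
  rewrite -(esum_pred_image w _ xpredT) ?[fun=> _]set_true//.
  by rewrite image_eq.
rewrite (_ : esum _ _ = \sum_(i <oo) \sum_(j <oo) w (i, j)); last first.
  pose J : nat -> set (nat * nat) := fun i => [set (i, j) | j in setT].
  rewrite (_ : setT = \bigcup_k J k); last first.
    by rewrite predeqE => -[a b]; split => // _; exists a => //; exists b.
  rewrite esum_bigcupT /=; last 2 first.
  - apply/trivIsetP => i j _ _ ij.
    rewrite predeqE => -[k m] /=; split => //= -[] [_] _ [<-{k} _].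
    by move=> [m' _] [] /esym/eqP; rewrite (negbTE ij).
  - by [].
  rewrite -(image_id [set: nat]) -fun_true esum_pred_image//; last first.
    by move=> k _; exact: esum_ge0.
  apply: eq_eseriesr => /= j _.
  rewrite -(esum_pred_image w (pair j) predT)//=; last first.
    by move=> ? ? _ _; exact: (@can_inj _ _ _ snd).
  by congr esum; rewrite predeqE => -[a b]; split; move=> [i _ <-]; exists i.
apply: lee_nneseries => [k _ _|k _]; first by apply: nneseries_ge0.
exact: (PG k).2.
Qed.

HB.instance Definition _ := isOuterMeasure.Build R V mu
  lebesgue_outer0 lebesgue_outer_ge0 le_lebesgue_outer
  lebesgue_outer_sigma_subadditive.

End lebesgue_outer_is_outer_measure.

(* Same carrier as 'rV[R]_n, with the sigma-algebra of Lebesgue measurable sets. *)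
Notation Rn R n := (caratheodory_type (@lebesgue_outer R n)).

Definition Leb (R : realType) (n : nat) : set (Rn R n) -> \bar R :=
  @lebesgue_outer R n.

HB.instance Definition _ (R : realType) (n : nat) :=
  isMeasure.Build _ _ _ (@Leb R n)
    (@caratheodory_measure0 R _ (@lebesgue_outer R n))
    (@caratheodory_measure_ge0 R _ (@lebesgue_outer R n))
    (@caratheodory_measure_sigma_additive R _ (@lebesgue_outer R n)).

Section euclidean.
Variables (R : realType) (n : nat).
Implicit Types (x y u c : 'rV[R]_n) (f : 'rV[R]_n -> R) (A K : set 'rV[R]_n).

Definition dot x y : R := \sum_(i < n) x 0 i * y 0 i.

(* The library's norm on 'rV[R]_n is the sup norm. *)
Definition enorm x : R := Num.sqrt (dot x x).

Definition closed_eball c (r : R) : set 'rV[R]_n := [set x | enorm (x - c) <= r].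

Definition is_convex_body K : Prop :=
  [/\ compact K, convex_set (K : set (convex_lmodType 'rV[R]_n)) & K° !=set0].

Definition measurable_set A : Prop := measurable (A : set (Rn R n)).

Definition ess_eq_set A B : Prop := {ae @Leb R n, forall x, A x <-> B x}.

Definition ess_eq f g : Prop := {ae @Leb R n, forall x, f x = g x}.

Definition ess_le f g : Prop := {ae @Leb R n, forall x, f x <= g x}.

End euclidean.

Section perimeter.
Variables (R : realType) (n : nat).
Implicit Types (phi : 'rV[R]_n -> 'rV[R]_n) (A : set 'rV[R]_n).

Definition C1c phi : Prop :=
  [/\ forall x, differentiable phi x,
      continuous (fun x => 'J phi x) &
      compact (closure [set x | phi x != 0])].

Definition divergence phi (x : 'rV[R]_n) : R := \tr ('J phi x).

(* De Giorgi's variational perimeter, for every set; on a convex body it is the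
   surface area. *)
Definition perimeter A : \bar R :=
  ereal_sup [set (\int[@Leb R n]_(x in (A : set (Rn R n)))
                    (divergence phi x)%:E)%E
            | phi in [set phi | C1c phi /\ forall x, enorm (phi x) <= 1]].

Definition finite_perimeter A : Prop :=
  measurable_set A /\ (perimeter A < +oo)%E.

End perimeter.

Section functions.
Variables (R : realType) (n : nat).
Implicit Types (f g : 'rV[R]_n -> R).

Definition Mfun : set ('rV[R]_n -> R) :=
  [set f | measurable_fun [set: Rn R n] (f : Rn R n -> R)].

Definition Mfun_plus : set ('rV[R]_n -> R) :=
  [set f | Mfun f /\ forall x, 0 <= f x].

Definition Sfun : set ('rV[R]_n -> R) :=
  [set f | Mfun f /\
    forall t : R, (ess_inf (@Leb R n) (EFin \o f) < t%:E)%E ->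
      (@Leb R n [set x | (t < f x)%R] < +oo)%E].

Definition Vfun : set ('rV[R]_n -> R) :=
  [set f | Mfun_plus f /\
    forall t : R, 0 < t -> (@Leb R n [set x | (t < f x)%R] < +oo)%E].

End functions.

(* A map on a class X of functions is a map on all functions, of which only the
   values on X are constrained or used. *)
Section rearrangements.
Variables (R : realType) (n : nat).
Local Notation map := (('rV[R]_n -> R) -> 'rV[R]_n -> R).
Implicit Types (X : set ('rV[R]_n -> R)) (T : map).

Definition equimeasurable X T : Prop :=
  forall f, X f -> forall t : R,
    @Leb R n [set x | t < T f x] = @Leb R n [set x | t < f x].

Definition monotonic X T : Prop :=
  forall f g, X f -> X g -> ess_le f g -> ess_le (T f) (T g).

Definition rearrangement X T : Prop :=
  [/\ forall f, X f -> X (T f), equimeasurable X T & monotonic X T].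

Definition ess_eq_map X (T0 T1 : map) : Prop :=
  forall f, X f -> ess_eq (T0 f) (T1 f).

Definition induced_map T (A : set 'rV[R]_n) : set 'rV[R]_n :=
  [set x | T \1_A x = 1].

Definition perimeter_preserving_convex_bodies
    (D : set 'rV[R]_n -> set 'rV[R]_n) : Prop :=
  forall K, is_convex_body K ->
    finite_perimeter (D K) /\ perimeter (D K) = perimeter K.

End rearrangements.

(* Reflection and polarization for the hyperplane H orthogonal to the unit
   vector u, oriented so that u lies in H^+ = [set x | 0 <= dot x u]. *)
Section polarization.
Variables (R : realType) (n : nat) (u : 'rV[R]_n).
Local Notation map := (('rV[R]_n -> R) -> 'rV[R]_n -> R).

Definition refl (x : 'rV[R]_n) : 'rV[R]_n := x - (2 * dot x u) *: u.

Definition dagger : map := fun f x => f (refl x).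

Definition polar : map := fun f x =>
  if 0 <= dot x u then Num.max (f x) (f (refl x))
  else Num.min (f x) (f (refl x)).

Definition polar_dagger : map := fun f => dagger (polar f).

Definition invariant_on_symmetric_two_balls
    (D : set 'rV[R]_n -> set 'rV[R]_n) : Prop :=
  forall (c1 c2 : 'rV[R]_n) (r1 r2 : R), 0 < r1 -> 0 < r2 ->
    closed_eball c1 r1 `&` closed_eball c2 r2 = set0 ->
    let K := closed_eball c1 r1 `|` closed_eball c2 r2 in
    refl @` K = K -> ess_eq_set (D K) K.

End polarization.

(* Main.v *)
Require Import Defs.
From mathcomp Require Import all_boot all_order all_algebra.
From mathcomp Require Import all_classical all_reals all_analysis.
From mathcomp Require Import ess_sup_inf measurable_realfun.
From mathcomp Require Import ring lra.

Set Implicit Arguments.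
Unset Strict Implicit.
Unset Printing Implicit Defensive.

Import Order.TTheory GRing.Theory Num.Theory.
Import numFieldNormedType.Exports.

Local Open Scope classical_set_scope.
Local Open Scope ring_scope.

(** Write [D] for the induced set map, [x'] and [A'] for mirror images in the
    hyperplane. The hypotheses determine [D] on all sets of finite measure, up
    to four possibilities, and a rearrangement is determined by what it does
    to level sets.

    Balls. Let [B] be a ball in an open half-space bounded by the hyperplane.
    As [D] is monotone and fixes the union of [B] and [B'], the set [D B] lies
    in this union and has the volume and the perimeter of [B]; then it is one
    of the two balls ([two_balls_rigidity]). This needs no isoperimetric
    inequality: the radial fields [(x - c) / r] of the two balls calibrate. They
    have divergence [n / r] and length at most one, so a set in the union has at
    least [n / r] times its volume as perimeter, while a ball has at most that
    ([perimeter_closed_eball_le]). For a set [E] attaining the bound, the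
    calibrating field may be perturbed inside a ball, where it is shorter than
    one, without increasing its flux; so the first variation vanishes there
    ([calibrated_variation_le]), the volume of [E] in a small box does not
    change when the box is moved ([calibrated_box_translate]), and a zero-one
    law for translation invariant densities shows that [E] fills or misses the
    ball ([calibrated_cube_dichotomy], [calibrated_ball_dichotomy]).

    Half-spaces. Any two balls of the half-space lie in a third one, so [D] acts
    on all of them as the identity or on all of them as the reflection. Filling
    open sets with balls and approximating measurable sets by open ones extends
    this to all sets of finite measure in the half-space ([set_map_half_space]);
    in the same way, symmetric sets are fixed ([set_map_symmetric]).

    All sets. The choices made on the two sides combine in four ways. Equal
    choices give the identity or the reflection. If both sides are sent to the
    same one, [D A] contains the union of [A] and [A'] on that side and the
    symmetric set of the common points of [A] and [A'] on the other; by volume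
    it is a polarization of [A] ([set_map_classification]).

    Functions. Comparing two functions with their minimum, one sees that a level
    set of finite measure of the image depends only on that level set of the
    function, and then, by means of step functions, that it is its image under
    [D] ([level_set_induced]). Countably many levels determine a function; below
    the essential infimum a lower bound for the image replaces the level sets
    ([ess_le_cst_rearrangement], [ess_eq_of_level_sets]).

    Lebesgue measure being given by covers with boxes, its invariance under the
    reflection is also proved here ([outer_refl]), by the comparison of
    translation invariant set functions that gives the zero-one law
    ([translation_invariant_le]). *)

(** * Lebesgue measure on boxes and open sets *)

Section lebesgue_basics.
Variables (R : realType) (n : nat).
Local Notation V := 'rV[R]_n.
Local Notation mu := (@lebesgue_outer R n).
Implicit Types (a b x v : V) (A B N U : set V).

Definition upd a (i : 'I_n) (t : R) : V :=
  \row_j (if j == i then t else a 0 j).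

Definition cbox a b : set V := [set x | forall i, a 0 i <= x 0 i <= b 0 i].
Definition hbox a b : set V := [set x | forall i, a 0 i <= x 0 i < b 0 i].
Definition obox a b : set V := [set x | forall i, a 0 i < x 0 i < b 0 i].
Definition vol a b : R := \prod_(i < n) Num.max 0 (b 0 i - a 0 i).

Lemma vol_ge0 a b : 0 <= vol a b.
Proof. by apply: prodr_ge0 => i _; rewrite le_max lexx. Qed.

Lemma vol_upd a b i s t : vol (upd a i s) (upd b i t) =
  Num.max 0 (t - s) * \prod_(j < n | j != i) Num.max 0 (b 0 j - a 0 j).
Proof.
rewrite /vol (bigD1 i)//= !mxE eqxx; congr (_ * _).
by apply: eq_bigr => j /negPf ji; rewrite !mxE ji.
Qed.

Lemma upd_id a i : upd a i (a 0 i) = a.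
Proof.
by apply/rowP => j; rewrite mxE; case: eqVneq => [->|].
Qed.

Lemma vol_split a b i t :
  vol a (upd b i (Num.min (b 0 i) t)) + vol (upd a i (Num.max (a 0 i) t)) b =
  vol a b.
Proof.
have := vol_upd a b i (a 0 i) (Num.min (b 0 i) t).
have := vol_upd a b i (Num.max (a 0 i) t) (b 0 i).
have := vol_upd a b i (a 0 i) (b 0 i).
rewrite !upd_id => -> -> ->; rewrite -mulrDl; congr (_ * _).
by rewrite /Num.min /Num.max; repeat case: ifPn; rewrite -?leNgt; lra.
Qed.

Lemma outer_cbox a b : (mu (cbox a b) <= (vol a b)%:E)%E.
Proof.
apply: ereal_inf_lbound.
exists (fun k => if k == 0%N then Some (a, b) else None).
  by move=> x abx; exists 0%N.
rewrite (@nneseries_split _ _ 0 1); last by move=> k _; rewrite lee_fin box_vol_ge0.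
by rewrite big_mkord big_ord1/= eseries0 ?adde0//; case.
Qed.

(** Cutting every box of a cover along the hyperplane splits the cover without
    changing the total volume. *)
Lemma lower_half_measurable (i : 'I_n) (t : R) :
  measurable_set [set x : V | x 0 i <= t].
Proof.
apply: le_caratheodory_measurable => X.
apply: le_ereal_inf_tmp => _ [q Xq <-].
pose q1 k := if q k is Some (a, b)
  then Some (a, upd b i (Num.min (b 0 i) t)) else None.
pose q2 k := if q k is Some (a, b)
  then Some (upd a i (Num.max (a 0 i) t), b) else None.
apply: (@le_trans _ _ (\sum_(k <oo) (box_vol (q1 k))%:E +
                      \sum_(k <oo) (box_vol (q2 k))%:E)%E).
  apply: leeD; apply: ereal_inf_lbound.
    exists q1 => // x [/Xq[k _]]; rewrite /q1 => qx xt; exists k => //.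
    case: (q k) qx => [[a b]|]//= abx j; rewrite mxE.
    have := abx j; case: eqVneq => [->|//] /andP[-> xb] /=.
    by rewrite le_min xb.
  exists q2 => // x [/Xq[k _]]; rewrite /q2 => qx /negP; rewrite -ltNge => xt.
  exists k => //; case: (q k) qx => [[a b]|]//= abx j; rewrite mxE.
  have := abx j; case: eqVneq => [->|//] /andP[ax ->] /=.
  by rewrite andbT ge_max ax ltW.
rewrite -nneseriesD; try by move=> *; rewrite lee_fin box_vol_ge0.
apply: lee_nneseries => k; first by rewrite adde_ge0// lee_fin box_vol_ge0.
rewrite -EFinD lee_fin /q1 /q2; case: (q k) => [[a b]|]/=; last by rewrite addr0.
by have /eqP := vol_split a b i t; rewrite eq_le => /andP[].
Qed.

Lemma measurable_setI_coord (P : 'I_n -> R -> Prop) :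
  (forall i, measurable_set [set x : V | P i (x 0 i)]) ->
  measurable_set [set x : V | forall i, P i (x 0 i)].
Proof.
move=> mP; rewrite (_ : [set x | _] =
  \bigcap_(i in [set: 'I_n]) ([set x : V | P i (x 0 i)] : set (Rn R n))).
  apply: (@fin_bigcap_measurable _ (Rn R n)) => // i _; exact: mP.
by apply/seteqP; split => x /= Px i; [move=> _|]; exact: Px.
Qed.

Lemma measurable_coord_lt (i : 'I_n) t : measurable_set [set x : V | x 0 i < t].
Proof.
rewrite (_ : [set x | _] = \bigcup_k
    ([set x : V | x 0 i <= t - k.+1%:R^-1] : set (Rn R n))).
  by apply: bigcup_measurable => k _; exact: lower_half_measurable.
apply/seteqP; split => x /=.
  move=> xt; have [k /ltW ktx] := ltr_add_invr xt.
  by exists k => //=; rewrite lerBrDr.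
by move=> [k _ /= /le_lt_trans]; apply; rewrite ltrBlDr ltrDl invr_gt0.
Qed.

Lemma measurable_coord_ge (i : 'I_n) t : measurable_set [set x : V | t <= x 0 i].
Proof.
rewrite (_ : [set x | _] = ~` ([set x : V | x 0 i < t] : set (Rn R n))).
  by apply: measurableC; exact: measurable_coord_lt.
by apply/seteqP; split => x /= ; rewrite leNgt => /negP.
Qed.

Lemma measurable_coord_gt (i : 'I_n) t : measurable_set [set x : V | t < x 0 i].
Proof.
rewrite (_ : [set x | _] = ~` ([set x : V | x 0 i <= t] : set (Rn R n))).
  by apply: measurableC; exact: lower_half_measurable.
by apply/seteqP; split => x /= ; rewrite ltNge => /negP.
Qed.

Lemma measurable_obox a b : measurable_set (obox a b).
Proof.
apply: (@measurable_setI_coord (fun i s => a 0 i < s < b 0 i)) => i.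
rewrite (_ : [set x | _] = ([set x : V | a 0 i < x 0 i] `&`
   [set x : V | x 0 i < b 0 i] : set (Rn R n))).
  by apply: measurableI; [exact: measurable_coord_gt|exact: measurable_coord_lt].
by apply/seteqP; split => x /= => [/andP[]|[-> ->]].
Qed.

Lemma measurable_hbox a b : measurable_set (hbox a b).
Proof.
apply: (@measurable_setI_coord (fun i s => a 0 i <= s < b 0 i)) => i.
rewrite (_ : [set x | _] = ([set x : V | a 0 i <= x 0 i] `&`
   [set x : V | x 0 i < b 0 i] : set (Rn R n))).
  by apply: measurableI; [exact: measurable_coord_ge|exact: measurable_coord_lt].
by apply/seteqP; split => x /= => [/andP[]|[-> ->]].
Qed.

Definition rat_box (pq : 'rV[rat]_n * 'rV[rat]_n) : set V :=
  obox (map_mx ratr pq.1) (map_mx ratr pq.2).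

Lemma nbhs_rat_box x U : nbhs x U -> exists2 pq, rat_box pq x & rat_box pq `<=` U.
Proof.
move=> /nbhs_ballP[e /= e0 eU].
have lo i : {q : rat | x 0 i - e < ratr q < x 0 i}.
  apply: cid; have /rat_in_itvoo[q] : x 0 i - e < x 0 i by rewrite ltrBlDr ltrDl.
  by rewrite in_itv/=; exists q.
have hi i : {q : rat | x 0 i < ratr q < x 0 i + e}.
  apply: cid; have /rat_in_itvoo[q] : x 0 i < x 0 i + e by rewrite ltrDl.
  by rewrite in_itv/=; exists q.
exists (\row_i sval (lo i), \row_i sval (hi i)).
  move=> i; rewrite !mxE.
  by case: (lo i) => p /= /andP[_ ->]; case: (hi i) => q /= /andP[-> _].
move=> y xy; apply: eU; split => // k i; rewrite (ord1 k).
have := xy i; rewrite !mxE; case: (lo i) => p /= /andP[+ _].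
case: (hi i) => q /= /andP[_]; rewrite /ball /= ltr_distlC.
by move=> ? ? /andP[? ?]; apply/andP; split; lra.
Qed.

Lemma open_measurable_Rn U : open U -> measurable_set U.
Proof.
move=> oU; pose J := [set pq | rat_box pq `<=` U].
rewrite (_ : U = \bigcup_pq (if pq \in J then rat_box pq : set (Rn R n) else set0)).
  apply: countable_bigcupT_measurable => // pq.
  by case: ifPn => _; [exact: measurable_obox|exact: measurable0].
apply/seteqP; split => [x Ux|x [pq _]]; last first.
  by case: ifPn => // /set_mem; apply.
have [pq pqx pqU] := nbhs_rat_box (open_nbhs_nbhs (conj oU Ux)).
by exists pq => //; rewrite mem_set.
Qed.

Lemma closed_measurable_Rn A : closed A -> measurable_set A.
Proof.
move=> cA; rewrite -(setCK A); apply: (@measurableC _ (Rn R n)).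
exact/open_measurable_Rn/closed_openC.
Qed.

(** Countably many rational boxes, each meeting [N] in a null set, cover [U]. *)
Lemma locally_null N U :
  (forall x, U x -> exists2 W, nbhs x W & mu (N `&` W) = 0%E) ->
  mu (N `&` U) = 0%E.
Proof.
move=> nullW; apply/eqP; rewrite eq_le outer_measure_ge0 andbT.
pose F k := if unpickle k is Some pq then
  if `[< mu (N `&` rat_box pq) = 0%E >] then N `&` rat_box pq else set0 else set0.
apply: (@le_trans _ _ (mu (\bigcup_k F k))).
  apply: le_outer_measure => x [Nx /nullW[W /nbhs_rat_box[pq pqx pqW] W0]].
  exists (pickle pq) => //; rewrite /F pickleK asboolT //.
  apply/eqP; rewrite eq_le outer_measure_ge0 andbT -W0.
  by apply: le_outer_measure => y [Ny /pqW].
apply: (le_trans (outer_measure_sigma_subadditive mu F)).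
rewrite eseries0// => k _ _; rewrite /F; case: unpickle => [pq|]; last exact: outer_measure0.
by case: asboolP => // _; exact: outer_measure0.
Qed.

Lemma outer0_measurable N : mu N = 0%E -> measurable_set N.
Proof.
move=> N0; apply: le_caratheodory_measurable => X.
rewrite [X in (X + _)%E](_ : _ = 0%E) ?add0e; first exact: le_outer_measure.
apply/eqP; rewrite eq_le outer_measure_ge0 andbT -N0; exact: le_outer_measure.
Qed.

Lemma outer_affine_le (l : R) v A : 0 < l ->
  (mu [set (l *: x + v)%R | x in A] <= (l ^+ n)%:E * mu A)%E.
Proof.
move=> l0; rewrite -lee_pdivrMl ?exprn_gt0//.
apply: le_ereal_inf_tmp => _ [q Aq <-]; rewrite lee_pdivrMl ?exprn_gt0//.
rewrite -nneseriesZl; last first.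
  by move=> *; rewrite lee_fin box_vol_ge0.
pose q' k : option (V * V) :=
  if q k is Some (a, b) then Some (l *: a + v, l *: b + v) else None.
rewrite (_ : (\sum_(_ <oo) _)%E = (\sum_(k <oo) (box_vol (q' k))%:E)%E).
  apply: ereal_inf_lbound; exists q' => // _ [x /Aq[k _ qx] <-].
  exists k => //; rewrite /q'; case: (q k) qx => [[a b]|]//= abx i.
  by rewrite !mxE !lerD2r !ler_pM2l// abx.
apply: eq_eseriesr => k _; rewrite -EFinM /q'; congr EFin.
case: (q k) => [[a b]|]/=; last by rewrite mulr0.
rewrite -[l ^+ n](_ : \prod_(i < n) l = _); last by rewrite prodr_const card_ord.
rewrite -big_split/=; apply: eq_bigr => i _.
rewrite !mxE maxr_pMr ?(ltW l0)// mulr0; congr Num.max; ring.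
Qed.

Lemma outer_translate v A : mu [set (x + v)%R | x in A] = mu A.
Proof.
have le w B : (mu [set (x + w)%R | x in B] <= mu B)%E.
  have := @outer_affine_le 1 w B ltr01; rewrite expr1n mul1e.
  by under eq_imagel do rewrite scale1r.
apply/eqP; rewrite eq_le le/=.
apply: le_trans (le (- v) _); apply: le_outer_measure => x Ax.
by exists (x + v); [exists x|rewrite addrK].
Qed.

Lemma vol_enlarge a b (e : R) : 0 < e -> (forall i, a 0 i <= b 0 i) ->
  exists2 d, 0 < d & vol (a - const_mx d) (b + const_mx d) <= vol a b + e.
Proof.
move=> e0 ab.
pose F (d : R) := \prod_(i < n) (b 0 i - a 0 i + d *+ 2).
have cF : continuous F.
  apply: (@continuous_big R^o 'I_n *%R 1 xpredT) => //.
    by move=> z; exact: mul_continuous.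
  move=> i _ z; apply: cvgD; first exact: cvg_cst.
  by under eq_fun do rewrite mulr2n; apply: cvgD; exact: cvg_id.
have F0 : F 0 = vol a b.
  apply: eq_bigr => i _; rewrite mul0rn addr0; apply/esym/max_r.
  by rewrite subr_ge0.
have /cvgrPdist_lt/(_ _ e0)/nbhs_ballP[d /= d0 dF] := cF 0.
exists (d / 2); first by rewrite divr_gt0.
have : ball 0 d (d / 2).
  rewrite /ball/= sub0r normrN gtr0_norm ?divr_gt0//.
  by rewrite ltr_pdivrMr// mulr_natr mulr2n ltrDl.
move=> /dF; rewrite F0 ltr_distlC => /andP[_ /ltW]; apply: le_trans.
rewrite le_eqVlt; apply/orP; left; apply/eqP.
apply: eq_bigr => i _; rewrite !mxE max_r; first ring.
by have := ab i; move: d0; lra.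
Qed.

End lebesgue_basics.

(** * Euclidean geometry *)

Section euclidean_geometry.
Variables (R : realType) (n : nat).
Local Notation V := 'rV[R]_n.
Implicit Types (x y z u v : V).

Lemma dotC x y : dot x y = dot y x.
Proof. by apply: eq_bigr => i _; rewrite mulrC. Qed.

Lemma dotDl x y z : dot (x + y) z = dot x z + dot y z.
Proof. by rewrite -big_split; apply: eq_bigr => i _; rewrite mxE mulrDl. Qed.

Lemma dotZl (k : R) x z : dot (k *: x) z = k * dot x z.
Proof. by rewrite mulr_sumr; apply: eq_bigr => i _; rewrite mxE mulrA. Qed.

Lemma dotNl x z : dot (- x) z = - dot x z.
Proof. by rewrite -scaleN1r dotZl mulN1r. Qed.

Lemma dotBl x y z : dot (x - y) z = dot x z - dot y z.
Proof. by rewrite dotDl dotNl. Qed.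

Lemma dotDr x y z : dot x (y + z) = dot x y + dot x z.
Proof. by rewrite !(dotC x) dotDl. Qed.

Lemma dotZr (k : R) x z : dot x (k *: z) = k * dot x z.
Proof. by rewrite !(dotC x) dotZl. Qed.

Lemma dotNr x z : dot x (- z) = - dot x z.
Proof. by rewrite !(dotC x) dotNl. Qed.

Lemma dotBr x y z : dot x (y - z) = dot x y - dot x z.
Proof. by rewrite !(dotC x) dotBl. Qed.

Definition dotE := (dotDl, dotDr, dotBl, dotBr, dotZl, dotZr, dotNl, dotNr).

Lemma dot_ge0 x : 0 <= dot x x.
Proof. by apply: sumr_ge0 => i _; rewrite -expr2 sqr_ge0. Qed.

Lemma coord_sqr_le_dot x i : x 0 i ^+ 2 <= dot x x.
Proof.
rewrite /dot (bigD1 i)//= expr2 lerDl.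
by apply: sumr_ge0 => j _; rewrite -expr2 sqr_ge0.
Qed.

Lemma dot_eq0 x : dot x x = 0 -> x = 0.
Proof.
move=> x0; apply/rowP => i; rewrite mxE; apply/eqP; rewrite -sqrf_eq0.
by rewrite eq_le sqr_ge0 andbT -x0 coord_sqr_le_dot.
Qed.

Lemma enorm_ge0 x : 0 <= enorm x. Proof. exact: sqrtr_ge0. Qed.

Lemma sqr_enorm x : enorm x ^+ 2 = dot x x.
Proof. by rewrite sqr_sqrtr ?dot_ge0. Qed.

Lemma enorm_leP x (r : R) : 0 <= r -> (enorm x <= r) = (dot x x <= r ^+ 2).
Proof. by move=> r0; rewrite -sqr_enorm ler_pXn2r// ?nnegrE// enorm_ge0. Qed.

Lemma enorm_ltP x (r : R) : 0 <= r -> (enorm x < r) = (dot x x < r ^+ 2).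
Proof. by move=> r0; rewrite -sqr_enorm ltr_pXn2r// ?nnegrE// enorm_ge0. Qed.

Lemma enorm0 : enorm (0 : V) = 0.
Proof. by rewrite /enorm -(scale0r 0) dotZl mul0r sqrtr0. Qed.

Lemma enorm_eq0 x : enorm x = 0 -> x = 0.
Proof. by move=> x0; apply: dot_eq0; rewrite -sqr_enorm x0 expr0n. Qed.

Lemma enormZ (k : R) x : enorm (k *: x) = `|k| * enorm x.
Proof. by rewrite /enorm dotZl dotZr mulrA -expr2 sqrtrM ?sqr_ge0// sqrtr_sqr. Qed.

Lemma enormN x : enorm (- x) = enorm x.
Proof. by rewrite -scaleN1r enormZ normrN1 mul1r. Qed.

Lemma enorm_distC x y : enorm (x - y) = enorm (y - x).
Proof. by rewrite -enormN opprB. Qed.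

Lemma cauchy_schwarz x y : dot x y <= enorm x * enorm y.
Proof.
have [->|x0] := eqVneq x 0; first by rewrite -(scale0r 0) dotZl mul0r enormZ normr0 !mul0r.
have [->|y0] := eqVneq y 0; first by rewrite -(scale0r 0) dotZr mul0r enormZ normr0 mul0r mulr0.
have ex : 0 < enorm x.
  rewrite lt0r enorm_ge0 andbT; apply: contra x0 => /eqP/enorm_eq0 ->; exact: eqxx.
have ey : 0 < enorm y.
  rewrite lt0r enorm_ge0 andbT; apply: contra y0 => /eqP/enorm_eq0 ->; exact: eqxx.
(* the square of |y| x - |x| y *)
have := dot_ge0 (enorm y *: x - enorm x *: y).
rewrite !dotE (dotC y x) -!sqr_enorm => h.
have : 0 <= (enorm x * enorm y) * (enorm x * enorm y - dot x y) by nra.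
by rewrite pmulr_rge0 ?mulr_gt0// subr_ge0.
Qed.

Lemma ler_enormD x y : enorm (x + y) <= enorm x + enorm y.
Proof.
rewrite enorm_leP ?addr_ge0 ?enorm_ge0// !dotE (dotC y x).
have := cauchy_schwarz x y; rewrite -!sqr_enorm; nra.
Qed.

Lemma ler_enormB x y : enorm x - enorm y <= enorm (x - y).
Proof. by rewrite lerBlDr -{1}(subrK y x) ler_enormD. Qed.

Lemma coord_le_enorm x i : `|x 0 i| <= enorm x.
Proof.
rewrite -(@ler_pXn2r _ 2)// ?nnegrE ?enorm_ge0// sqr_enorm.
by rewrite real_normK ?num_real// coord_sqr_le_dot.
Qed.

Lemma continuous_coord i : continuous (fun x : V => x 0 i).
Proof. exact: coord_continuous. Qed.

Lemma continuous_dot (f g : V -> V) : continuous f -> continuous g ->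
  continuous (fun x => dot (f x) (g x)).
Proof.
move=> cf cg x; rewrite /dot.
apply: (@cvg_big R^o 'I_n +%R 0 xpredT).
- by move=> z; exact: add_continuous.
- exact: nbhs_filter.
move=> i _; apply: (@cvgM R V (nbhs x) _ (fun z => f z 0 i) (fun z => g z 0 i)).
  exact: (continuous_comp (cf x) (@continuous_coord i _)).
exact: (continuous_comp (cg x) (@continuous_coord i _)).
Qed.

Lemma continuous_subr (c : V) : continuous (fun x : V => x - c).
Proof. move=> x; apply: (@cvgB R V V (nbhs x) _ id (cst c)); last exact: cvg_cst.
exact: cvg_id. Qed.

Lemma continuous_enorm (c : V) : continuous (fun x : V => enorm (x - c)).
Proof.
move=> x; apply: (@cvg_comp _ _ _ _ (@Num.sqrt R)); last exact: sqrt_continuous.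
by apply: (@continuous_dot (fun x => x - c) (fun x => x - c)); exact: continuous_subr.
Qed.

Lemma closed_closed_eball c (r : R) : closed (closed_eball c r : set V).
Proof.
apply: (@closed_comp _ _ (fun x : V => enorm (x - c)) [set s | s <= r]).
  by move=> x _; exact: continuous_enorm.
exact: closed_le.
Qed.

Definition open_eball c (r : R) : set V := [set x | enorm (x - c) < r].

Lemma open_open_eball c (r : R) : open (open_eball c r : set V).
Proof.
apply: (@open_comp _ _ (fun x : V => enorm (x - c)) [set s | s < r]).
  by move=> x _; exact: continuous_enorm.
exact: open_lt.
Qed.

Section reflection.
Variables (u : V) (hu : enorm u = 1).

Lemma dot_unit : dot u u = 1.
Proof. by rewrite -sqr_enorm hu expr1n. Qed.

Lemma reflD x y : refl u (x + y) = refl u x + refl u y.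
Proof. by rewrite /refl dotDl mulrDr scalerDl opprD addrACA. Qed.

Lemma reflZ k x : refl u (k *: x) = k *: refl u x.
Proof. by rewrite /refl dotZl scalerBr scalerA mulrCA. Qed.

Lemma reflB x y : refl u (x - y) = refl u x - refl u y.
Proof. by rewrite reflD -scaleN1r reflZ scaleN1r. Qed.

Lemma dot_refl_u x : dot (refl u x) u = - dot x u.
Proof. by rewrite /refl !dotE dot_unit; ring. Qed.

Lemma reflK : involutive (refl u).
Proof. by move=> x; rewrite {1}/refl dot_refl_u /refl mulrN scaleNr opprK subrK. Qed.

Lemma dot_refl x y : dot (refl u x) (refl u y) = dot x y.
Proof. by rewrite /refl !dotE dot_unit (dotC u y); ring. Qed.

Lemma enorm_refl x : enorm (refl u x) = enorm x.
Proof. by rewrite /enorm dot_refl. Qed.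

Lemma continuous_refl : continuous (refl u).
Proof.
move=> x; apply: (@cvgB R V V (nbhs x) _ id (fun x => (2 * dot x u) *: u)).
  exact: cvg_id.
apply: (@cvgZr_tmp R V V (nbhs x) _ (fun x => 2 * dot x u)).
apply: (@cvgM R V (nbhs x) _ (cst 2) (fun x => dot x u)); first exact: cvg_cst.
have := @continuous_dot id (cst u); apply; first by move=> ?; exact: cvg_id.
exact: cst_continuous.
Qed.

End reflection.
End euclidean_geometry.

(** * Measures on boxes *)

Section additive.
Variable R : realType.

(** A nonnegative additive function is monotone, so its values are squeezed
    between those at fractions of [L], where it is linear. *)
Lemma additive_linear (f : R -> R) (L : R) : 0 < L ->
  (forall s, 0 <= s -> s <= L -> 0 <= f s) ->
  (forall s t, 0 <= s -> 0 <= t -> s + t <= L -> f (s + t) = f s + f t) ->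
  forall s, 0 <= s -> s <= L -> f s = s / L * f L.
Proof.
move=> L0 f0 fD.
have mono s t : 0 <= s -> s <= t -> t <= L -> f s <= f t.
  move=> s0 st tL; rewrite -(subrK s t) addrC fD// ?subr_ge0//; last by lra.
  by rewrite lerDl f0// ?subr_ge0//; lra.
have fM N k : (k <= N.+1)%N -> f (k%:R * (L / N.+1%:R)) = k%:R * f (L / N.+1%:R).
  elim: k => [|k IH] kN.
    have := fD 0 0; rewrite !mul0r addr0 lexx => /(_ isT isT (ltW L0)); lra.
  have LN : 0 <= L / N.+1%:R by rewrite divr_ge0// ltW.
  have kL : k.+1%:R * (L / N.+1%:R) <= L.
    by rewrite mulrCA ger_pMr// ler_pdivrMr// mul1r ler_nat.
  have kLN : 0 <= k%:R * (L / N.+1%:R) by rewrite mulr_ge0.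
  rewrite -[in LHS](@natr1 R k) mulrDl mul1r fD//.
    by rewrite IH ?(ltnW kN)// -(@natr1 R k) mulrDl mul1r.
  by move: kL; rewrite -natr1 mulrDl mul1r.
have fLN N : f (L / N.+1%:R) = f L / N.+1%:R.
  have := fM N N.+1 (leqnn _); rewrite [_ * (L / _)]mulrC divfK// => ->.
  by rewrite mulrAC mulfV ?mul1r.
have fL0 : 0 <= f L by apply: f0 => //; exact: ltW.
move=> s s0 sL; have [->|sL'] := eqVneq s L; first by rewrite divff ?mul1r// gt_eqF.
have {sL sL'} sL : s < L by rewrite lt_neqAle sL' sL.
have bnd (N : nat) : `|f s - s / L * f L| <= f L / N.+1%:R.
  have N0 : 0 < N.+1%:R :> R by [].
  have p0 : 0 <= s / L * N.+1%:R by rewrite mulr_ge0// divr_ge0// ltW.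
  have [k /andP[kle klt]] : exists k : nat, (k%:R <= s / L * N.+1%:R < k.+1%:R).
    by exists (Num.truncn (s / L * N.+1%:R)); rewrite truncn_itv.
  have kN : (k < N.+1)%N.
    rewrite -(ltr_nat R); apply: le_lt_trans kle _.
    by rewrite gtr_pMl// ltr_pdivrMr// mul1r.
  have lo : k%:R * (L / N.+1%:R) <= s.
    by move: kle; rewrite mulrAC ler_pdivlMr// mulrA ler_pdivrMr.
  have hi : s <= k.+1%:R * (L / N.+1%:R).
    by move: klt => /ltW; rewrite mulrAC ler_pdivrMr// mulrA ler_pdivlMr.
  have kL : k.+1%:R * (L / N.+1%:R) <= L.
    by rewrite mulrCA ger_pMr// ler_pdivrMr// mul1r ler_nat.
  have klo : 0 <= k%:R * (L / N.+1%:R) by rewrite mulr_ge0// divr_ge0// ltW.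
  have := mono _ _ klo lo (ltW sL); have := mono _ _ s0 hi kL.
  rewrite !fM ?(ltnW kN)// fLN => h1 h2.
  have e1 : k%:R * (f L / N.+1%:R) <= s / L * f L.
    by rewrite mulrCA mulrC ler_wpM2r// ler_pdivrMr.
  have e2 : s / L * f L <= k.+1%:R * (f L / N.+1%:R).
    by rewrite mulrCA (mulrC (f L)) ler_wpM2r// ler_pdivlMr// ltW.
  have e3 : k.+1%:R * (f L / N.+1%:R) = k%:R * (f L / N.+1%:R) + f L / N.+1%:R.
    by rewrite -natr1 mulrDl mul1r.
  rewrite e3 in h1 e2; move: h1 h2 e1 e2.
  set p := k%:R * (f L / _); set z := f L / _; set q := s / L * _.
  move: p q z (f s) => p q z y h1 h2 h3 h4.
  by rewrite ler_norml; apply/andP; split; lra.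
apply/eqP; rewrite -subr_eq0 -normr_le0 leNgt; apply/negP => h.
have [fL|fL] := eqVneq (f L) 0; first by have := bnd 0%N; move: h; rewrite fL mul0r => h; rewrite leNgt h.
have fLp : 0 < f L by rewrite lt0r fL.
have [k] := ltr_add_invr (divr_gt0 h fLp); rewrite add0r.
by rewrite ltr_pdivlMr// mulrC ltNge bnd.
Qed.

End additive.

Section box_functions.
Variables (R : realType) (n : nat).
Local Notation V := 'rV[R]_n.
Implicit Types (a b c l v : V).

Definition rle a b := forall i : 'I_n, a 0 i <= b 0 i.

Variables (c : V) (L : R) (L0 : 0 < L) (F : V -> V -> R).
Local Notation d := (c + const_mx L).

Hypothesis F_ge0 : forall a b, rle c a -> rle a b -> rle b d -> 0 <= F a b.
Hypothesis F_split : forall a b i t, rle c a -> rle a b -> rle b d ->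
  a 0 i <= t <= b 0 i -> F a b = F a (upd b i t) + F (upd a i t) b.
Hypothesis F_trans : forall a b v, rle c a -> rle a b -> rle b d ->
  rle c (a + v) -> rle (b + v) d -> F (a + v) (b + v) = F a b.

Let G l := F c (c + l).

Let Gupd l i s : (forall j, 0 <= l 0 j <= L) -> 0 <= s -> s <= L ->
  G (upd l i s) = s / L * G (upd l i L).
Proof.
move=> l0L; move: s.
have rl t : 0 <= t <= L -> rle c (c + upd l i t) /\ rle (c + upd l i t) d.
  move=> tL; split => j; rewrite !mxE; have := l0L j; case: eqP => _; lra.
apply: (@additive_linear R (fun s => G (upd l i s)) L L0).
  move=> s s0 sL; have [] := rl s; rewrite ?s0 ?sL// => h1 h2.
  exact: F_ge0.
move=> s t s0 t0 stL; have [|h1 h2] := rl (s + t); first by rewrite addr_ge0//.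
have [|h3 h4] := rl s; first by apply/andP; split; lra.
have [|h5 h6] := rl t; first by apply/andP; split; lra.
rewrite /G (@F_split _ _ i (c 0 i + s))//; last by rewrite !mxE eqxx; lra.
congr (_ + _).
  by congr F; apply/rowP => j; rewrite !mxE; case: eqP => // ->.
rewrite -(@F_trans c (c + upd l i t) (upd 0 i s))//.
  congr F; apply/rowP => j; rewrite !mxE; case: eqP => [->|_]; rewrite ?addr0//; ring.
- by move=> j; rewrite !mxE; case: eqP => _; lra.
- by move=> j; rewrite !mxE; have := l0L j; case: eqP => _; lra.
Qed.

(** Additivity under cuts and translation invariance make the function linear
    in each side length. *)
Lemma box_function_vol a b : rle c a -> rle a b -> rle b d ->
  F a b = F c d / L ^+ n * vol a b.
Proof.
move=> ca ab bd.
pose l := b - a; have l0L j : 0 <= l 0 j <= L.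
  by have := ca j; have := ab j; have := bd j; rewrite !mxE; lra.
have cl : rle c (c + l) by move=> j; rewrite mxE; have := l0L j; lra.
have ld : rle (c + l) d.
  by move=> j; have := l0L j; rewrite /l !mxE; lra.
have -> : F a b = G l.
  rewrite /G -(@F_trans c (c + l) (a - c))//.
  - by congr F; apply/rowP => j; rewrite !mxE; ring.
  - by move=> j; have := ca j; rewrite !mxE; lra.
  - by move=> j; have := bd j; rewrite /l !mxE; lra.
have key (s : seq 'I_n) : uniq s -> G l =
    (\prod_(i <- s) (l 0 i / L)) * G (\row_j (if j \in s then L else l 0 j)).
  elim: s => [_|i s IH /= /andP[is_ us]].
    rewrite big_nil mul1r; congr G; apply/rowP => j; by rewrite mxE.
  rewrite big_cons IH// -mulrA mulrCA; congr (_ * _).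
  set l' := \row_j _.
  have -> : l' = upd l' i (l 0 i).
    by apply/rowP => j; rewrite !mxE; case: eqP => // ->; rewrite (negPf is_).
  rewrite Gupd.
  - congr (_ * G _); apply/rowP => j; rewrite !mxE in_cons.
    by case: eqP.
  - by move=> j; rewrite mxE; case: ifP => _; rewrite ?l0L// lexx ltW.
  - by case/andP: (l0L i).
  - by case/andP: (l0L i).
rewrite (key (enum 'I_n)) ?enum_uniq// mulrC big_enum/=.
have -> : \row_j (if j \in enum 'I_n then L else l 0 j) = const_mx L.
  by apply/rowP => j; rewrite !mxE mem_enum.
rewrite -mulrA; congr (_ * _).
rewrite prodf_div prodr_const card_ord mulrC; congr (_ * _).
by apply: eq_bigr => i _; rewrite /l !mxE max_r// subr_ge0.
Qed.

End box_functions.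

Section covers.
Variables (R : realType) (n : nat) (i0 : 'I_n).
Local Notation V := 'rV[R]_n.
Local Notation mu := (@lebesgue_outer R n).
Implicit Types (a b c v x : V) (A B U : set V).

Lemma open_obox a b : open (obox a b : set V).
Proof.
rewrite openE => x abx.
exists (fun _ i => [set s | a 0 i < s < b 0 i]) => [k i|y aby i]; last exact: aby.
have /near_in_itvoo : x k i \in `]a 0 i, b 0 i[ by rewrite in_itv/= (ord1 k).
by apply: filterS => s; rewrite in_itv.
Qed.

(** Covering boxes may be taken open: enlarging each of them slightly costs
    arbitrarily little volume. *)
Lemma open_box_cover A (e : R) : (mu A < +oo)%E -> 0 < e ->
  exists a b : nat -> V, [/\ forall k, rle (a k) (b k),
    A `<=` \bigcup_k obox (a k) (b k) &
    (\sum_(k <oo) (vol (a k) (b k))%:E <= mu A + e%:E)%E].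
Proof.
move=> Aoo e0.
have e20 : 0 < e / 2 by rewrite divr_gt0.
have fA : mu A \is a fin_num by rewrite ge0_fin_numE ?outer_measure_ge0.
have [_ [q Aq <-] ltq] := lb_ereal_inf_adherent e20 fA.
pose P k (ab : V * V) := [/\ rle ab.1 ab.2, box (q k) `<=` obox ab.1 ab.2 &
  vol ab.1 ab.2 <= box_vol (q k) + (e / 2) / (2 ^ k.+1)%:R].
have [ab Pab] : {ab : nat -> V * V & forall k, P k (ab k)}.
  apply: (@choice _ _ P) => k; rewrite /P.
  have ek : 0 < (e / 2) / (2 ^ k.+1)%:R by rewrite divr_gt0// ltr0n expn_gt0.
  have void (B : set V) : B = set0 -> forall s, 0 <= s -> exists ab : V * V,
      [/\ rle ab.1 ab.2, B `<=` obox ab.1 ab.2 &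
      vol ab.1 ab.2 <= s + (e / 2) / (2 ^ k.+1)%:R].
    move=> -> s s0; exists (0, 0); split => //.
    by rewrite /vol (bigD1 i0)//= mxE subrr maxxx mul0r addr_ge0// ltW.
  case: (q k) => [[a b]|] /=; last exact: void.
  have [ab|] := pselect (rle a b); last first.
    move=> /existsNP[i /negP]; rewrite -ltNge => ba.
    apply: void; last exact: vol_ge0.
    apply/seteqP; split => // x /(_ i) /andP[ax xb].
    by have := le_trans ax xb; rewrite leNgt ba.
  have [d d0 vd] := vol_enlarge ek ab.
  exists (a - const_mx d, b + const_mx d); split => //=.
    by move=> i; have := ab i; rewrite !mxE; lra.
  by move=> x abx i; have := abx i; rewrite !mxE; lra.
exists (fun k => (ab k).1), (fun k => (ab k).2); split.
- by move=> k; have [] := Pab k.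
- by move=> x /Aq[k _ qx]; exists k => //; have [_ + _] := Pab k; apply.
apply: (@le_trans _ _ (\sum_(k <oo) ((box_vol (q k))%:E +
    ((e / 2) / (2 ^ k.+1)%:R)%:E))%E).
  apply: lee_nneseries => k _; first by rewrite lee_fin vol_ge0.
  by rewrite -EFinD lee_fin; have [] := Pab k.
apply: (le_trans (epsilon_trick _ _ _)); first by move=> k; rewrite lee_fin box_vol_ge0.
  exact: ltW.
rewrite [in leRHS](splitr e) EFinD addeA leeD2r//; exact: ltW.
Qed.

(** The union of the open boxes of such a cover. *)
Lemma outer_regular A (e : R) : (mu A < +oo)%E -> 0 < e ->
  exists U, [/\ open U, A `<=` U & (mu U <= mu A + e%:E)%E].
Proof.
move=> Aoo e0; have [a [b [ab Aab le]]] := open_box_cover Aoo e0.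
exists (\bigcup_k obox (a k) (b k)); split => //.
  by apply: bigcup_open => k _; exact: open_obox.
apply: le_trans le; apply: (le_trans (outer_measure_sigma_subadditive mu _)).
apply: lee_nneseries => [*|k _]; first exact: outer_measure_ge0.
apply: le_trans (outer_cbox _ _); apply: le_outer_measure => x abx i.
by have /andP[/ltW -> /ltW ->] := abx i.
Qed.

(** On boxes in the cube, [m] is proportional to the volume, and countable
    subadditivity carries the bound over to covered sets. Applied to the
    reflected Lebesgue measure and to the Lebesgue measure of the part in a
    fixed set. *)
Lemma translation_invariant_le (m : set V -> \bar R) c (L : R) :
  0 < L -> m set0 = 0%E ->
  (forall A, 0 <= m A)%E -> (forall A B, A `<=` B -> m A <= m B)%E ->
  (forall F, m (\bigcup_k F k) <= \sum_(k <oo) m (F k))%E ->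
  (forall A i t, m A = m (A `&` [set x | (x 0 i < t)%R]) +
                       m (A `&` [set x | (t <= x 0 i)%R]))%E ->
  (m (hbox c (c + const_mx L)) < +oo)%E ->
  (forall a b v, rle c a -> rle a b -> rle b (c + const_mx L) ->
    rle c (a + v) -> rle (b + v) (c + const_mx L) ->
    m (hbox (a + v) (b + v)) = m (hbox a b)) ->
  forall A, A `<=` hbox c (c + const_mx L) -> (mu A < +oo)%E ->
  (m A <= (fine (m (hbox c (c + const_mx L))) / L ^+ n)%:E * mu A)%E.
Proof.
move=> L0 m0 m_ge0 m_le m_sub m_split m_fin m_tr A AC Aoo.
set d := c + const_mx L in m_fin m_tr AC *.
set th := fine (m (hbox c d)) / L ^+ n.
have th0 : 0 <= th by rewrite divr_ge0 ?exprn_ge0 ?fine_ge0// ltW.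
have finC a b : rle c a -> rle b d -> m (hbox a b) \is a fin_num.
  move=> ca bd; rewrite ge0_fin_numE//; apply: le_lt_trans m_fin.
  apply: m_le => x abx i; have /andP[ax xb] := abx i.
  by rewrite (le_trans (ca i) ax) (lt_le_trans xb (bd i)).
have hb a b : rle c a -> rle a b -> rle b d -> fine (m (hbox a b)) = th * vol a b.
  apply: (@box_function_vol R n c L L0 (fun a b => fine (m (hbox a b)))).
  - by move=> *; exact: fine_ge0.
  - move=> {}a {}b i t ca ab bd /andP[ait tbi].
    rewrite (m_split _ i t) fineD; last 2 first.
    + rewrite ge0_fin_numE//; apply: le_lt_trans m_fin; apply: m_le => x [abx _] j.
      by have /andP[ax xb] := abx j; rewrite (le_trans (ca j) ax) (lt_le_trans xb (bd j)).
    + rewrite ge0_fin_numE//; apply: le_lt_trans m_fin; apply: m_le => x [abx _] j.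
      by have /andP[ax xb] := abx j; rewrite (le_trans (ca j) ax) (lt_le_trans xb (bd j)).
    congr (fine (m _) + fine (m _)); apply/seteqP; split => x.
    + move=> [abx xt] j; rewrite mxE; have /andP[ax xb] := abx j.
      by rewrite ax /=; case: eqVneq => [->|//]; exact: xt.
    + move=> h; split => [j|]; last by have := h i; rewrite mxE eqxx => /andP[].
      have := h j; rewrite mxE; case: eqVneq => [->|//] /andP[-> /= xt].
      exact: lt_le_trans xt tbi.
    + move=> [abx xt] j; rewrite mxE; have /andP[ax xb] := abx j.
      by rewrite xb andbT; case: eqVneq => [->|//]; exact: xt.
    + move=> h; split => [j|]; last by have := h i; rewrite mxE eqxx => /andP[].
      have := h j; rewrite mxE; case: eqVneq => [->|//] /andP[xt ->].
      by rewrite andbT; exact: le_trans xt.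
  - by move=> {}a {}b v *; rewrite m_tr.
apply/lee_addgt0Pr => e e0.
have e10 : 0 < e / (th + 1) by rewrite divr_gt0// ltr_wpDl.
have [a [b [ab Aab vab]]] := open_box_cover Aoo e10.
pose a' k := \row_i Num.max (a k 0 i) (c 0 i).
pose b' k := \row_i Num.min (b k 0 i) (d 0 i).
have mk k : (m (hbox (a' k) (b' k)) <= th%:E * (vol (a k) (b k))%:E)%E.
  have [ab'|] := pselect (rle (a' k) (b' k)); last first.
    move=> /existsNP[i /negP]; rewrite -ltNge => ba.
    rewrite (_ : hbox _ _ = set0) ?m0 ?mule_ge0 ?lee_fin ?vol_ge0//.
    apply/seteqP; split => // x /(_ i) /andP[ax xb].
    by have := le_lt_trans ax xb; rewrite ltNge (ltW ba).
  have ca : rle c (a' k) by move=> i; rewrite mxE le_max lexx orbT.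
  have bd : rle (b' k) d by move=> i; rewrite mxE ge_min lexx orbT.
  rewrite -(fineK (finC _ _ ca bd)) hb// -EFinM lee_fin ler_wpM2l//.
  apply: ler_prod => i _; rewrite le_max lexx/=.
  rewrite ge_max le_max lexx/= le_max; apply/orP; right; apply: lerB.
    by rewrite mxE ge_min lexx.
  by rewrite mxE le_max lexx.
apply: (@le_trans _ _ (\sum_(k <oo) m (hbox (a' k) (b' k)))%E).
  apply: le_trans (m_sub _); apply: m_le => x Ax.
  have [k _ abx] := Aab _ Ax; exists k => // i; have /andP[ax xb] := abx i.
  have /andP[cx xd] := AC _ Ax i.
  by move: xd; rewrite !mxE ge_max lt_min (ltW ax) cx xb.
apply: (@le_trans _ _ (\sum_(k <oo) (th%:E * (vol (a k) (b k))%:E))%E).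
  exact: lee_nneseries.
rewrite nneseriesZl; last by move=> *; rewrite lee_fin vol_ge0.
apply: (@le_trans _ _ (th%:E * (mu A + (e / (th + 1))%:E))%E).
  by apply: lee_wpmul2l => //; rewrite lee_fin.
rewrite ge0_muleDr ?outer_measure_ge0//; last by rewrite lee_fin ltW.
rewrite leeD2l// -EFinM lee_fin mulrA ler_pdivrMr ?ltr_wpDl//; lra.
Qed.

End covers.

Section transport.
Variables (R : realType) (n : nat) (i0 : 'I_n).
Local Notation V := 'rV[R]_n.
Local Notation mu := (@lebesgue_outer R n).
Implicit Types (a b c v x : V) (A B U : set V).

Lemma preim_translateE v A :
  [set x | A (x - v)] = [set (x + v) | x in A].
Proof.
apply/seteqP; split => [x Ax|_ [x Ax <-] /=]; last by rewrite addrK.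
by exists (x - v) => //; rewrite subrK.
Qed.

Lemma outer_translate_preim v A : mu [set x | A (x - v)] = mu A.
Proof. by rewrite preim_translateE outer_translate. Qed.

Lemma measurable_transport (f g : V -> V) : cancel f g -> cancel g f ->
  (forall A, mu (f @^-1` A) = mu A) ->
  forall A, measurable_set A -> measurable_set (f @^-1` A).
Proof.
move=> fK gK muf A mA; apply: le_caratheodory_measurable => X.
have E B : X `&` f @^-1` B = f @^-1` ((g @^-1` X) `&` B).
  by apply/seteqP; split => x /=; rewrite fK.
have EC : ~` (f @^-1` A) = f @^-1` (~` A) by [].
change (mu (X `&` f @^-1` A) + mu (X `&` ~` (f @^-1` A)) <= mu X)%E.
rewrite EC !E !muf; have -> : mu X = mu (g @^-1` X).
  by rewrite -[RHS]muf; congr (mu _); apply/seteqP; split => x /=; rewrite fK.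
by rewrite (mA (g @^-1` X)).
Qed.

Lemma measurable_translate v A : measurable_set A ->
  measurable_set [set x | A (x - v)].
Proof.
apply: (@measurable_transport (fun x => x - v) (fun x => x + v)).
- by move=> x; rewrite subrK.
- by move=> x; rewrite addrK.
- exact: outer_translate_preim.
Qed.

Lemma outer_closed_eball_lty c (r : R) : (mu (closed_eball c r) < +oo)%E.
Proof.
apply: (@le_lt_trans _ _ (mu (cbox (c - const_mx `|r|) (c + const_mx `|r|)))).
  apply: le_outer_measure => x /= xr i.
  have := le_trans (coord_le_enorm (x - c) i) (le_trans xr (ler_norm r)).
  by rewrite !mxE ler_norml; lra.
by apply: le_lt_trans (outer_cbox _ _) _; rewrite ltry.
Qed.

Lemma outer_hbox_lty a b : (mu (hbox a b) < +oo)%E.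
Proof.
apply: (@le_lt_trans _ _ (mu (cbox a b))).
  by apply: le_outer_measure => x h i; have /andP[-> /ltW ->] := h i.
by apply: le_lt_trans (outer_cbox _ _) _; rewrite ltry.
Qed.

Section reflection.
Variables (u : V) (hu : enorm u = 1).
Local Notation rf := (refl u).

Let m A := mu (rf @^-1` A).

Let outer_ball_null : mu (closed_eball 0 1) = 0%E -> forall A, mu A = 0%E.
Proof.
move=> B0 A; rewrite -(setIT A); apply: locally_null => x _.
exists (open_eball x 1).
  apply: open_nbhs_nbhs; split; first exact: open_open_eball.
  by rewrite /open_eball/= subrr enorm0.
apply/eqP; rewrite eq_le outer_measure_ge0 andbT.
rewrite -B0 -[leRHS](outer_translate_preim x); apply: le_outer_measure => y [_ /= /ltW].
by rewrite /closed_eball/= subr0.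
Qed.

(** Proportionality alone gives some factor between [m] and [mu] on a cube; it
    is at most one, because the unit ball is its own mirror image. *)
Let outer_refl_bounded A c L : A `<=` hbox c (c + const_mx L) ->
  (forall i, c 0 i <= - 1) -> (forall i, 1 < c 0 i + L) -> (m A <= mu A)%E.
Proof.
(* the bounds on [c] and [L] put the unit ball into the cube *)
move=> AC c1 cL.
have [/outer_ball_null n0|B0] := eqVneq (mu (closed_eball 0 1)) 0%E.
  by rewrite /m !n0.
set C := hbox c (c + const_mx L) in AC *.
have L0 : 0 < L by have := c1 i0; have := cL i0; lra.
have mCoo : (m C < +oo)%E.
  have [K CK] : exists K : R, C `<=` closed_eball 0 K.
    exists (Num.sqrt (\sum_(i < n) (`|c 0 i| + L) ^+ 2)) => x Cx /=.
    rewrite /closed_eball/= subr0 enorm_leP ?sqrtr_ge0// sqr_sqrtr; last first.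
      by apply: sumr_ge0 => i _; exact: sqr_ge0.
    apply: ler_sum => i _; rewrite -expr2 -(real_normK (num_real (x 0 i))).
    rewrite ler_pXn2r// ?nnegrE ?addr_ge0// ?(ltW L0)//.
    have := Cx i; rewrite !mxE => /andP[h1 h2].
    have := ler_norm (c 0 i); have := ler_norm (- c 0 i); rewrite normrN => h3 h4.
    by rewrite ler_norml; lra.
  apply: le_lt_trans (outer_closed_eball_lty 0 K); apply: le_outer_measure => x /CK.
  by rewrite /closed_eball/= !subr0 enorm_refl.
have key B : B `<=` C -> (m B <= (fine (m C) / L ^+ n)%:E * mu B)%E.
  move=> BC; apply: translation_invariant_le => //.
  - by move=> *; exact: outer_measure_ge0.
  - by move=> D E DE; apply: le_outer_measure => x /DE.
  - by move=> F; rewrite /m preimage_bigcup; exact: outer_measure_sigma_subadditive.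
  - move=> D i t; rewrite /m.
    have mt : measurable_set (rf @^-1` [set x : V | x 0 i < t]).
      apply: open_measurable_Rn; apply: open_comp; first by move=> x _; exact: continuous_refl.
      apply: (@open_comp _ _ (fun x : V => x 0 i) [set s | s < t]).
        by move=> x _; exact: continuous_coord.
      exact: open_lt.
    rewrite (mt (rf @^-1` D)); congr (mu _ + mu _)%E.
    by apply/seteqP; split => x [h1 /= h2]; split => //=; move: h2; rewrite leNgt => /negP.
  - move=> a b v _ _ _ _ _; rewrite /m -[RHS](outer_translate_preim (rf v)).
    congr (mu _); apply/seteqP; split => x /= h i; have := h i.
      by rewrite reflB reflK// !mxE; lra.
    by rewrite reflB reflK// !mxE; lra.
  - apply: le_lt_trans (outer_hbox_lty c (c + const_mx L)).
    exact: le_outer_measure.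
set th := fine (m C) / L ^+ n in key.
pose B := closed_eball (0 : V) 1.
have BC : B `<=` C.
  move=> x; rewrite /B/closed_eball/= subr0 => x1 i; have := le_trans (coord_le_enorm x i) x1.
  by rewrite ler_norml !mxE; have := c1 i; have := cL i; lra.
have mB : m B = mu B.
  by congr (mu _); apply/seteqP; split => x; rewrite /B/closed_eball/= !subr0 enorm_refl.
have mBm : measurable_set B by apply/closed_measurable_Rn/closed_closed_eball.
have fB : mu B \is a fin_num.
  by rewrite ge0_fin_numE ?outer_measure_ge0// outer_closed_eball_lty.
have CDfin : mu (C `\` B) \is a fin_num.
  rewrite ge0_fin_numE ?outer_measure_ge0//.
  by apply: le_lt_trans (outer_hbox_lty c (c + const_mx L)); apply: le_outer_measure => x [].
(* comparing [m] and [mu] on the cube, the ball and their difference *)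
have th1 : th <= 1.
  have mC : (m C <= mu B + th%:E * mu (C `\` B))%E.
    rewrite -mB; apply: (@le_trans _ _ (m B + m (C `\` B))%E).
      apply: le_trans (outer_measureU2 _ _ _); apply: le_outer_measure => x Cx.
      by have [|] := pselect (B (rf x)); [left|right].
    by rewrite leeD2l//; apply: key => x [].
  have muC : (mu B + mu (C `\` B) <= (L ^+ n)%:E)%E.
    have := mBm C; rewrite (_ : C `&` B = B) => [<-|]; last exact/setIidr.
    apply: (@le_trans _ _ (mu (cbox c (c + const_mx L)))).
      by apply: le_outer_measure => x h i; have /andP[-> /ltW ->] := h i.
    apply: le_trans (outer_cbox _ _) _; rewrite lee_fin le_eqVlt; apply/orP; left.
    rewrite /vol (eq_bigr (fun=> L)) ?prodr_const ?card_ord// => i _.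
    by rewrite !mxE addrAC subrr add0r max_r// ltW.
  have fC : m C \is a fin_num by rewrite ge0_fin_numE// outer_measure_ge0.
  move: mC muC; rewrite -(fineK fB) -(fineK CDfin) -(fineK fC) -EFinM -!EFinD !lee_fin.
  have -> : fine (m C) = th * L ^+ n by rewrite /th divfK// expf_neq0// gt_eqF.
  have th0 : 0 <= th by rewrite divr_ge0 ?exprn_ge0 ?fine_ge0 ?outer_measure_ge0// ltW.
  have b0 : 0 < fine (mu B).
    by rewrite lt0r fine_ge0 ?outer_measure_ge0// andbT fine_eq0.
  move=> h1 h2; rewrite leNgt; apply/negP => th1.
  have := ler_wpM2l th0 h2; rewrite mulrDr; nra.
apply: le_trans (key A AC) _; rewrite -[leRHS]mul1e.
by apply: lee_wpmul2r; rewrite ?outer_measure_ge0// lee_fin.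
Qed.

Let outer_refl_le A : (mu (rf @^-1` A) <= mu A)%E.
Proof.
apply: le_ereal_inf_tmp => _ [q Aq <-].
apply: (@le_trans _ _ (\sum_(k <oo) m (box (q k)))%E).
  apply: le_trans (outer_measure_sigma_subadditive mu _).
  by apply: le_outer_measure => x /Aq[k _ qx]; exists k.
apply: lee_nneseries => [*|k _]; first exact: outer_measure_ge0.
case: (q k) => [[a b]|] /=; last by rewrite /m preimage_set0 outer_measure0.
apply: le_trans (outer_cbox a b).
pose M := 1 + \sum_(i < n) (`|a 0 i| + `|b 0 i|).
have Mi i : `|a 0 i| + `|b 0 i| <= M - 1.
  by rewrite /M addrAC subrr add0r (bigD1 i)//= lerDl; apply: sumr_ge0 => j _; rewrite addr_ge0.
apply: (@outer_refl_bounded _ (const_mx (- M)) (M + M + 1)).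
- move=> x abx i; have /andP[ax xb] := abx i; rewrite !mxE.
  have := Mi i; have := ler_norm (- a 0 i); have := ler_norm (b 0 i); rewrite normrN.
  by have := normr_ge0 (a 0 i); have := normr_ge0 (b 0 i); lra.
- move=> i; rewrite mxE; have := Mi i.
  by have := normr_ge0 (a 0 i); have := normr_ge0 (b 0 i); lra.
- move=> i; rewrite mxE; have := Mi i.
  by have := normr_ge0 (a 0 i); have := normr_ge0 (b 0 i); lra.
Qed.

Lemma outer_refl A : mu (rf @^-1` A) = mu A.
Proof.
apply/eqP; rewrite eq_le outer_refl_le/=.
have := outer_refl_le (rf @^-1` A); rewrite -comp_preimage.
by rewrite (_ : rf \o rf = id)//; apply/funext => x /=; exact: reflK.
Qed.

Lemma measurable_refl A : measurable_set A -> measurable_set (rf @^-1` A).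
Proof.
exact: (measurable_transport (reflK hu) (reflK hu) outer_refl).
Qed.

End reflection.

(** Shrinking a ball by a factor close to one loses little measure and misses
    the sphere. *)
Lemma outer_sphere c (r : R) : 0 < r ->
  mu (closed_eball c r `\` open_eball c r) = 0%E.
Proof.
move=> r0; set B := closed_eball c r.
have fB : mu B \is a fin_num.
  by rewrite ge0_fin_numE ?outer_measure_ge0// outer_closed_eball_lty.
set S := B `\` _.
have fS : mu S \is a fin_num.
  rewrite ge0_fin_numE ?outer_measure_ge0//; apply: le_lt_trans (outer_closed_eball_lty c r).
  by apply: le_outer_measure => x [].
have bound (l : R) : 0 < l -> l < 1 -> fine (mu S) <= (1 - l ^+ n) * fine (mu B).
  move=> l0 l1; pose Bl := closed_eball c (l * r).
  have fBl : mu Bl \is a fin_num.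
    by rewrite ge0_fin_numE ?outer_measure_ge0// outer_closed_eball_lty.
  have mBl : measurable_set Bl by apply/closed_measurable_Rn/closed_closed_eball.
  have BlB : Bl `<=` B by move=> x /= /le_trans; apply; rewrite ger_pMl// ltW.
  have h1 : (mu Bl + mu S <= mu B)%E.
    rewrite (mBl B) (_ : B `&` Bl = Bl); last exact/setIidr.
    rewrite leeD2l//; apply: le_outer_measure => x [Bx /negP]; rewrite -leNgt => rx.
    split => //= xl; have := le_trans rx xl; rewrite leNgt gtr_pMl// l1//.
  have h2 : (mu B <= (l^-1 ^+ n)%:E * mu Bl)%E.
    apply: le_trans (outer_affine_le (c - l^-1 *: c) Bl _); last by rewrite invr_gt0.
    apply: le_outer_measure => x /= xr; exists (l *: x + (c - l *: c)).
      rewrite /Bl/closed_eball/= (_ : _ - c = l *: (x - c)).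
        by rewrite enormZ gtr0_norm// ler_pM2l.
      by apply/rowP => j; rewrite !mxE; ring.
    by apply/rowP => j; rewrite !mxE; field; rewrite gt_eqF.
  move: h1 h2; rewrite -(fineK fB) -(fineK fBl) -(fineK fS) -EFinM -!EFinD !lee_fin.
  rewrite exprVn ler_pdivlMl ?exprn_gt0//; lra.
have bern (l : R) k : 0 < l -> l < 1 -> 1 - l ^+ k <= k%:R * (1 - l).
  move=> l0 l1; elim: k => [|k IH]; first by rewrite expr0 mul0r subrr.
  have lk : 0 <= k%:R * (1 - l) by rewrite mulr_ge0// subr_ge0 ltW.
  by rewrite exprS -natr1; nra.
apply/eqP; rewrite -[_ == _]fine_eq0// eq_le fine_ge0 ?outer_measure_ge0// andbT.
rewrite leNgt; apply/negP => s0.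
have b0 : 0 <= fine (mu B) by rewrite fine_ge0 ?outer_measure_ge0.
set s := fine (mu S) in bound s0 *; set b := fine (mu B) in bound b0 *.
have D0 : 0 < 2 * (n%:R * b + s + 1) by rewrite mulr_gt0// ltr_wpDl// addr_ge0 ?mulr_ge0// ltW.
have e0 : 0 < s / (2 * (n%:R * b + s + 1)) by rewrite divr_gt0.
have nb0 : 0 <= n%:R * b by rewrite mulr_ge0.
have e1 : s / (2 * (n%:R * b + s + 1)) < 1 by rewrite ltr_pdivrMr// mul1r; lra.
set e := s / _ in e0 e1.
have ee : e * (2 * (n%:R * b + s + 1)) = s by rewrite divfK// gt_eqF.
have l0 : 0 < 1 - e by rewrite subr_gt0.
have l1 : 1 - e < 1 by rewrite ltrBlDr ltrDl.
have := bern _ n l0 l1; have := bound _ l0 l1; rewrite opprB addrCA subrr addr0.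
by move: (n%:R) nb0 ee => N; nra.
Qed.

End transport.

(** * Continuously differentiable functions and vector fields *)

Section cutoff.
Variable R : realType.
Implicit Types s t : R.

(** All cutoffs below are built from this function, which is continuously
    differentiable. *)
Definition pos2 s : R := Num.max 0 s ^+ 2.

Lemma pos2_ge0 s : 0 <= pos2 s. Proof. exact: sqr_ge0. Qed.

Lemma pos2_le0 s : s <= 0 -> pos2 s = 0.
Proof. by move=> s0; rewrite /pos2 max_l// expr0n. Qed.

Lemma pos2_gt0 s : 0 < s -> 0 < pos2 s.
Proof. by move=> s0; rewrite /pos2 max_r ?exprn_gt0// ltW. Qed.

Lemma pos2_le1 s : s <= 1 -> pos2 s <= 1.
Proof. by move=> s1; rewrite exprn_ile1 ?le_max ?lexx// ge_max ler01. Qed.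

Lemma is_derive_pos2 s : is_derive s (1 : R) pos2 (2 * Num.max 0 s).
Proof.
have [s0|s0|->] := ltgtP s 0.
- rewrite mulr0.
  apply: (@near_eq_is_derive _ _ _ (cst 0)) => //.
  have tn : \forall t \near s, t < 0.
    by apply: open_nbhs_nbhs; split => //; exact: open_lt.
  by apply: filterS tn => t t0; rewrite pos2_le0// ltW.
- apply: (@near_eq_is_derive _ _ _ (fun t => t ^+ 2)) => //.
    have tn : \forall t \near s, 0 < t.
      by apply: open_nbhs_nbhs; split => //; exact: open_gt.
    by apply: filterS tn => t t0; rewrite /pos2 max_r// ltW.
  have := @is_deriveX R R id 2%N s 1 1 (is_derive_id _ _).
  by rewrite /= expr1 [_ *: _]mulr1.
- have lim0 : h^-1 *: ((pos2 \o shift 0) (h *: 1) - pos2 0) @[h --> 0^'] --> (0 : R).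
    apply/cvgrPdist_le => e e0; near=> h.
    have h0 : h != 0 by near: h; exact: nbhs_dnbhs_neq.
    have he : `|h| <= e by near: h; exact: dnbhs0_le.
    rewrite sub0r normrN /= addr0 (pos2_le0 (lexx 0)) subr0 [h *: 1]mulr1.
    rewrite normrM normfV ler_pdivrMl ?normr_gt0//.
    rewrite ger0_norm ?pos2_ge0//; apply: (@le_trans _ _ (`|h| * `|h|)).
      rewrite /pos2 -expr2 lerXn2r ?nnegrE ?le_max ?lexx//.
      by rewrite ge_max normr_ge0 ler_norm.
    by rewrite ler_wpM2l.
  rewrite mulr0; apply: DeriveDef; first by apply/cvg_ex; exists 0.
  exact: cvg_lim.
Unshelve. all: by end_near. Qed.

Lemma continuous_maxr0 : continuous (fun s : R => Num.max 0 s).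
Proof.
have -> : (fun s : R => Num.max 0 s) = (fun s => (s + `|s|) / 2).
  by apply/funext => s; case: (lerP 0 s) => h; [rewrite ger0_norm//|rewrite ltr0_norm//]; field.
move=> s; apply: cvgM; last exact: cvg_cst.
by apply: cvgD; [exact: cvg_id|exact: norm_continuous].
Qed.

End cutoff.

Section C1.
Variables (R : realType) (n : nat).
Local Notation V := 'rV[R]_n.
Implicit Types (f g : V -> R) (x v c : V).

Lemma continuous_addf f g : continuous f -> continuous g ->
  continuous (fun x => f x + g x).
Proof. by move=> cf cg x; apply: (@cvgD R R V (nbhs x) _ f g); [exact: cf|exact: cg]. Qed.

Lemma continuous_mulf f g : continuous f -> continuous g ->
  continuous (fun x => f x * g x).
Proof. by move=> cf cg x; apply: (@cvgM R V (nbhs x) _ f g); [exact: cf|exact: cg]. Qed.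

(** Directional derivatives instead of the Jacobian: closure under sums,
    products and cutoffs is then a matter of scalar functions. *)
Definition C1 f := (forall x, differentiable f x) /\
  forall v, continuous (fun x => 'D_v f x).

Lemma C1_derivable f x v : C1 f -> derivable f x v.
Proof. by move=> [df _]; exact: diff_derivable. Qed.

Lemma C1_continuous f : C1 f -> continuous f.
Proof. by move=> [df _] x; exact: differentiable_continuous. Qed.

Lemma C1_cst (k : R) : C1 (fun _ : V => k).
Proof.
split=> [x|v]; first exact: differentiable_cst.
rewrite (_ : 'D_v _ = cst 0); first exact: cst_continuous.
by apply/funext => x; exact: derive_cst.
Qed.

Lemma derive_coord i x v : 'D_v (fun y : V => y 0 i) x = v 0 i.
Proof.
have := derive_mx (@derivable_id _ _ x v); rewrite derive_id => /rowP/(_ i).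
by rewrite mxE.
Qed.

Lemma C1_coord i : C1 (fun x : V => x 0 i).
Proof.
split=> [x|v]; first exact: differentiable_coord.
under eq_fun do rewrite derive_coord.
exact: cst_continuous.
Qed.

Lemma C1_add f g : C1 f -> C1 g -> C1 (fun x => f x + g x).
Proof.
move=> Cf Cg; split=> [x|v]; first by apply: differentiableD; [apply Cf|apply Cg].
rewrite (_ : 'D_v _ = (fun x => 'D_v f x + 'D_v g x)).
  by apply: continuous_addf; [apply Cf|apply Cg].
by apply/funext => x; rewrite deriveD//; exact: C1_derivable.
Qed.

Lemma C1_mul f g : C1 f -> C1 g -> C1 (fun x => f x * g x).
Proof.
move=> Cf Cg; split=> [x|v]; first by apply: differentiableM; [apply Cf|apply Cg].
rewrite (_ : 'D_v _ = (fun x => f x * 'D_v g x + g x * 'D_v f x)).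
  apply: continuous_addf; apply: continuous_mulf.
  - exact: C1_continuous.
  - by apply Cg.
  - exact: C1_continuous.
  - by apply Cf.
by apply/funext => x; rewrite deriveM//; exact: C1_derivable.
Qed.

Lemma C1_scale (k : R) f : C1 f -> C1 (fun x => k * f x).
Proof. by move=> Cf; apply: C1_mul => //; exact: C1_cst. Qed.

Lemma C1_sum (I : Type) (s : seq I) (F : I -> V -> R) :
  (forall i, C1 (F i)) -> C1 (fun x => \sum_(i <- s) F i x).
Proof.
move=> CF; elim: s => [|i s IH].
  by under eq_fun do rewrite big_nil; exact: C1_cst.
by under eq_fun do rewrite big_cons; exact: C1_add.
Qed.

Lemma C1_prod (I : Type) (s : seq I) (F : I -> V -> R) :
  (forall i, C1 (F i)) -> C1 (fun x => \prod_(i <- s) F i x).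
Proof.
move=> CF; elim: s => [|i s IH].
  by under eq_fun do rewrite big_nil; exact: C1_cst.
by under eq_fun do rewrite big_cons; exact: C1_mul.
Qed.

Lemma derive_pos2 f x v : differentiable f x ->
  'D_v (fun y => pos2 (f y)) x = 2 * Num.max 0 (f x) * 'D_v f x.
Proof.
move=> df; have dp := is_derive_pos2 (f x).
have dp' : differentiable (@pos2 R) (f x) by apply/derivable1_diffP.
rewrite deriveE; last exact: differentiable_comp.
rewrite diff_comp//= diff1E// derive1E (@derive_val _ _ _ _ _ _ _ dp).
by rewrite -deriveE// [RHS]mulrC.
Qed.

Lemma C1_pos2 f : C1 f -> C1 (fun x => pos2 (f x)).
Proof.
move=> Cf; split=> [x|v].
  apply: differentiable_comp; first by apply Cf.
  by apply/derivable1_diffP; have := is_derive_pos2 (f x) => -[].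
rewrite (_ : 'D_v _ = (fun x => 2 * Num.max 0 (f x) * 'D_v f x)).
  apply: continuous_mulf; last by apply Cf.
  apply: continuous_mulf; first exact: cst_continuous.
  move=> x; exact: (continuous_comp (@C1_continuous f Cf x) (@continuous_maxr0 R _)).
by apply/funext => x; rewrite derive_pos2//; apply Cf.
Qed.

Lemma derive_translate f c x v :
  'D_v (fun y => f (y + c)) x = 'D_v f (x + c).
Proof.
by rewrite /derive; congr (lim _); apply/funext => A; congr nbhs;
  under eq_fun do rewrite /= -addrA.
Qed.

Lemma C1_translate f c : C1 f -> C1 (fun x => f (x + c)).
Proof.
move=> Cf; split=> [x|v].
  apply: (@differentiable_comp _ _ _ _ (fun y : V => y + c)); last by apply Cf.
  exact: differentiableD.
rewrite (_ : 'D_v _ = (fun x => 'D_v f (x + c))).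
  move=> x; apply: (@continuous_comp _ _ _ (fun y : V => y + c) ('D_v f)).
    have := @continuous_subr R n (- c) x; by rewrite opprK.
  by apply Cf.
by apply/funext => x; exact: derive_translate.
Qed.

Lemma derivable_line f x v t : C1 f -> derivable (fun s : R => f (x + s *: v)) t 1.
Proof.
move=> /(@C1_derivable f (x + t *: v) v); rewrite /derivable.
by under eq_fun do rewrite /= addrCA -scalerDl -[X in (X + t) *: _]mulr1.
Qed.

Lemma derive_line f x v t :
  derive1 (fun s : R => f (x + s *: v)) t = 'D_v f (x + t *: v).
Proof.
rewrite derive1E /derive; congr (lim _); apply/funext => A; congr nbhs.
by under [in RHS]eq_fun do rewrite /= addrCA -scalerDl -[X in (X + t) *: _]mulr1.
Qed.

Lemma derive_sum_basis f x v : differentiable f x ->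
  'D_v f x = \sum_i v 0 i * 'D_(delta_mx 0 i) f x.
Proof.
move=> df; rewrite deriveE// {1}(row_sum_delta v) linear_sum.
by apply: eq_bigr => i _; rewrite linearZ deriveE.
Qed.

End C1.

Section fields.
Variables (R : realType) (n : nat).
Local Notation V := 'rV[R]_n.
Implicit Types (f g : V -> R) (x v c : V) (phi : V -> V).

Lemma jacobian_derive phi x i j : differentiable phi x ->
  ('J phi x) i j = ('D_(delta_mx 0 i) phi x) 0 j.
Proof. by move=> dphi; rewrite /jacobian mxE -deriveE. Qed.

Lemma jacobianE phi x i j : differentiable phi x ->
  ('J phi x) i j = 'D_(delta_mx 0 i) (fun y => phi y 0 j) x.
Proof.
move=> dphi; rewrite jacobian_derive//.
by rewrite derive_mx ?mxE//; exact: diff_derivable.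
Qed.

Lemma divergenceE phi x : differentiable phi x ->
  divergence phi x = \sum_i 'D_(delta_mx 0 i) (fun y => phi y 0 i) x.
Proof. by move=> dphi; apply: eq_bigr => i _; rewrite jacobianE. Qed.

Lemma mx_norm_le_enorm x : `|x| <= enorm x.
Proof.
rewrite [`|x|]mx_normrE; apply/bigmax_leP; split=> [|[i j] _ /=]; first exact: enorm_ge0.
by rewrite (ord1 i) coord_le_enorm.
Qed.

Lemma enorm_le_mx_norm x : enorm x <= Num.sqrt n%:R * `|x|.
Proof.
rewrite enorm_leP ?mulr_ge0 ?sqrtr_ge0// exprMn sqr_sqrtr//.
apply: (@le_trans _ _ (\sum_(i < n) `|x| ^+ 2)); last first.
  by rewrite sumr_const card_ord mulr_natl.
apply: ler_sum => i _; rewrite -expr2 -(real_normK (num_real (x 0 i))).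
rewrite lerXn2r ?nnegrE// [leRHS]mx_normrE.
by apply/bigmax_geP; right; exists (0, i).
Qed.

Lemma compact_closed_eball c (r : R) : compact (closed_eball c r : set V).
Proof.
apply: bounded_closed_compact; last exact: closed_closed_eball.
exists (enorm c + r); split; first exact: num_real.
move=> M cM x /= xr; apply: le_trans (mx_norm_le_enorm x) _.
apply: le_trans (ltW cM); rewrite -{1}(subrK c x) addrC.
by apply: le_trans (ler_enormD _ _) _; rewrite lerD2l.
Qed.

Definition bdd_supp (W : zmodType) (F : V -> W) :=
  exists M : R, forall x, M < enorm x -> F x = 0.

Lemma C1c_intro phi : (forall i, C1 (fun x => phi x 0 i)) -> bdd_supp phi ->
  C1c phi.
Proof.
move=> Cphi [M phi0].
have dphi x : differentiable phi x.
  rewrite (_ : phi = \sum_i (fun y => phi y 0 i *: delta_mx 0 i)); last first.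
    by apply/funext => y; rewrite fct_sumE {1}(row_sum_delta (phi y)).
  by apply: differentiable_sum => i; apply: differentiableZl; apply (Cphi i).
split=> //.
- move=> x A [P /= nP PA].
  have : \forall y \near x, forall i, forall j, P i j ('J phi y i j).
    have FF : Filter (nbhs x) by exact: nbhs_filter.
    apply: (@filter_forall V 'I_n (fun i y => forall j, P i j ('J phi y i j)) _ FF) => i.
    apply: (@filter_forall V 'I_n (fun j y => P i j ('J phi y i j)) _ FF) => j.
    have cJ : continuous (fun y => 'J phi y i j).
      rewrite (_ : (fun y => _) = 'D_(delta_mx 0 i) (fun y => phi y 0 j)).
        by apply (Cphi j).2.
      by apply/funext => y; rewrite jacobianE.
    exact: cJ (nP i j).
  by apply: filterS => y Py; exact: PA.
- apply: (subclosed_compact _ (@compact_closed_eball 0 M)).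
    exact: closed_closure.
  have E := (@closure_id _ _).1 (@closed_closed_eball R n 0 M).
  rewrite E; apply: closure_subset => x /= xphi; rewrite /closed_eball/= subr0 leNgt.
  by apply: contra xphi => /phi0 ->.
Qed.

Lemma C1c_bdd_supp phi : C1c phi -> bdd_supp phi.
Proof.
move=> [_ _ /compact_bounded[M [_ hM]]].
exists (Num.sqrt n%:R * (M + 1)) => x hx.
apply: contrapT => /eqP x0.
have := hM (M + 1) _ x; rewrite ltrDl ltr01 => /(_ isT).
have : closure [set x | phi x != 0] x by exact: subset_closure.
move=> cx /(_ cx) xM.
have := le_trans (enorm_le_mx_norm x) (ler_wpM2l (sqrtr_ge0 _) xM).
by rewrite leNgt hx.
Qed.

Lemma C1c_coord phi i : C1c phi -> C1 (fun x => phi x 0 i).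
Proof.
move=> [dphi cJ _]; split=> [x|v].
  apply: (@differentiable_comp _ _ _ _ phi (fun y : V => y 0 i)); first exact: dphi.
  exact: differentiable_coord.
rewrite (_ : 'D_v _ = (fun x => \sum_j v 0 j * ('J phi x) j i)).
  move=> x; apply: (@cvg_big R^o 'I_n +%R 0 xpredT).
  - by move=> z; exact: add_continuous.
  - exact: nbhs_filter.
  move=> j _; apply: (@cvgM R V (nbhs x) _ (cst (v 0 j))); first exact: cvg_cst.
  exact: (continuous_comp (cJ x) (@coord_continuous _ _ _ j i _)).
apply/funext => x; have := @deriveEjacobian _ _ _ phi x v (dphi x).
rewrite derive_mx; last exact: diff_derivable.
by move=> /rowP/(_ i); rewrite !mxE.
Qed.

Lemma derive_out_supp f v (M : R) x : (forall y, M < enorm y -> f y = 0) ->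
  M < enorm x -> 'D_v f x = 0.
Proof.
move=> f0 Mx; transitivity ('D_v (cst 0 : V -> R) x); last exact: derive_cst.
have oM : open [set y : V | M < enorm y].
  rewrite (_ : [set y | _] = ~` closed_eball 0 M).
    by rewrite openC; exact: closed_closed_eball.
  apply/seteqP; split => y; rewrite /closed_eball/= subr0 ltNge; first by move/negP.
  by move=> h; apply/negP.
by apply: near_eq_derive; apply: filterS (open_nbhs_nbhs (conj oM Mx)) => y; exact: f0.
Qed.

Lemma bdd_supp_derive f v : bdd_supp f -> bdd_supp ('D_v f).
Proof. by move=> [M f0]; exists M => x; exact: derive_out_supp. Qed.

Lemma bdd_supp_divergence phi : C1c phi -> bdd_supp (divergence phi).
Proof.
move=> Cphi; have [M phi0] := C1c_bdd_supp Cphi.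
have dphi x : differentiable phi x by case: Cphi.
exists M => x Mx; rewrite divergenceE// big1// => i _.
by apply: derive_out_supp Mx => y /phi0 ->; rewrite mxE.
Qed.

Lemma continuous_divergence phi : C1c phi -> continuous (divergence phi).
Proof.
move=> [_ cJ _] x; apply: (@cvg_big R^o 'I_n +%R 0 xpredT).
- by move=> z; exact: add_continuous.
- exact: nbhs_filter.
by move=> i _; exact: (continuous_comp (cJ x) (@coord_continuous _ _ _ i i _)).
Qed.

Lemma divergence_add (phi psi : V -> V) x :
  differentiable phi x -> differentiable psi x ->
  divergence (fun y => phi y + psi y) x = divergence phi x + divergence psi x.
Proof.
move=> dp dq; rewrite -big_split; apply: eq_bigr => i _ /=.
transitivity (('D_(delta_mx 0 i) (phi + psi) x) 0 i).
  by apply: jacobian_derive; exact: differentiableD.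
have E := @deriveD _ _ _ phi psi x (delta_mx 0 i) (@diff_derivable _ _ _ phi x _ dp)
  (@diff_derivable _ _ _ psi x _ dq).
rewrite E mxE.
by congr (_ + _); rewrite jacobian_derive.
Qed.

Lemma divergence_scale_cst (k : R) (phi : V -> V) x : differentiable phi x ->
  divergence (fun y => k *: phi y) x = k * divergence phi x.
Proof.
move=> dp; rewrite mulr_sumr; apply: eq_bigr => i _ /=.
transitivity (('D_(delta_mx 0 i) (k \*: phi) x) 0 i).
  by apply: jacobian_derive; exact: differentiableZ.
have E := @deriveZ _ _ _ phi k x (delta_mx 0 i) (@diff_derivable _ _ _ phi x _ dp).
by rewrite E mxE jacobian_derive.
Qed.

Lemma C1c_add phi psi : C1c phi -> C1c psi -> C1c (fun x => phi x + psi x).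
Proof.
move=> Cp Cq; apply: C1c_intro.
  move=> i; rewrite (_ : (fun x => _) = fun x => phi x 0 i + psi x 0 i).
    by apply: C1_add; exact: C1c_coord.
  by apply/funext => x; rewrite mxE.
have [M sM] := C1c_bdd_supp Cp; have [N sN] := C1c_bdd_supp Cq.
exists (Num.max M N) => x; rewrite gt_max => /andP[xM xN].
by rewrite sM// sN// addr0.
Qed.

Lemma C1c_scale (k : R) phi : C1c phi -> C1c (fun x => k *: phi x).
Proof.
move=> Cp; apply: C1c_intro.
  move=> i; rewrite (_ : (fun x => _) = fun x => k * phi x 0 i).
    by apply: C1_scale; exact: C1c_coord.
  by apply/funext => x; rewrite mxE.
by have [M sM] := C1c_bdd_supp Cp; exists M => x /sM ->; rewrite scaler0.
Qed.

Lemma divergence_scale f phi x : C1 f -> (forall i, C1 (fun y => phi y 0 i)) ->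
  divergence (fun y => f y *: phi y) x =
  f x * (\sum_i 'D_(delta_mx 0 i) (fun y => phi y 0 i) x) +
  \sum_i phi x 0 i * 'D_(delta_mx 0 i) f x.
Proof.
move=> Cf Cphi.
rewrite divergenceE; last first.
  rewrite (_ : (fun y => _) = \sum_i (fun y => (f y * phi y 0 i) *: delta_mx 0 i)); last first.
    apply/funext => y; rewrite fct_sumE {1}(row_sum_delta (phi y)) scaler_sumr.
    by apply: eq_bigr => i _; rewrite scalerA.
  apply: differentiable_sum => i; apply: differentiableZl.
  by apply: differentiableM; [apply Cf|apply (Cphi i)].
rewrite mulr_sumr -big_split; apply: eq_bigr => i _ /=.
rewrite (_ : (fun y => _) = (fun y => f y * phi y 0 i)).
  by rewrite deriveM//; exact: C1_derivable.
by apply/funext => y; rewrite mxE.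
Qed.

End fields.

(** * Integration of continuous functions of bounded support *)

Section integration.
Variables (R : realType) (n : nat) (i0 : 'I_n).
Local Notation V := 'rV[R]_n.
Local Notation mu := (@Leb R n).
Implicit Types (f g : V -> R) (x v c : V) (A : set V).

Lemma continuous_measurable_Rn A f : continuous f ->
  measurable_fun (A : set (Rn R n)) (f : Rn R n -> R).
Proof.
move=> cf; apply: (@measurable_funS _ _ (Rn R n) _ setT) => //.
apply: (measurability _ (RGenOInfty.measurableE R)) => // _ [_ [a ->] <-].
have H : measurable_set (f @^-1` `]a, +oo[%classic); last by rewrite setTI; exact: H.
apply: (@open_measurable_Rn R n); apply: (@open_comp _ _ f `]a, +oo[%classic); first by move=> x _; exact: cf.
exact: interval_open.
Qed.

Lemma bounded_supp_integrable A f (C M : R) :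
  measurable_set A -> measurable_fun [set: Rn R n] (f : Rn R n -> R) ->
  (forall x, `|f x| <= C) -> (forall x, M < enorm x -> f x = 0) ->
  mu.-integrable (A : set (Rn R n)) (EFin \o (f : Rn R n -> R)).
Proof.
move=> mA mf fC fM.
have mK : measurable_set (closed_eball 0 M : set V).
  by apply/closed_measurable_Rn/closed_closed_eball.
have fE : (EFin \o f : Rn R n -> \bar R) =
    ((EFin \o (f : Rn R n -> R)) \_ (closed_eball 0 M : set (Rn R n))).
  apply/funext => x; rewrite patchE; case: ifPn => // /negP xM.
  rewrite /= fM// ltNge; apply/negP => h; apply: xM.
  by rewrite inE /closed_eball/= subr0.
apply: (@integrableS _ (Rn R n) R mu setT) => //.
rewrite fE; apply/(integrable_mkcond _ mK).
apply: measurable_bounded_integrable => //.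
- exact: outer_closed_eball_lty.
- exact: measurable_funS mf.
- exists C; split; first exact: num_real.
  by move=> D CD x _; rewrite /= (le_trans (fC x)) ?ltW.
Qed.

Lemma continuous_bdd_supp_bounded f : continuous f -> bdd_supp f ->
  exists2 C, 0 <= C & forall x, `|f x| <= C.
Proof.
move=> cf [M fM].
have : compact (f @` closed_eball (0 : V) M).
  apply: continuous_compact; last exact: compact_closed_eball.
  exact: continuous_subspaceT.
move=> /compact_bounded[N [_ hN]]; exists (`|N| + 1); first by rewrite addr_ge0.
move=> x; have [xM|Mx] := leP (enorm x) M; last by rewrite fM// normr0 addr_ge0.
apply: (hN (`|N| + 1)); first by rewrite ltr_pwDr// ler_norm.
by exists x => //; rewrite /closed_eball/= subr0.
Qed.

Lemma continuous_bdd_supp_integrable A f :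
  measurable_set A -> continuous f -> bdd_supp f ->
  mu.-integrable (A : set (Rn R n)) (EFin \o (f : Rn R n -> R)).
Proof.
move=> mA cf sf; have [C _ fC] := continuous_bdd_supp_bounded cf sf.
have [M fM] := sf.
exact: (bounded_supp_integrable mA (continuous_measurable_Rn cf) fC fM).
Qed.

Lemma bdd_supp_translate (W : zmodType) (F : V -> W) c :
  bdd_supp F -> bdd_supp (fun x => F (x + c)).
Proof.
move=> [M FM]; exists (M + enorm c) => x xM; apply: FM.
have := ler_enormB x (- c); rewrite opprK enormN; lra.
Qed.

Lemma integral_translate f c : continuous f -> bdd_supp f ->
  (\int[mu]_x f (x + c) = \int[mu]_x f x)%R.
Proof.
move=> cf sf; rewrite /Rintegral; congr fine.
have mtr : measurable_fun [set: Rn R n] ((fun x => x + c) : Rn R n -> Rn R n).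
  move=> _ B mB; rewrite setTI.
  have := measurable_translate (- c) mB.
  by rewrite (_ : [set x | _] = (fun x => x + c) @^-1` B)//;
    apply/seteqP; split => x /=; rewrite opprK.
have mEf : measurable_fun [set: Rn R n] (EFin \o (f : Rn R n -> R)).
  by apply/measurable_EFinP; exact: continuous_measurable_Rn.
pose tr : Rn R n -> Rn R n := fun x => (x + c)%R.
have If : mu.-integrable (tr @^-1` setT) ((EFin \o (f : Rn R n -> R)) \o tr).
  apply: (@continuous_bdd_supp_integrable _ (fun x => f (x + c))).
    - by rewrite preimage_setT; exact: measurableT.
    - move=> x; apply: (@continuous_comp _ _ _ (fun y : V => y + c) f); last exact: cf.
    by have := @continuous_subr R n (- c) x; rewrite opprK.
    - exact: bdd_supp_translate.
have H := @integral_pushforward _ _ (Rn R n) (Rn R n) R tr mtr mu setT _ mEf If measurableT.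
rewrite preimage_setT in H.
transitivity (\int[mu]_x ((EFin \o (f : Rn R n -> R)) \o tr) x)%E; first by [].
rewrite -H.
apply: eq_measure_integral => B mB _ /=.
rewrite /pushforward /Leb -(outer_translate_preim (- c) B); congr (lebesgue_outer _).
by apply/seteqP; split => x /=; rewrite opprK.
Qed.

(** While [t] stays within distance one of [s], the translated supports lie in
    one ball, whose indicator function dominates the derivatives. *)
Lemma derive_integral_translate A g v (s : R) : measurable_set A ->
  C1 g -> bdd_supp g ->
  is_derive s 1 (fun t : R => \int[mu]_(x in A) (g (x + t *: v)))%R
    (\int[mu]_(x in A) 'D_v g (x + s *: v))%R.
Proof.
move=> mA Cg sg.
have cD : continuous ('D_v g) by apply Cg.
have [C C0 gC] := continuous_bdd_supp_bounded cD (bdd_supp_derive v sg).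
have [M gM] := sg.
pose M' := M + (`|s| + 1) * enorm v.
pose G : V -> R := fun x => C * \1_(closed_eball 0 M') x.
have G0 x : 0 <= G x by rewrite mulr_ge0.
have sI : `]s - 1, s + 1[%classic s by rewrite /= in_itv/= ltrDl ltrBlDr ltrDl ltr01.
have intf (t : R) : `]s - 1, s + 1[%classic t ->
    mu.-integrable (A : set (Rn R n)) (EFin \o ((fun x => g (x + t *: v)) : Rn R n -> R)).
  move=> _; apply: continuous_bdd_supp_integrable => //; last exact: bdd_supp_translate.
  exact/C1_continuous/C1_translate.
have df (t : R) (x : V) : `]s - 1, s + 1[%classic t -> A x ->
    derivable (fun t : R => g (x + t *: v)) t 1.
  by move=> _ _; exact: derivable_line.
have iG : mu.-integrable (A : set (Rn R n)) (EFin \o (G : Rn R n -> R)).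
  apply: (@bounded_supp_integrable A G C M' mA).
  - apply: measurable_funM => //; apply: (@measurable_indic _ (Rn R n) R).
    by apply/closed_measurable_Rn/closed_closed_eball.
  - move=> x; rewrite /G indicE; case: (_ \in _); rewrite ?mulr1 ?mulr0 ?normr0//.
    by rewrite ger0_norm.
  - move=> x; rewrite ltNge => /negP xM; rewrite /G indicE memNset ?mulr0// => h.
    by apply: xM; move: h; rewrite /closed_eball/= subr0.
have Gub (t : R) (x : V) : `]s - 1, s + 1[%classic t -> A x ->
    `|partial1of2 (fun (t : R) x => g (x + t *: v)) t x| <= G x.
  move=> /= + _; rewrite in_itv/= => tI; rewrite /partial1of2 derive_line.
  rewrite /G indicE; case: (boolP (x \in _)) => xM; first by rewrite mulr1.
  rewrite mulr0 (@derive_out_supp _ _ _ _ M) ?normr0//.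
  move: xM => /negP xM; rewrite ltNge; apply/negP => h; apply: xM.
  rewrite inE /closed_eball/= subr0 /M'.
  have := ler_enormB x (- (t *: v)); rewrite opprK enormN enormZ.
  have : `|t| * enorm v <= (`|s| + 1) * enorm v.
    rewrite ler_wpM2r ?enorm_ge0//; have := ler_normD s (t - s); rewrite subrKC.
    have : `|t - s| <= 1 by rewrite ler_norml; lra.
    lra.
  lra.
have := @derivable_under_integral R _ (Rn R n) mu _ A mA s _ _ sI intf df G G0 iG Gub.
have := @differentiation_under_integral R _ (Rn R n) mu _ A mA s _ _ sI intf df G G0 iG Gub.
have -> : (\int[mu]_(y in A) partial1of2 (fun (t : R) x => g (x + t *: v)) s y)%R =
    (\int[mu]_(x in A) 'D_v g (x + s *: v))%R.
  by apply: eq_Rintegral => x _; exact: derive_line.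
by rewrite derive1E => <- h; apply: DeriveDef.
Qed.

End integration.

(** * Perimeter *)

Section divergence_theorem.
Variables (R : realType) (n : nat) (i0 : 'I_n).
Local Notation V := 'rV[R]_n.
Local Notation mu := (@Leb R n).
Implicit Types (f g : V -> R) (x v c : V) (A : set V) (phi psi : V -> V).

Lemma integral_sum_bdd_supp A (I : Type) (s : seq I) (F : I -> V -> R) :
  measurable_set A -> (forall i, continuous (F i)) -> (forall i, bdd_supp (F i)) ->
  (\int[mu]_(x in A) (\sum_(i <- s) F i x) = \sum_(i <- s) \int[mu]_(x in A) F i x)%R.
Proof.
move=> mA cF sF.
have sumP : continuous (fun x => \sum_(i <- s) F i x) /\
    bdd_supp (fun x => \sum_(i <- s) F i x) /\
  (\int[mu]_(x in A) (\sum_(i <- s) F i x) = \sum_(i <- s) \int[mu]_(x in A) F i x)%R.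
  elim: s => [|i s [cs [[M sM] IH]]].
    split; [|split].
    - by under eq_fun do rewrite big_nil; exact: cst_continuous.
    - by exists 0 => x _; rewrite big_nil.
    - rewrite big_nil; under eq_Rintegral do rewrite big_nil.
      by rewrite Rintegral_cst// mul0r.
  have [N sN] := sF i; split; [|split].
  - by under eq_fun do rewrite big_cons; exact: continuous_addf.
  - exists (Num.max M N) => x; rewrite gt_max => /andP[xM xN].
    by rewrite big_cons sM// sN// addr0.
  - rewrite big_cons -IH; under eq_Rintegral do rewrite big_cons.
    rewrite RintegralD//; apply: continuous_bdd_supp_integrable => //.
    by exists M.
by case: sumP => _ [].
Qed.

Lemma integral_scale (k : R) f : continuous f -> bdd_supp f ->
  (\int[mu]_x (k * f x) = k * \int[mu]_x f x)%R.
Proof.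
move=> cf sf; apply: RintegralZl => //.
by apply: continuous_bdd_supp_integrable => //; exact: measurableT.
Qed.

(** The functions [a] and [b] will be divergences. *)
Lemma integral_le_up_to_null f g a b : continuous f -> bdd_supp f ->
  continuous g -> bdd_supp g -> continuous a -> bdd_supp a ->
  continuous b -> bdd_supp b ->
  (\int[mu]_x a x = 0)%R -> (\int[mu]_x b x = 0)%R ->
  (forall x, f x <= a x + (g x - b x)) ->
  (\int[mu]_x f x <= \int[mu]_x g x)%R.
Proof.
move=> cf sf cg sg ca sa cb sb a0 b0 fle.
have int h : continuous h -> bdd_supp h ->
    mu.-integrable [set: Rn R n] (EFin \o (h : Rn R n -> R)).
  by move=> ch sh; apply: continuous_bdd_supp_integrable => //; exact: measurableT.
have igb : mu.-integrable [set: Rn R n] (EFin \o ((fun x => g x - b x) : Rn R n -> R)).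
  by apply: (integrableB measurableT (int g cg sg) (int b cb sb)).
have iagb : mu.-integrable [set: Rn R n]
    (EFin \o ((fun x => a x + (g x - b x)) : Rn R n -> R)).
  by apply: (integrableD measurableT (int a ca sa) igb).
apply: (@le_trans _ _ (\int[mu]_x (a x + (g x - b x)))%R).
  by apply: (le_Rintegral measurableT (int f cf sf) iagb) => x _; exact: fle.
rewrite (RintegralD measurableT (int a ca sa) igb).
by rewrite (RintegralB measurableT (int g cg sg) (int b cb sb)) a0 b0 add0r subr0.
Qed.

(** The integral of the translates of [g] is constant. *)
Lemma integral_derive0 g v : C1 g -> bdd_supp g -> (\int[mu]_x 'D_v g x = 0)%R.
Proof.
move=> Cg sg.
have := @derive_integral_translate R n setT g v 0 measurableT Cg sg.
under eq_Rintegral => x _ do rewrite scale0r addr0.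
rewrite (_ : (fun t : R => _) = cst (\int[mu]_x g x)%R); last first.
  apply/funext => t; apply: integral_translate => //; exact: C1_continuous.
by move=> h; rewrite -(@derive_val _ _ _ _ _ _ _ h) derive_cst.
Qed.

Lemma integral_divergence A phi : measurable_set A -> C1c phi ->
  (\int[mu]_(x in A) divergence phi x =
   \sum_(i < n) \int[mu]_(x in A) 'D_(delta_mx 0 i) (fun y => phi y 0 i) x)%R.
Proof.
move=> mA Cphi; have [M sM] := C1c_bdd_supp Cphi.
rewrite -integral_sum_bdd_supp//.
- apply: eq_Rintegral => x _; rewrite divergenceE//; by case: Cphi.
- by move=> i; apply (C1c_coord i Cphi).
- by move=> i; apply: bdd_supp_derive; exists M => x /sM ->; rewrite mxE.
Qed.

Lemma integral_divergence0 phi : C1c phi -> (\int[mu]_x divergence phi x = 0)%R.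
Proof.
move=> Cphi; have [M sM] := C1c_bdd_supp Cphi.
rewrite integral_divergence//; last exact: measurableT.
apply: big1 => i _; apply: integral_derive0; first exact: C1c_coord.
by exists M => x /sM ->; rewrite mxE.
Qed.

Lemma integrable_divergence A phi : measurable_set A -> C1c phi ->
  mu.-integrable (A : set (Rn R n)) (EFin \o (divergence phi : Rn R n -> R)).
Proof.
move=> mA Cphi; apply: continuous_bdd_supp_integrable => //.
- exact: continuous_divergence.
- exact: bdd_supp_divergence.
Qed.

Lemma perimeter_ge A phi : measurable_set A -> C1c phi ->
  (forall x, enorm (phi x) <= 1) ->
  (((\int[mu]_(x in A) divergence phi x)%R)%:E <= perimeter A)%E.
Proof.
move=> mA Cphi phi1; apply: ereal_sup_ubound; exists phi => //.
rewrite fineK//; apply: integrable_fin_num => //; exact: integrable_divergence.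
Qed.

Lemma perimeter_le A (p : R) : measurable_set A ->
  (forall phi, C1c phi -> (forall x, enorm (phi x) <= 1) ->
    (\int[mu]_(x in A) divergence phi x)%R <= p) ->
  (perimeter A <= p%:E)%E.
Proof.
move=> mA h; apply: ge_ereal_sup => _ [phi [Cphi phi1] <-].
have := h phi Cphi phi1; rewrite -lee_fin fineK//.
by apply: integrable_fin_num => //; exact: integrable_divergence.
Qed.

End divergence_theorem.

Section radial_cutoff.
Variables (R : realType) (n : nat) (i0 : 'I_n).
Local Notation V := 'rV[R]_n.
Local Notation mu := (@Leb R n).
Local Notation "'e_ i" := (delta_mx 0 i : V) (at level 8, i at level 2).
Implicit Types (x v c : V).

Definition sqdist c x : R := dot (x - c) (x - c).

Lemma derive_affine (k l : R) (f : V -> R) x v : C1 f ->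
  'D_v (fun y => k * f y + l) x = k * 'D_v f x.
Proof.
move=> Cf; have h := is_deriveD (is_deriveZ k (derivableP (@C1_derivable R n f x v Cf)))
  (is_derive_cst l x v).
by have := @derive_val _ _ _ _ _ _ _ h; rewrite addr0.
Qed.

Lemma C1_subcoord c i : C1 (fun x : V => (x - c) 0 i).
Proof.
rewrite (_ : (fun x : V => _) = (fun x => x 0 i + - c 0 i)).
  by apply: C1_add; [exact: C1_coord|exact: C1_cst].
by apply/funext => x; rewrite !mxE.
Qed.

Lemma derive_subcoord c i x v : 'D_v (fun x : V => (x - c) 0 i) x = v 0 i.
Proof.
transitivity ('D_v (fun y : V => y 0 i) (x + - c)); last exact: derive_coord.
exact: (@derive_translate R n (fun y => y 0 i) (- c) x v).
Qed.

Lemma C1_sqdist c : C1 (sqdist c).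
Proof. by apply: C1_sum => i; apply: C1_mul; exact: C1_subcoord. Qed.

Lemma derive_sqdist c x v : 'D_v (sqdist c) x = 2 * dot (x - c) v.
Proof.
have -> : sqdist c = \sum_(i < n) ((fun x : V => (x - c) 0 i) * (fun x : V => (x - c) 0 i)).
  by apply/funext => y; rewrite fct_sumE.
rewrite derive_sum; last first.
  by move=> i; apply: derivableM; apply: C1_derivable; exact: C1_subcoord.
rewrite mulr_sumr; apply: eq_bigr => i _.
rewrite deriveM; [|by apply: C1_derivable; exact: C1_subcoord..].
rewrite derive_subcoord.
change ((x - c) 0 i * v 0 i + (x - c) 0 i * v 0 i = 2 * ((x - c) 0 i * v 0 i)).
by rewrite -mulr2n mulr_natl.
Qed.

(** Equal to one on the ball, zero outside the ball of squared radius
    [r ^+ 2 * (1 + e)]. *)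
Definition cutoff c (r e : R) x : R :=
  pos2 (1 - pos2 ((sqdist c x / r ^+ 2 - 1) / e)).

(** The gradient of the cutoff is this multiple of [- (x - c)]. *)
Definition cutoff_slope c (r e : R) x : R :=
  8 * Num.max 0 (1 - pos2 ((sqdist c x / r ^+ 2 - 1) / e)) *
  Num.max 0 ((sqdist c x / r ^+ 2 - 1) / e) / (r ^+ 2 * e).

Variables (c : V) (r e : R).
Hypotheses (r0 : 0 < r) (e0 : 0 < e).
Local Notation arg := (fun x => (sqdist c x / r ^+ 2 - 1) / e).

Let C1_arg : C1 arg.
Proof.
rewrite (_ : arg = fun x => e^-1 * (r ^- 2 * sqdist c x + - 1)).
  by apply: C1_scale; apply: C1_add; [apply: C1_scale; exact: C1_sqdist|exact: C1_cst].
by apply/funext => x; rewrite mulrC [_ / _ ^+ _]mulrC.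
Qed.

Let C1_inner : C1 (fun x => 1 - pos2 (arg x)).
Proof.
rewrite (_ : (fun x => _) = fun x => 1 + (- 1) * pos2 (arg x)).
  apply: C1_add; first exact: C1_cst.
  by apply: C1_scale; apply: C1_pos2; exact: C1_arg.
by apply/funext => x; rewrite mulN1r.
Qed.

Lemma C1_cutoff : C1 (cutoff c r e).
Proof. exact: C1_pos2. Qed.

Lemma cutoff_ge0 x : 0 <= cutoff c r e x. Proof. exact: pos2_ge0. Qed.

Lemma cutoff_le1 x : cutoff c r e x <= 1.
Proof. by apply: pos2_le1; rewrite gerBl pos2_ge0. Qed.

Let arg_le0 x : sqdist c x <= r ^+ 2 -> arg x <= 0.
Proof.
move=> h; rewrite pmulr_lle0 ?invr_gt0// subr_le0.
by rewrite ler_pdivrMr ?exprn_gt0// mul1r.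
Qed.

Let arg_ge1 x : r ^+ 2 * (1 + e) <= sqdist c x -> 1 <= pos2 (arg x).
Proof.
move=> h.
have a1 : 1 <= arg x.
  rewrite ler_pdivlMr// mul1r lerBrDl ler_pdivlMr ?exprn_gt0//.
  by rewrite mulrC.
rewrite /pos2 max_r ?(le_trans ler01)//.
by rewrite expr_ge1// (le_trans ler01).
Qed.

Lemma cutoff1 x : sqdist c x <= r ^+ 2 -> cutoff c r e x = 1.
Proof.
move=> /arg_le0 h; by rewrite /cutoff (pos2_le0 h) subr0 /pos2 max_r ?expr1n.
Qed.

Lemma cutoff0 x : r ^+ 2 * (1 + e) <= sqdist c x -> cutoff c r e x = 0.
Proof. by move=> /arg_ge1 h; rewrite /cutoff pos2_le0// subr_le0. Qed.

Lemma cutoff_slope_ge0 x : 0 <= cutoff_slope c r e x.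
Proof.
rewrite divr_ge0//; last by rewrite mulr_ge0 ?exprn_ge0// ltW.
by rewrite !mulr_ge0// le_max lexx.
Qed.

Lemma cutoff_slope_in x : sqdist c x <= r ^+ 2 -> cutoff_slope c r e x = 0.
Proof.
move=> /arg_le0 h.
by rewrite /cutoff_slope (max_l h) mulr0 mul0r.
Qed.

Lemma cutoff_slope_out x : r ^+ 2 * (1 + e) <= sqdist c x ->
  cutoff_slope c r e x = 0.
Proof.
move=> /arg_ge1 h; rewrite /cutoff_slope.
by rewrite (@max_l _ _ 0 (1 - _)) ?subr_le0// mulr0 !mul0r.
Qed.

Lemma derive_cutoff x v :
  'D_v (cutoff c r e) x = - cutoff_slope c r e x * dot (x - c) v.
Proof.
rewrite derive_pos2; last by apply C1_inner.
have -> : (fun x => 1 - pos2 (arg x)) = (fun x => - 1 * pos2 (arg x) + 1).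
  by apply/funext => y; rewrite mulN1r addrC.
rewrite derive_affine; last exact: C1_pos2.
rewrite derive_pos2; last by apply C1_arg.
have -> : arg = (fun x => (r ^+ 2 * e)^-1 * sqdist c x + - e^-1).
  by apply/funext => y; rewrite mulrBl mul1r -mulrA -invfM mulrC.
rewrite derive_affine; last exact: C1_sqdist.
rewrite derive_sqdist /cutoff_slope.
ring.
Qed.

Lemma bdd_supp_cutoff (W : zmodType) (F : V -> W) :
  (forall x, cutoff c r e x = 0 -> F x = 0) -> bdd_supp F.
Proof.
move=> F0; exists (enorm c + r * (1 + e)) => x xM; apply/F0/cutoff0.
have := ler_enormB x c => h1.
have h2 : r * (1 + e) <= enorm (x - c) by lra.
rewrite /sqdist -sqr_enorm.
apply: (@le_trans _ _ ((r * (1 + e)) ^+ 2)).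
  rewrite exprMn; apply: (ler_wpM2l (exprn_ge0 2 (ltW r0))).
  by rewrite ler_eXnr// lerDl ltW.
have re0 : 0 <= r * (1 + e) by rewrite mulr_ge0 ?(ltW r0)// addr_ge0// ltW.
by rewrite lerXn2r ?nnegrE ?enorm_ge0 ?re0.
Qed.

Lemma divergence_cutoff_radial x :
  divergence (fun y => cutoff c r e y *: (y - c)) x =
  n%:R * cutoff c r e x - cutoff_slope c r e x * sqdist c x.
Proof.
rewrite divergence_scale; [|exact: C1_cutoff|exact: C1_subcoord].
congr (_ + _).
  rewrite (eq_bigr (fun=> 1)) => [|i _].
    by rewrite sumr_const card_ord mulrC.
  by rewrite derive_subcoord mxE !eqxx.
rewrite /sqdist /dot mulr_sumr -sumrN; apply: eq_bigr => i _.
rewrite derive_cutoff /dot (bigD1 i)//= big1 => [|j ji]; last first.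
  by rewrite [delta_mx _ _ _ _]mxE (negPf ji) andbF mulr0.
rewrite !mxE !eqxx /= mulr1n; ring.
Qed.

Lemma divergence_cutoff (phi : V -> V) x : C1c phi ->
  divergence (fun y => cutoff c r e y *: phi y) x =
  cutoff c r e x * divergence phi x - cutoff_slope c r e x * dot (phi x) (x - c).
Proof.
move=> Cphi; rewrite divergence_scale; [|exact: C1_cutoff|by move=> i; exact: C1c_coord].
rewrite divergenceE; last by case: Cphi.
congr (_ + _); rewrite /dot mulr_sumr -sumrN; apply: eq_bigr => i _.
rewrite derive_cutoff /dot (bigD1 i)//= big1 => [|j ji]; last first.
  by rewrite [delta_mx _ _ _ _]mxE (negPf ji) andbF mulr0.
rewrite !mxE !eqxx /= mulr1n; ring.
Qed.

Lemma C1c_cutoff_radial : C1c (fun y => cutoff c r e y *: (y - c)).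
Proof.
apply: C1c_intro; last by apply: bdd_supp_cutoff => x ->; rewrite scale0r.
move=> i; rewrite (_ : (fun x => _) = fun x => cutoff c r e x * (x - c) 0 i).
  by apply: C1_mul; [exact: C1_cutoff|exact: C1_subcoord].
by apply/funext => x; rewrite mxE.
Qed.

Lemma C1c_cutoff_scale (phi : V -> V) : C1c phi ->
  C1c (fun y => cutoff c r e y *: phi y).
Proof.
move=> Cphi; apply: C1c_intro; last by apply: bdd_supp_cutoff => x ->; rewrite scale0r.
move=> i; rewrite (_ : (fun x => _) = fun x => cutoff c r e x * phi x 0 i).
  by apply: C1_mul; [exact: C1_cutoff|exact: C1c_coord].
by apply/funext => x; rewrite mxE.
Qed.

(** The divergence theorem, tested against the cutoff: where the cutoff varies
    one has [r <= enorm (x - c)], so [phi . (x - c) <= sqdist c x / r]. *)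
Lemma integral_cutoff_divergence_le (phi : V -> V) : C1c phi ->
  (forall x, enorm (phi x) <= 1) ->
  (\int[mu]_x (cutoff c r e x * divergence phi x) <=
   n%:R / r * \int[mu]_x cutoff c r e x)%R.
Proof.
move=> Cphi phi1.
have cc : continuous (cutoff c r e) by exact/C1_continuous/C1_cutoff.
rewrite -integral_scale; [|exact: cc|exact: bdd_supp_cutoff].
apply: (@integral_le_up_to_null _ _ _ (fun x => n%:R / r * cutoff c r e x)
  (divergence (fun y => cutoff c r e y *: phi y))
  (fun x => r^-1 * divergence (fun y => cutoff c r e y *: (y - c)) x)).
- by apply: continuous_mulf => //; exact: continuous_divergence.
- by apply: bdd_supp_cutoff => x ->; rewrite mul0r.
- by apply: continuous_mulf => //; exact: cst_continuous.
- by apply: bdd_supp_cutoff => x ->; rewrite mulr0.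
- exact/continuous_divergence/C1c_cutoff_scale.
- exact/bdd_supp_divergence/C1c_cutoff_scale.
- apply: continuous_mulf; first exact: cst_continuous.
  exact/continuous_divergence/C1c_cutoff_radial.
- have [M sM] := bdd_supp_divergence C1c_cutoff_radial.
  by exists M => x /sM ->; rewrite mulr0.
- exact/integral_divergence0/C1c_cutoff_scale.
- rewrite integral_scale.
  + by rewrite integral_divergence0 ?mulr0//; exact: C1c_cutoff_radial.
  + exact/continuous_divergence/C1c_cutoff_radial.
  + exact/bdd_supp_divergence/C1c_cutoff_radial.
move=> x; rewrite divergence_cutoff// divergence_cutoff_radial.
set K := cutoff_slope c r e x; set s := sqdist c x.
have K0 : 0 <= K by exact: cutoff_slope_ge0.
suff : K * dot (phi x) (x - c) <= r^-1 * (K * s) by lra.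
rewrite mulrCA; have [rs|sr] := leP s (r ^+ 2).
  by rewrite /K cutoff_slope_in// !mul0r.
apply: ler_wpM2l => //; apply: le_trans (cauchy_schwarz _ _) _.
apply: (@le_trans _ _ (enorm (x - c))).
  by rewrite ler_piMl ?enorm_ge0.
rewrite /s /sqdist -sqr_enorm ler_pdivlMl// expr2 ler_wpM2r ?enorm_ge0//.
rewrite -(@ler_pXn2r _ 2)// ?nnegrE ?enorm_ge0 ?(ltW r0)// sqr_enorm; exact: ltW.
Qed.

End radial_cutoff.

Section ball_perimeter.
Variables (R : realType) (n : nat) (i0 : 'I_n).
Local Notation V := 'rV[R]_n.
Local Notation mu := (@Leb R n).
Implicit Types (x v c : V) (E : set V) (f : V -> R).

Lemma closed_eball_sqdist c (r : R) : 0 < r ->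
  closed_eball c r = [set x | sqdist c x <= r ^+ 2].
Proof.
by move=> r0; apply/seteqP; split => x; rewrite /closed_eball/= enorm_leP// ltW.
Qed.

Lemma measurable_closed_eball c (r : R) : measurable_set (closed_eball c r : set V).
Proof. by apply/closed_measurable_Rn/closed_closed_eball. Qed.

(** Sharpening the cutoff localizes an integral to the ball. *)
Lemma integral_cutoff_cvg c (r C : R) f : 0 < r -> continuous f ->
  (forall x, `|f x| <= C) ->
  (\int[mu]_x (cutoff c r k.+1%:R^-1 x * f x))%R @[k --> \oo] -->
  (\int[mu]_(x in closed_eball c r) f x)%R.
Proof.
move=> r0 cf fC.
have C0 : 0 <= C := le_trans (normr_ge0 _) (fC 0).
pose B : set (Rn R n) := closed_eball c r.
have mB : measurable B := measurable_closed_eball c r.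
rewrite [X in _ --> X]Rintegral_mkcond.
have k0 k : 0 < k.+1%:R^-1 :> R by rewrite invr_gt0.
pose G : V -> R := fun x => C * \1_(closed_eball c (2 * r)) x.
have cut_le k x : `|cutoff c r k.+1%:R^-1 x * f x| <= G x.
  rewrite normrM ger0_norm ?cutoff_ge0// /G indicE.
  case: (boolP (x \in _)) => xB; first by rewrite mulr1 -[leRHS]mul1r ler_pM ?cutoff_ge0 ?cutoff_le1.
  rewrite cutoff0 ?mul0r ?mulr0//.
  rewrite leNgt; apply: contra xB => h; rewrite inE closed_eball_sqdist ?mulr_gt0//=.
  apply: le_trans (ltW h) _; rewrite exprMn mulrC ler_wpM2r ?exprn_ge0 ?(ltW r0)//.
  have : k.+1%:R^-1 <= 1 :> R by rewrite invf_le1// ler1n.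
  by move: (k.+1%:R^-1) => z; lra.
have iG : mu.-integrable [set: Rn R n] (EFin \o (G : Rn R n -> R)).
  apply: (@bounded_supp_integrable R n setT G C (enorm c + 2 * r) measurableT).
  - by apply: measurable_funM => //; apply: (@measurable_indic _ (Rn R n) R); exact: measurable_closed_eball.
  - move=> x; rewrite /G indicE; case: (_ \in _); rewrite ?mulr1 ?mulr0 ?normr0//.
    by rewrite ger0_norm.
  - move=> x xr; rewrite /G indicE memNset ?mulr0// /closed_eball/= => h.
    by have := ler_enormB x c; lra.
have mcut k : measurable_fun [set: Rn R n]
    (EFin \o ((fun x => cutoff c r k.+1%:R^-1 x * f x) : Rn R n -> R)).
  apply/measurable_EFinP/continuous_measurable_Rn/continuous_mulf => //.
  exact/C1_continuous/C1_cutoff.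
have lim x : cutoff c r k.+1%:R^-1 x * f x @[k --> \oo] --> (f \_ B) x.
  rewrite patchE; case: (boolP (x \in B)) => xB.
    rewrite (_ : (fun k => _) = cst (f x)); first exact: cvg_cst.
    apply/funext => k; rewrite cutoff1 ?mul1r//.
    by move: xB; rewrite inE /B closed_eball_sqdist.
  have rx : r ^+ 2 < sqdist c x.
    by rewrite ltNge; apply: contra xB => h; rewrite inE /B closed_eball_sqdist.
  have d0 : 0 < sqdist c x / r ^+ 2 - 1 by rewrite subr_gt0 ltr_pdivlMr ?exprn_gt0// mul1r.
  have [N _ hN] := near_infty_natSinv_lt (PosNum d0).
  apply: cvg_near_cst; exists N => // k /= Nk.
  transitivity (0 : R); last by [].
  rewrite (cutoff0 r0 (k0 k)) ?mul0r// mulrC -ler_pdivlMr ?exprn_gt0// -lerBrDl.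
  exact/ltW/hN.
rewrite /Rintegral; apply: fine_cvg.
have step := @dominated_cvg _ (Rn R n) R mu setT measurableT
  (fun k x => (cutoff c r k.+1%:R^-1 x * f x)%:E) (fun x => ((f \_ B) x)%:E) (EFin \o G) mcut.
rewrite fineK; last first.
  apply: integrable_fin_num => //; apply: (le_integrable measurableT _ _ iG).
    apply/measurable_EFinP; apply/(measurable_restrictT _ mB).
    exact: continuous_measurable_Rn.
  move=> x _; rewrite /= lee_fin (ger0_norm (_ : 0 <= G x)) ?mulr_ge0//.
  rewrite patchE; case: (boolP (x \in _)) => xB; last first.
    by change (`|0 : R| <= G x); rewrite normr0 mulr_ge0.
  rewrite /G indicE mem_set ?mulr1//.
  by move: xB; rewrite inE /closed_eball/= => /le_trans; apply; lra.
apply: step.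
- by move=> x _; apply: cvg_EFin; [exact: nearW|exact: lim].
- by [].
- exact: iG.
- by move=> k x _; rewrite lee_fin; exact: cut_le.
Qed.

(** Gauss' theorem for a ball as a limit of [integral_cutoff_divergence_le],
    which involves no boundary integral. *)
Lemma perimeter_closed_eball_le c (r : R) : 0 < r ->
  (perimeter (closed_eball c r) <= (n%:R / r * fine (mu (closed_eball c r)))%:E)%E.
Proof.
move=> r0; apply: perimeter_le; first exact: measurable_closed_eball.
move=> phi Cphi phi1.
have k0 k : 0 < k.+1%:R^-1 :> R by rewrite invr_gt0.
have cd := continuous_divergence Cphi.
have [C C0 dC] := continuous_bdd_supp_bounded cd (bdd_supp_divergence Cphi).
have l1 := @integral_cutoff_cvg c r C _ r0 cd dC.
have c1 : continuous (fun _ : V => 1 : R) by exact: cst_continuous.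
have l2 := @integral_cutoff_cvg c r 1 (fun _ => 1) r0 c1 _.
have {}l2 := l2 (fun _ => eq_ind_r (fun z => z <= 1) (lexx 1) (normr1 R)).
have e2 : (\int[mu]_(x in closed_eball c r) 1)%R = fine (mu (closed_eball c r)).
  by rewrite Rintegral_cst ?mul1r//; exact: measurable_closed_eball.
rewrite e2 in l2.
have l3 : (n%:R / r * \int[mu]_x (cutoff c r k.+1%:R^-1 x * 1))%R @[k --> \oo] -->
    n%:R / r * fine (mu (closed_eball c r)).
  by apply: cvgM; [exact: cvg_cst|exact: l2].
apply: (ler_cvg_to l1 l3); apply: nearW => k /=.
under [X in _ <= _ * X]eq_Rintegral do rewrite mulr1.
exact: integral_cutoff_divergence_le.
Qed.

End ball_perimeter.

Section calibration.
Variables (R : realType) (n : nat) (i0 : 'I_n).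
Local Notation V := 'rV[R]_n.
Local Notation mu := (@Leb R n).
Implicit Types (x v c : V) (E : set V) (psi : V -> V).

(** The radial fields of two balls calibrate [E]: if the perimeter of [E] does
    not exceed what they give, then no competitor supported inside one of the
    balls, where the field is shorter than one, can improve on them. *)
Lemma calibrated_variation_le E (c1 c2 : V) (r rho : R) psi :
  measurable_set E -> 0 < r -> 2 * r < enorm (c1 - c2) -> 0 <= rho < r ->
  E `<=` closed_eball c1 r `|` closed_eball c2 r ->
  (perimeter E <= (n%:R / r * fine (mu E))%:E)%E ->
  C1c psi -> (forall x, rho < enorm (x - c1) -> psi x = 0) ->
  (forall x, enorm (psi x) <= 1 - rho / r) ->
  (\int[mu]_(x in E) divergence psi x)%R <= 0.
Proof.
move=> mE r0 c12 /andP[rho0 rhor] EB PE Cpsi psi0 psi1.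
set I := (\int[mu]_(x in E) divergence psi x)%R.
set m := fine (mu E) in PE.
have Eoo : (mu E < +oo)%E.
  apply: (@le_lt_trans _ _ (mu (closed_eball c1 r) + mu (closed_eball c2 r))%E).
    by apply: le_trans (outer_measureU2 _ _ _); apply: le_outer_measure.
  by rewrite lte_add_pinfty// outer_closed_eball_lty.
have m0 : 0 <= m by rewrite fine_ge0// outer_measure_ge0.
have key d : 0 < d < 1 -> I <= d * (n%:R / r * m).
  move=> /andP[d0 d1].
  (* the radial fields are shrunk by the factor [1 - d], which leaves room to
     cut them off in a shell of thickness governed by [e]: there they are not
     longer than one by the first condition on [e], and by the second one the
     supports of the two fields do not meet *)
  have [e [e0 e1 e2]] : exists e : R,
      [/\ 0 < e, (1 - d) ^+ 2 * (1 + e) <= 1 & r ^+ 2 * (1 + e) <= (enorm (c1 - c2) / 2) ^+ 2].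
    exists (Num.min d ((enorm (c1 - c2) / 2) ^+ 2 / r ^+ 2 - 1)).
    have q0 : r ^+ 2 < (enorm (c1 - c2) / 2) ^+ 2.
      by rewrite ltrXn2r// ?nnegrE ?divr_ge0 ?enorm_ge0 ?(ltW r0)// ltr_pdivlMr// mulrC.
    split.
    - by rewrite lt_min d0 subr_gt0 ltr_pdivlMr ?exprn_gt0// mul1r.
    - apply: (@le_trans _ _ ((1 - d) ^+ 2 * (1 + d))); last by nra.
      by rewrite ler_wpM2l ?sqr_ge0// lerD2l ge_min lexx.
    - rewrite mulrC -ler_pdivlMr ?exprn_gt0// -lerBrDl ge_min lexx orbT//.
  pose et1 := cutoff c1 r e; pose et2 := cutoff c2 r e.
  pose ph x := et1 x *: (x - c1) + et2 x *: (x - c2).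
  pose k := (1 - d) / r.
  have k0 : 0 <= k by rewrite divr_ge0 ?(ltW r0)// subr_ge0 ltW.
  have far x : sqdist c1 x < r ^+ 2 * (1 + e) -> r ^+ 2 * (1 + e) <= sqdist c2 x.
    move=> h; apply: (le_trans e2).
    rewrite /sqdist -sqr_enorm lerXn2r ?nnegrE ?divr_ge0 ?enorm_ge0//.
    have h1 : enorm (x - c1) < enorm (c1 - c2) / 2.
      by rewrite enorm_ltP ?divr_ge0 ?enorm_ge0//; exact: lt_le_trans e2.
    have := ler_enormB (c1 - c2) (c1 - x).
    by rewrite opprB (addrC (c1 - c2)) addrA subrK (enorm_distC c1 x); lra.
  have Cr1 := C1c_cutoff_radial c1 r0 e0; have Cr2 := C1c_cutoff_radial c2 r0 e0.
  have Cph : C1c ph := C1c_add Cr1 Cr2.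
  have CF : C1c (fun x => k *: ph x + psi x) := C1c_add (C1c_scale k Cph) Cpsi.
  have re : r ^+ 2 < r ^+ 2 * (1 + e).
    by rewrite ltr_pMr ?exprn_gt0// ltrDl.
  have short c x t : 0 <= t <= 1 -> enorm (k *: (t *: (x - c))) <= k * enorm (x - c).
    move=> /andP[t0 t1]; rewrite !enormZ (ger0_norm k0) (ger0_norm t0).
    by rewrite ler_wpM2l// ler_piMl ?enorm_ge0.
  have aux c x t : sqdist c x < r ^+ 2 * (1 + e) -> 0 <= t <= 1 ->
      enorm (k *: (t *: (x - c))) <= 1.
    move=> h t01; apply: le_trans (short c x t t01) _.
    have kN0 : 0 <= k * enorm (x - c) by rewrite mulr_ge0 ?enorm_ge0.
    rewrite -(expr_le1 (ltn0Sn 1) kN0) exprMn sqr_enorm.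
    apply: le_trans e1; rewrite /k expr_div_n -mulrA ler_wpM2l ?sqr_ge0//.
    by rewrite ler_pdivrMl ?exprn_gt0// ltW.
  have et01 c x : 0 <= cutoff c r e x <= 1 by rewrite cutoff_ge0 cutoff_le1.
  have phle x : enorm (k *: ph x) <= 1 /\ (enorm (x - c1) <= rho -> enorm (k *: ph x) <= rho / r).
    have [h1|h1] := ltP (sqdist c1 x) (r ^+ 2 * (1 + e)).
      rewrite /ph (_ : et2 x = 0) ?scale0r ?addr0; last exact: cutoff0 (far _ h1).
      split; first exact: (aux c1 x _ h1 (et01 c1 x)).
      move=> xr; apply: le_trans (short _ _ _ (et01 c1 x)) _.
      apply: (@le_trans _ _ (k * rho)); first by rewrite ler_wpM2l.
      rewrite /k mulrAC ler_wpM2r ?invr_ge0 ?(ltW r0)// ler_piMl//; lra.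
    rewrite /ph (_ : et1 x = 0) ?scale0r ?add0r; last exact: cutoff0.
    split.
      have [h2|h2] := ltP (sqdist c2 x) (r ^+ 2 * (1 + e)).
        exact: (aux c2 x _ h2 (et01 c2 x)).
      by rewrite (_ : et2 x = 0) ?scale0r ?scaler0 ?enorm0//; exact: cutoff0.
    move=> xr; have := le_lt_trans xr rhor; rewrite enorm_ltP ?(ltW r0)// => h3.
    by have := lt_trans (le_lt_trans h1 h3) re; rewrite ltxx.
  have F1 x : enorm (k *: ph x + psi x) <= 1.
    apply: le_trans (ler_enormD _ _) _; have [p1 p2] := phle x.
    have [xr|rx] := leP (enorm (x - c1)) rho; last by rewrite psi0// enorm0 addr0.
    by have := p2 xr; have := psi1 x; lra.
  have dph x : E x -> divergence (fun x => k *: ph x) x = k * n%:R.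
    move=> Ex; have dp c : C1c (fun y => cutoff c r e y *: (y - c)) -> 
        differentiable (fun y => cutoff c r e y *: (y - c)) x by case.
    rewrite divergence_scale_cst; last by case: Cph.
    congr (_ * _); rewrite divergence_add; [|exact: dp|exact: dp].
    rewrite !divergence_cutoff_radial//.
    have [|] := EB _ Ex; rewrite closed_eball_sqdist//= => xB.
      have xo := far _ (le_lt_trans xB re).
      by rewrite cutoff1// cutoff_slope_in// cutoff0// cutoff_slope_out// !mul0r !subr0 mulr1 mulr0 addr0.
    have xo : r ^+ 2 * (1 + e) <= sqdist c1 x.
      rewrite leNgt; apply/negP => /far h.
      by have := lt_le_trans re (le_trans h xB); rewrite ltxx.
    rewrite [X in X - _ + _](_ : _ = 0); last by rewrite cutoff0// mulr0.
    by rewrite cutoff_slope_out// cutoff1// cutoff_slope_in// !mul0r !subr0 mulr1 add0r.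
  have := le_trans (perimeter_ge mE CF F1) PE.
  rewrite lee_fin (_ : (\int[mu]_(x in E) _)%R = k * n%:R * m + I); last first.
    have Ck := C1c_scale k Cph.
    transitivity (\int[mu]_(x in E) (divergence (fun x => k *: ph x) x + divergence psi x))%R.
      apply: eq_Rintegral => x _; apply: divergence_add; first by case: Ck.
      by case: Cpsi.
    rewrite (RintegralD mE (integrable_divergence mE Ck) (integrable_divergence mE Cpsi)).
    congr (_ + _); rewrite -(@Rintegral_cst _ (Rn R n) R mu E mE (k * n%:R)).
    by apply: eq_Rintegral => x; rewrite inE => /dph.
  rewrite /k; have -> : (1 - d) / r * n%:R * m = (1 - d) * (n%:R / r * m) by ring.
  lra.
rewrite leNgt; apply/negP => I0.
have nm0 : 0 <= n%:R / r * m by rewrite mulr_ge0// divr_ge0// ltW.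
set q := n%:R / r * m in key nm0.
have D0 : 0 < 2 * (q + I + 1) by lra.
have d0 : 0 < I / (2 * (q + I + 1)) by rewrite divr_gt0.
have d1 : I / (2 * (q + I + 1)) < 1 by rewrite ltr_pdivrMr// mul1r; lra.
have := key _ (introT andP (conj d0 d1)).
rewrite mulrAC ler_pdivlMr//; nra.
Qed.

End calibration.

(** * Inclusion up to null sets *)

Section essential_inclusion.
Variables (R : realType) (n : nat).
Local Notation V := 'rV[R]_n.
Local Notation mu := (@lebesgue_outer R n).
Implicit Types (A B C : set V).

Definition ess_sub A B := mu (A `\` B) = 0%E.

Lemma outer_null_sub A B : A `<=` B -> mu B = 0%E -> mu A = 0%E.
Proof.
move=> AB B0; apply/eqP; rewrite eq_le outer_measure_ge0 andbT -B0.
exact: le_outer_measure.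
Qed.

Lemma outer_null_setU A B : mu A = 0%E -> mu B = 0%E -> mu (A `|` B) = 0%E.
Proof.
move=> A0 B0; apply/eqP; rewrite eq_le outer_measure_ge0 andbT.
by apply: (le_trans (outer_measureU2 _ _ _)); rewrite [X in (X + _)%E]A0 [X in (_ + X)%E]B0 adde0.
Qed.

Lemma outer_null_bigcup (F : nat -> set V) :
  (forall k, mu (F k) = 0%E) -> mu (\bigcup_k F k) = 0%E.
Proof.
move=> F0; apply/eqP; rewrite eq_le outer_measure_ge0 andbT.
by apply: (le_trans (outer_measure_sigma_subadditive mu F)); rewrite eseries0// => k _ _; exact: F0.
Qed.

Lemma subset_ess_sub A B : A `<=` B -> ess_sub A B.
Proof. by rewrite -setD_eq0 /ess_sub => ->; exact: outer_measure0. Qed.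

Lemma ess_sub_trans A B C : ess_sub A B -> ess_sub B C -> ess_sub A C.
Proof.
move=> AB BC; apply: outer_null_sub (outer_null_setU AB BC) => x [Ax Cx].
by have [Bx|Bx] := pselect (B x); [right|left].
Qed.

Lemma ess_subU A B C : ess_sub A C -> ess_sub B C -> ess_sub (A `|` B) C.
Proof.
by move=> hA hB; apply: outer_null_sub (outer_null_setU hA hB) => x [[h|h] nC]; [left|right].
Qed.

Lemma ess_sub_le A B : ess_sub A B -> (mu A <= mu B)%E.
Proof.
move=> AB; apply: (@le_trans _ _ (mu (B `|` (A `\` B)))).
  by apply: le_outer_measure => x Ax; have [|] := pselect (B x); [left|right].
by apply: (le_trans (outer_measureU2 _ _ _)); rewrite [X in (_ + X)%E]AB adde0.
Qed.

Lemma ess_sub_outer_eq A B : ess_sub A B -> ess_sub B A -> mu A = mu B.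
Proof. by move=> AB BA; apply/eqP; rewrite eq_le !ess_sub_le. Qed.

Lemma ess_sub_eq_measure A B : measurable_set A -> ess_sub A B ->
  mu A = mu B -> (mu B < +oo)%E -> ess_sub B A.
Proof.
move=> mA AB eqAB Boo; rewrite /ess_sub.
have fA : mu A \is a fin_num by rewrite eqAB ge0_fin_numE// outer_measure_ge0.
have E1 : (mu B = mu (B `&` A) + mu (B `\` A))%E by exact: mA.
have E2 : (mu A <= mu (B `&` A))%E.
  apply: (@le_trans _ _ (mu ((B `&` A) `|` (A `\` B)))).
    by apply: le_outer_measure => x Ax; have [|] := pselect (B x); [left|right].
  by apply: (le_trans (outer_measureU2 _ _ _)); rewrite [X in (_ + X)%E]AB adde0.
have : (mu A + mu (B `\` A) <= mu A + 0)%E.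
  by rewrite adde0 [leRHS]eqAB [leRHS]E1 leeD2r.
rewrite leeD2lE// => le0; apply/eqP; rewrite eq_le le0; exact: outer_measure_ge0.
Qed.

Lemma ae_outer (P : set V) :
  {ae @Leb R n, forall x, P x} <-> mu (~` P) = 0%E.
Proof.
split=> [[N [mN N0 PN]]|P0]; first exact: outer_null_sub PN N0.
by exists (~` P); split => //; exact: outer0_measurable.
Qed.

Lemma ess_eq_setP A B : ess_eq_set A B <-> ess_sub A B /\ ess_sub B A.
Proof.
rewrite /ess_eq_set ae_outer; split=> [h|[AB BA]].
  by split; apply: outer_null_sub h => x [h1 h2] h; apply: h2; apply/h.
apply: outer_null_sub (outer_null_setU AB BA) => x /= h.
have [Ax|Ax] := pselect (A x); have [Bx|Bx] := pselect (B x); [|by left|by right|];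
  by exfalso; apply: h; split.
Qed.

End essential_inclusion.

(** * Rigidity of calibrated sets *)

Section rigidity.
Variables (R : realType) (n : nat) (i0 : 'I_n).
Local Notation V := 'rV[R]_n.
Local Notation mu := (@lebesgue_outer R n).
Local Notation leb := (@Leb R n).
Implicit Types (a b x y v c : V) (E : set V) (g : V -> R).

(** Increases to the indicator function of the open box as [k] grows. *)
Definition bump a b (k : R) x : R :=
  1 - pos2 (1 - k * \prod_(i < n) pos2 ((x 0 i - a 0 i) * (b 0 i - x 0 i))).

Lemma C1_bump a b k : C1 (bump a b k).
Proof.
have C1opp (f : V -> R) : C1 f -> C1 (fun x => 1 - f x).
  move=> Cf; rewrite (_ : (fun x => _) = (fun x => 1 + (- 1) * f x)).
    by apply: C1_add; [exact: C1_cst|exact: C1_scale].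
  by apply/funext => x; rewrite mulN1r.
apply: (C1opp); apply: C1_pos2; apply: (C1opp); apply: C1_scale; apply: C1_prod => i.
apply: C1_pos2; apply: C1_mul.
  exact: (C1_add (@C1_coord R n i) (@C1_cst R n (- a 0 i))).
rewrite (_ : (fun x => _) = (fun x : V => b 0 i + (- 1) * x 0 i)).
  by apply: C1_add; [exact: C1_cst|apply: C1_scale; exact: C1_coord].
by apply/funext => x; rewrite mulN1r.
Qed.

Lemma bump_ge0 a b k x : 0 <= k -> 0 <= bump a b k x.
Proof.
move=> k0; rewrite subr_ge0 pos2_le1// gerBl mulr_ge0//.
by apply: prodr_ge0 => i _; exact: pos2_ge0.
Qed.

Lemma bump_le1 a b k x : bump a b k x <= 1.
Proof. by rewrite gerBl pos2_ge0. Qed.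

Lemma bump_out a b k x : rle a b -> ~ obox a b x -> bump a b k x = 0.
Proof.
move=> ab /existsNP[i /negP xi]; rewrite /bump (bigD1 i)//=.
rewrite (@pos2_le0 R ((x 0 i - a 0 i) * (b 0 i - x 0 i))).
  by rewrite mul0r mulr0 subr0 /pos2 max_r// expr1n subrr.
by have := ab i; move: xi; rewrite negb_and -!leNgt => /orP[h|h] h2; nra.
Qed.

Lemma bump_in a b x : obox a b x ->
  exists N : nat, forall k, (N <= k)%N -> bump a b k%:R x = 1.
Proof.
move=> abx; set p := \prod_(i < n) pos2 ((x 0 i - a 0 i) * (b 0 i - x 0 i)).
have p0 : 0 < p.
  apply: prodr_gt0 => i _; apply: pos2_gt0; have /andP[h1 h2] := abx i.
  by rewrite mulr_gt0// subr_gt0.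
exists (Num.truncn p^-1).+1 => k Nk; rewrite /bump -/p pos2_le0 ?subr0//.
rewrite subr_le0 -ler_pdivrMr// mul1r.
apply: (@le_trans _ _ ((Num.truncn p^-1).+1)%:R); last by rewrite ler_nat.
by have := truncn_itv (ltW (_ : 0 < p^-1)); rewrite invr_gt0 => /(_ p0)/andP[_ /ltW].
Qed.

Lemma bump_translate a b k v x : bump (a + v) (b + v) k x = bump a b k (x - v).
Proof.
rewrite /bump; congr (1 - pos2 (1 - _ * _)); apply: eq_bigr => i _.
by rewrite !mxE; congr (pos2 (_ * _)); ring.
Qed.

Lemma obox_enorm a b x : obox a b x ->
  enorm x <= Num.sqrt (\sum_(i < n) (`|a 0 i| + `|b 0 i|) ^+ 2).
Proof.
move=> abx; rewrite /enorm ler_sqrt; last by apply: sumr_ge0 => i _; exact: sqr_ge0.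
apply: ler_sum => i _; rewrite -expr2 -(real_normK (num_real (x 0 i))).
rewrite lerXn2r ?nnegrE ?addr_ge0//; have := abx i.
have := ler_norm (- a 0 i); have := ler_norm (b 0 i); rewrite normrN.
have := normr_ge0 (a 0 i); have := normr_ge0 (b 0 i) => h1 h2 h3 h4 h5.
by rewrite ler_norml; lra.
Qed.

Lemma bdd_supp_bump a b k : rle a b -> bdd_supp (bump a b k).
Proof.
move=> ab; exists (Num.sqrt (\sum_(i < n) (`|a 0 i| + `|b 0 i|) ^+ 2)) => x xM.
by apply: bump_out => // /obox_enorm; rewrite leNgt xM.
Qed.

Lemma integral_bump_cvg E a b : measurable_set E -> rle a b ->
  (\int[leb]_(x in E) bump a b k%:R x)%R @[k --> \oo] -->
  fine (mu (E `&` obox a b)).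
Proof.
move=> mE ab.
have mO : measurable_set (obox a b) by exact: measurable_obox.
have Ooo : (mu (obox a b `&` E) < +oo)%E.
  apply: le_lt_trans (outer_hbox_lty a b); apply: le_outer_measure => x [abx _] i.
  by have /andP[/ltW -> ->] := abx i.
have -> : fine (mu (E `&` obox a b)) = (\int[leb]_(x in E) \1_(obox a b : set (Rn R n)) x)%R.
  by rewrite /Rintegral (integral_indic _ mE mO) setIC.
pose G : V -> R := \1_(obox a b).
have iG : leb.-integrable (E : set (Rn R n)) (EFin \o (G : Rn R n -> R)).
  have [M sM] := @bdd_supp_bump a b 1 ab.
  apply: (@bounded_supp_integrable R n E G 1 (Num.sqrt (\sum_(i < n) (`|a 0 i| + `|b 0 i|) ^+ 2)) mE).
  - exact: (@measurable_indic _ (Rn R n) R).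
  - by move=> x; rewrite /G indicE; case: (_ \in _); rewrite ?normr1 ?normr0.
  - by move=> x xM; rewrite /G indicE memNset// => /obox_enorm; rewrite leNgt xM.
rewrite /Rintegral; apply: fine_cvg; rewrite fineK; last exact: integrable_fin_num.
have step := @dominated_cvg _ (Rn R n) R leb E mE
  (fun k x => (bump a b k%:R x)%:E) (fun x => (G x)%:E) (EFin \o G).
apply: step.
- move=> k; apply/measurable_EFinP/continuous_measurable_Rn.
  exact/C1_continuous/C1_bump.
- move=> x _; apply: cvg_EFin; first exact: nearW.
  have [abx|abx] := pselect (obox a b x).
    have [N hN] := bump_in abx; apply: cvg_near_cst; exists N => // k /= Nk.
    by rewrite hN// /G indicE mem_set.
  by apply: cvg_near_cst; apply: nearW => k /=; rewrite bump_out// /G indicE memNset.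
- by [].
- exact: iG.
- move=> k x _; rewrite /= lee_fin ger0_norm ?bump_ge0//.
  have [abx|abx] := pselect (obox a b x); last by rewrite bump_out// /G indicE.
  by rewrite /G indicE mem_set// bump_le1.
Qed.

Section calibrated.
Variables (E : set V) (c1 c2 : V) (r : R).
Hypotheses (mE : measurable_set E) (r0 : 0 < r) (c12 : 2 * r < enorm (c1 - c2))
  (EB : E `<=` closed_eball c1 r `|` closed_eball c2 r)
  (PE : (perimeter E <= (n%:R / r * fine (mu E))%:E)%E).

(** Along the translations in direction [v], the derivative of the integral is
    the integral over [E] of the divergence of a multiple of [v]. Such a field
    and its opposite are both small perturbations inside the ball. *)
Let integral_translate_calibrated (rho : R) g v : 0 <= rho < r ->
  C1 g -> bdd_supp g -> (forall x, 0 <= g x <= 1) ->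
  (forall s x, 0 <= s <= 1 -> rho < enorm (x - c1) -> g (x + s *: v) = 0) ->
  (\int[leb]_(x in E) g (x + v) = \int[leb]_(x in E) g x)%R.
Proof.
move=> rhor Cg sg g01 gsupp.
pose tau := (1 - rho / r) / (enorm v + 1).
have v1 : 0 < enorm v + 1 by rewrite ltr_wpDl// enorm_ge0.
have rr : 0 < 1 - rho / r.
  by rewrite subr_gt0 ltr_pdivrMr// mul1r; case/andP: rhor.
have tau0 : 0 < tau by rewrite divr_gt0.
have zero s : 0 <= s <= 1 -> (\int[leb]_(x in E) 'D_v g (x + s *: v))%R = 0.
  move=> s01.
  have Cgs : C1 (fun x => g (x + s *: v)) by exact: C1_translate.
  have psiC k : C1c (fun x => (k * g (x + s *: v)) *: v).
    apply: C1c_intro.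
      move=> i; rewrite (_ : (fun x => _) = (fun x => v 0 i * (k * g (x + s *: v)))).
        by apply: C1_scale; exact: C1_scale.
      by apply/funext => x; rewrite mxE mulrC.
    have [M sM] := bdd_supp_translate (s *: v) sg.
    by exists M => x /sM ->; rewrite mulr0 scale0r.
  have dpsi k x : divergence (fun x => (k * g (x + s *: v)) *: v) x =
      k * 'D_v g (x + s *: v).
    rewrite (divergence_scale (f := fun x => k * g (x + s *: v)) (phi := fun=> v)).
    - rewrite big1 ?mulr0 ?add0r => [|i _]; last exact: derive_cst.
      rewrite -derive_sum_basis; last by have [] := C1_scale k Cgs.
      rewrite -derive_translate; have := @derive_affine R n k 0 _ x v Cgs.
      by under eq_fun do rewrite addr0.
    - exact: C1_scale.
    - by move=> i; exact: C1_cst.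
  have cont : continuous (fun x => 'D_v g (x + s *: v)).
    rewrite (_ : (fun x => _) = 'D_v (fun x => g (x + s *: v))); first by apply Cgs.
    by apply/funext => x; rewrite derive_translate.
  have supp : bdd_supp (fun x => 'D_v g (x + s *: v)).
    exact: (@bdd_supp_translate _ _ _ ('D_v g) (s *: v) (bdd_supp_derive v sg)).
  have intle k : `|k| <= tau -> k * (\int[leb]_(x in E) 'D_v g (x + s *: v))%R <= 0.
    move=> ktau.
    rewrite -RintegralZl//; last exact: continuous_bdd_supp_integrable.
    have -> : (\int[leb]_(x in E) (k * 'D_v g (x + s *: v)))%R =
        (\int[leb]_(x in E) divergence (fun x => (k * g (x + s *: v)) *: v) x)%R.
      by apply: eq_Rintegral => x _; rewrite dpsi.
    apply: (calibrated_variation_le mE r0 c12 rhor EB PE (psiC k)).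
    - by move=> x xr; rewrite gsupp// mulr0 scale0r.
    - move=> x; rewrite enormZ normrM; have /andP[g0 g1] := g01 (x + s *: v).
      rewrite (ger0_norm g0).
      apply: (@le_trans _ _ (tau * enorm v)).
        by rewrite ler_wpM2r ?enorm_ge0// -[leRHS]mulr1 ler_pM.
      by rewrite /tau mulrAC ler_pdivrMr// ler_wpM2l ?(ltW rr)// lerDl.
  have := intle tau; have := intle (- tau); rewrite normrN (gtr0_norm tau0) lexx.
  move=> /(_ isT) h1 /(_ isT) h2; apply/eqP; rewrite eq_le.
  by move: h1 h2; rewrite mulNr oppr_le0 pmulr_rle0// pmulr_rge0// => -> ->.
pose w (s : R) := (\int[leb]_(x in E) g (x + s *: v))%R.
have dw (s : R) : is_derive s 1 w (\int[leb]_(x in E) 'D_v g (x + s *: v))%R.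
  exact: derive_integral_translate.
have cw : {within `[0, 1], continuous w}.
  apply: derivable_within_continuous => s _; by case: (dw s).
have [t t01 tw] := MVT_segment ler01 (fun s _ => dw s) cw.
have w10 : w 1 = w 0.
  by apply/eqP; rewrite -subr_eq0 tw zero ?mul0r.
move: w10; rewrite /w.
under eq_Rintegral do rewrite scale1r.
by under [X in _ = X]eq_Rintegral do rewrite scale0r addr0.
Qed.

Lemma hbox_null_boundary a b : mu (hbox a b `\` obox a b) = 0%E.
Proof.
pose F k := if (insub k : option 'I_n) is Some i
  then cbox a (upd b i (a 0 i)) else set0.
apply: (@outer_null_sub _ _ _ (\bigcup_k F k)).
  move=> x [hx /existsNP[i /negP xi]]; exists (val i) => //; rewrite /F valK.
  move=> j; have /andP[ax xb] := hx j; rewrite mxE ax /=.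
  case: eqVneq => [->|_]; last exact: ltW.
  have /andP[ai bi] := hx i; move: xi; rewrite bi andbT -leNgt => xi; exact: xi.
apply: outer_null_bigcup => k; rewrite /F; case: insub => [i|]; last exact: outer_measure0.
apply/eqP; rewrite eq_le outer_measure_ge0 andbT; apply: le_trans (outer_cbox _ _) _.
by rewrite lee_fin /vol (bigD1 i)//= mxE eqxx subrr maxxx mul0r.
Qed.

(** Bumps approximate the indicator function of the box, and all translations
    in between keep it in the ball, which is convex. *)
Lemma calibrated_box_translate (rho : R) a b v : 0 <= rho < r -> rle a b ->
  cbox a b `<=` closed_eball c1 rho ->
  cbox (a + v) (b + v) `<=` closed_eball c1 rho ->
  mu (E `&` hbox (a + v) (b + v)) = mu (E `&` hbox a b).
Proof.
move=> rhor ab sab sabv.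
have ho a' b' : mu (E `&` hbox a' b') = mu (E `&` obox a' b').
  apply: ess_sub_outer_eq.
    by apply: outer_null_sub (hbox_null_boundary a' b') => x [[Ex hx] h]; split => // o; apply: h.
  by apply: subset_ess_sub => x [Ex o]; split => // i; have /andP[/ltW -> ->] := o i.
rewrite !ho.
have fin a' b' : mu (E `&` obox a' b') \is a fin_num.
  rewrite ge0_fin_numE ?outer_measure_ge0//.
  apply: le_lt_trans (outer_hbox_lty a' b'); apply: le_outer_measure => x [_ o] i.
  by have /andP[/ltW -> ->] := o i.
rewrite -(fineK (fin _ _)) -(fineK (fin a b)); congr EFin.
have abv : rle (a + v) (b + v) by move=> i; rewrite !mxE lerD2r.
have h1 := integral_bump_cvg mE ab.
have h2 := integral_bump_cvg mE abv.
rewrite -(cvg_lim (@Rhausdorff R) h1) -(cvg_lim (@Rhausdorff R) h2).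
congr (lim (_ @ \oo)); apply/funext => k.
under eq_Rintegral do rewrite bump_translate.
apply: (@integral_translate_calibrated rho (bump a b k%:R) (- v)) => //.
- exact: C1_bump.
- exact: bdd_supp_bump.
- by move=> x; rewrite bump_ge0// bump_le1.
move=> s x /andP[s0 s1] xr; apply: bump_out => // o.
move: xr; rewrite ltNge => /negP; apply.
have p1 : closed_eball c1 rho (x - s *: v).
  apply: sab => i; have := o i; rewrite scalerN.
  by move=> /andP[/ltW -> /ltW ->].
have p2 : closed_eball c1 rho (x - s *: v + v).
  apply: sabv => i; have := o i; rewrite scalerN !mxE.
  by move=> /andP[/ltW h3 /ltW h4]; rewrite !lerD2r h3.
(* the segment of translations stays in the ball *)
have -> : x - c1 = (1 - s) *: (x - s *: v - c1) + s *: (x - s *: v + v - c1).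
  by apply/rowP => i; rewrite !mxE; ring.
apply: (le_trans (ler_enormD _ _)); rewrite !enormZ !ger0_norm ?subr_ge0//.
move: p1 p2; rewrite /closed_eball/= => p1 p2.
have : (1 - s) * enorm (x - s *: v - c1) <= (1 - s) * rho by rewrite ler_wpM2l// subr_ge0.
have : s * enorm (x - s *: v + v - c1) <= s * rho by rewrite ler_wpM2l.
lra.
Qed.

(** The measure of the part in [E] is translation invariant on the boxes of the
    cube, hence at most the density of [E] in the cube times Lebesgue measure.
    Evaluated at the part of [E] in the cube, this says that the density is zero
    or at least one. *)
Lemma calibrated_cube_dichotomy (rho : R) c (L : R) : 0 <= rho < r -> 0 < L ->
  cbox c (c + const_mx L) `<=` closed_eball c1 rho ->
  mu (E `&` hbox c (c + const_mx L)) = 0%E \/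
  mu (hbox c (c + const_mx L) `\` E) = 0%E.
Proof.
move=> rhor L0 CB; set d := c + const_mx L in CB *; set C := hbox c d.
have finm A : A `<=` C -> (mu A < +oo)%E.
  by move=> AC; apply: le_lt_trans (outer_hbox_lty c d); exact: le_outer_measure.
have sub a b : rle c a -> rle b d -> cbox a b `<=` cbox c d.
  move=> ca bd x abx i; have /andP[h1 h2] := abx i.
  by rewrite (le_trans (ca i) h1) (le_trans h2 (bd i)).
have key : (mu (E `&` (E `&` C)) <= (fine (mu (E `&` C)) / L ^+ n)%:E * mu (E `&` C))%E.
  apply: (@translation_invariant_le R n i0 (fun A => mu (E `&` A)) c L L0).
  - by rewrite setI0 outer_measure0.
  - by move=> A; exact: outer_measure_ge0.
  - by move=> A B AB; apply: le_outer_measure; exact: setIS.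
  - by move=> F; rewrite setI_bigcupr; exact: outer_measure_sigma_subadditive.
  - move=> A i t; rewrite (measurable_coord_lt i t (E `&` A)) !setIA.
    congr (_ + lebesgue_outer _)%E; apply/seteqP.
    by split => x [h1 /= h2]; split => //=; move: h2; rewrite leNgt => /negP.
  - by apply: finm => x [].
  - move=> a b v ca ab bd cav bvd; apply: (calibrated_box_translate rhor ab).
      by apply: subset_trans CB; exact: sub.
    by apply: subset_trans CB; exact: sub.
  - by move=> x [].
  - by apply: finm => x [].
rewrite setIA setIid in key.
have fEC : mu (E `&` C) \is a fin_num.
  by rewrite ge0_fin_numE ?outer_measure_ge0//; apply: finm => x [].
have fC : mu C \is a fin_num.
  by rewrite ge0_fin_numE ?outer_measure_ge0//; apply: finm.
have CL : (mu C <= (L ^+ n)%:E)%E.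
  apply: (@le_trans _ _ (mu (cbox c d))).
    by apply: le_outer_measure => x h i; have /andP[-> /ltW ->] := h i.
  apply: le_trans (outer_cbox _ _) _; rewrite lee_fin le_eqVlt; apply/orP; left.
  rewrite /vol (eq_bigr (fun=> L)) ?prodr_const ?card_ord// => i _.
  by rewrite !mxE addrAC subrr add0r max_r// ltW.
have split : (mu C = mu (E `&` C) + mu (C `\` E))%E by rewrite setIC; exact: mE.
have fCE : mu (C `\` E) \is a fin_num.
  by rewrite ge0_fin_numE ?outer_measure_ge0//; apply: finm => x [].
move: key CL split; rewrite -(fineK fEC) -(fineK fC) -(fineK fCE) -EFinM -EFinD !lee_fin.
have t0 : 0 <= fine (mu (E `&` C)) by rewrite fine_ge0// outer_measure_ge0.
have w0 : 0 <= fine (mu (C `\` E)) by rewrite fine_ge0// outer_measure_ge0.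
move: (fine (mu (E `&` C))) (fine (mu C)) (fine (mu (C `\` E))) t0 w0 => t q w t0 w0.
rewrite mulrAC ler_pdivlMr ?exprn_gt0// => h1 h2 [h3].
have [->|tn] := eqVneq t 0; [by left|right].
have tp : 0 < t by rewrite lt0r tn.
by congr EFin; apply/eqP; rewrite eq_le w0 andbT; move: h1; rewrite ler_pM2l//; lra.
Qed.

Lemma cube_in_ball (dl : R) : 0 < dl -> exists2 s : R, 0 < s &
  forall x, cbox (x - const_mx s) (x + const_mx s) `<=` closed_eball x dl.
Proof.
have n0 : 0 < n%:R :> R by rewrite ltr0n (leq_trans _ (ltn_ord i0)).
move=> dl0; exists (dl / n%:R); first by rewrite divr_gt0.
move=> x y xy; rewrite /closed_eball/= enorm_leP ?(ltW dl0)//.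
apply: (@le_trans _ _ (\sum_(i < n) (dl / n%:R) ^+ 2)).
  apply: ler_sum => i _; rewrite -expr2 -(real_normK (num_real _)).
  rewrite lerXn2r ?nnegrE ?divr_ge0 ?(ltW dl0) ?(ltW n0)//.
  by have := xy i; rewrite !mxE ler_norml; lra.
rewrite sumr_const card_ord -[leLHS]mulr_natr.
have -> : (dl / n%:R) ^+ 2 * n%:R = dl ^+ 2 / n%:R by field; rewrite gt_eqF.
rewrite ler_pdivrMr// ler_peMr ?sqr_ge0//.
by rewrite ler1n (leq_trans _ (ltn_ord i0)).
Qed.

Lemma nbhs_hbox x (s : R) : 0 < s -> nbhs x (hbox (x - const_mx s) (x + const_mx s)).
Proof.
move=> s0; have o := @open_obox R n (x - const_mx s) (x + const_mx s).
have : obox (x - const_mx s) (x + const_mx s) x by move=> i; rewrite !mxE; lra.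
move=> xo; apply: filterS (open_nbhs_nbhs (conj o xo)) => y oy i.
by have /andP[/ltW -> ->] := oy i.
Qed.

(** The alternative for a cube at the centre spreads over the ball, since small
    cubes of the same size around two points contain the same amount of [E]. *)
Lemma calibrated_ball_dichotomy :
  mu (E `&` closed_eball c1 r) = 0%E \/ mu (closed_eball c1 r `\` E) = 0%E.
Proof.
have r20 : 0 < r / 2 by rewrite divr_gt0.
have r2r : 0 <= r / 2 < r by lra.
have [s0 s00 cs0] := cube_in_ball r20.
have dich : mu (E `&` hbox (c1 - const_mx s0) (c1 + const_mx s0)) = 0%E \/
    mu (hbox (c1 - const_mx s0) (c1 + const_mx s0) `\` E) = 0%E.
  have L0 : 0 < s0 + s0 by rewrite addr_gt0.
  have e : c1 + const_mx s0 = c1 - const_mx s0 + const_mx (s0 + s0).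
    by apply/rowP => i; rewrite !mxE; ring.
  rewrite e; apply: (calibrated_cube_dichotomy r2r L0); rewrite -e; exact: cs0.
have local x : open_eball c1 r x -> exists2 s, 0 < s <= s0 &
    mu (E `&` hbox (x - const_mx s) (x + const_mx s)) =
    mu (E `&` hbox (c1 - const_mx s) (c1 + const_mx s)).
  rewrite /open_eball/= => xr.
  pose dl := (r - enorm (x - c1)) / 2.
  have dl0 : 0 < dl by rewrite divr_gt0// subr_gt0.
  have [s1 s10 cs1] := cube_in_ball dl0.
  exists (Num.min s0 s1); first by rewrite lt_min s00 s10 ge_min lexx.
  set s := Num.min s0 s1.
  have rho1 : 0 <= r - dl < r by rewrite /dl; have := enorm_ge0 (x - c1); lra.
  have mono y t : s <= t -> cbox (y - const_mx s) (y + const_mx s) `<=`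
      cbox (y - const_mx t) (y + const_mx t).
    by move=> st z zs i; have := zs i; rewrite !mxE; lra.
  have s_0 : 0 < s by rewrite lt_min s00 s10.
  have E1 : x - const_mx s = c1 - const_mx s + (x - c1).
    by apply/rowP => i; rewrite !mxE; ring.
  have E2 : x + const_mx s = c1 + const_mx s + (x - c1).
    by apply/rowP => i; rewrite !mxE; ring.
  have ss1 : s <= s1 by rewrite ge_min lexx orbT.
  rewrite E1 E2; apply: (calibrated_box_translate rho1).
  - by move=> i; rewrite !mxE; lra.
  - move=> z /(mono c1 s1 ss1) /cs1; rewrite /closed_eball/= => h.
    by apply: le_trans h _; rewrite /dl; have := enorm_ge0 (x - c1); lra.
  - rewrite -E1 -E2 => z /(mono x s1 ss1) /cs1; rewrite /closed_eball/= => h.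
    have -> : z - c1 = (z - x) + (x - c1) by rewrite addrA subrK.
    by apply: le_trans (ler_enormD _ _) _; rewrite /dl in h *; lra.
have sph := @outer_sphere R n c1 r r0.
have shrink y (s : R) : s <= s0 -> hbox (y - const_mx s) (y + const_mx s) `<=`
    hbox (y - const_mx s0) (y + const_mx s0).
  by move=> st z zs i; have := zs i; rewrite !mxE; lra.
case: dich => d0; [left|right].
  have h : mu (E `&` open_eball c1 r) = 0%E.
    apply: locally_null => x /local[s /andP[s1 s2] es].
    exists (hbox (x - const_mx s) (x + const_mx s)); first exact: nbhs_hbox.
    rewrite [LHS]es; apply: outer_null_sub d0 => z [Ez hz]; split => //; exact: shrink hz.
  apply: outer_null_sub (outer_null_setU h sph) => z [Ez Bz].
  by have [oz|oz] := pselect (open_eball c1 r z); [left|right].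
have h : mu (~` E `&` open_eball c1 r) = 0%E.
  apply: locally_null => x /local[s /andP[s1 s2] es].
  exists (hbox (x - const_mx s) (x + const_mx s)); first exact: nbhs_hbox.
  have m1 : mu (E `&` hbox (c1 - const_mx s) (c1 + const_mx s)) =
      mu (hbox (c1 - const_mx s) (c1 + const_mx s)).
    apply: ess_sub_outer_eq; first by apply: subset_ess_sub => z [].
    apply: outer_null_sub d0 => z [hz nEz]; split; first exact: shrink hz.
    by move=> Ez; apply: nEz.
  have m2 : mu (hbox (x - const_mx s) (x + const_mx s)) =
      mu (hbox (c1 - const_mx s) (c1 + const_mx s)).
    rewrite -[RHS](outer_translate_preim (x - c1)); congr (lebesgue_outer _).
    by apply/seteqP; split => z hz i; have := hz i; rewrite !mxE; lra.
  have mEh : measurable_set (E `&` hbox (x - const_mx s) (x + const_mx s)).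
    by apply: (@measurableI _ (Rn R n)) => //; exact: measurable_hbox.
  have sub : ess_sub (E `&` hbox (x - const_mx s) (x + const_mx s))
      (hbox (x - const_mx s) (x + const_mx s)) by apply: subset_ess_sub => z [].
  have eqm : mu (E `&` hbox (x - const_mx s) (x + const_mx s)) =
      mu (hbox (x - const_mx s) (x + const_mx s)) by rewrite es m1 m2.
  apply: outer_null_sub (ess_sub_eq_measure mEh sub eqm (outer_hbox_lty _ _)).
  by move=> z [nEz hz]; split => // -[].
apply: outer_null_sub (outer_null_setU h sph) => z [Bz nEz].
by have [oz|oz] := pselect (open_eball c1 r z); [left|right].
Qed.

End calibrated.

Lemma perimeter_ess_eq (E F : set V) : measurable_set E -> measurable_set F ->
  F `<=` E -> ess_sub E F -> perimeter F = perimeter E.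
Proof.
move=> mE mF FE EF.
have int phi : C1c phi -> (\int[leb]_(x in (F : set (Rn R n))) (divergence phi x)%:E)%E =
    (\int[leb]_(x in (E : set (Rn R n))) (divergence phi x)%:E)%E.
  move=> Cphi.
  have mD : measurable (E `\` F : set (Rn R n)) by exact: measurableD.
  rewrite (negligible_integral mD mE (integrable_divergence mE Cphi) EF).
  by rewrite setDD setIidr.
rewrite /perimeter; congr ereal_sup; apply/seteqP.
by split => _ [phi [Cphi phi1] <-]; exists phi; rewrite ?int.
Qed.

(** The part of [E] in the two balls has the volume and the perimeter of [E], and
    these attain the bound of the calibration. So it fills or misses the first
    ball, and the volume leaves nothing, or just enough for the second. *)
Lemma two_balls_rigidity E (c1 c2 : V) (r : R) : measurable_set E -> 0 < r ->
  2 * r < enorm (c1 - c2) -> ess_sub E (closed_eball c1 r `|` closed_eball c2 r) ->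
  mu E = mu (closed_eball c1 r) ->
  (perimeter E <= perimeter (closed_eball c1 r))%E ->
  ess_eq_set E (closed_eball c1 r) \/ ess_eq_set E (closed_eball c2 r).
Proof.
move=> mE r0 c12 EB volE perE.
pose F := E `&` (closed_eball c1 r `|` closed_eball c2 r).
have mF : measurable_set F.
  apply: (@measurableI _ (Rn R n)) => //.
  by apply: (@measurableU _ (Rn R n)); exact: measurable_closed_eball.
have FE : ess_sub F E by apply: subset_ess_sub => x [].
have EF : ess_sub E F.
  by apply: outer_null_sub EB => x [Ex nF]; split => // Bx; apply: nF.
have volF : mu F = mu (closed_eball c1 r) by rewrite -volE; exact: ess_sub_outer_eq.
have perF : perimeter F = perimeter E by apply: perimeter_ess_eq => // x [].
have B12 : mu (closed_eball c2 r) = mu (closed_eball c1 r).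
  rewrite -(outer_translate_preim (c2 - c1) (closed_eball c1 r)); congr (lebesgue_outer _).
  have e x : x - (c2 - c1) - c1 = x - c2 by apply/rowP => i; rewrite !mxE; ring.
  by apply/seteqP; split => x; rewrite /closed_eball/= e.
have PF : (perimeter F <= (n%:R / r * fine (mu F))%:E)%E.
  rewrite perF volF; apply: le_trans perE _; exact: perimeter_closed_eball_le.
have FB : F `<=` closed_eball c1 r `|` closed_eball c2 r by move=> x [].
have ball_lty c : (mu (closed_eball c r) < +oo)%E by exact: outer_closed_eball_lty.
have := calibrated_ball_dichotomy mF r0 c12 FB PF.
move=> [F0|F1]; [right|left]; apply/ess_eq_setP.
  have FB2 : ess_sub F (closed_eball c2 r).
    by apply: outer_null_sub F0 => x [Fx nB]; have [|] := FB x Fx.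
  split; first exact: ess_sub_trans EF FB2.
  apply: ess_sub_trans FE; apply: (ess_sub_eq_measure mF FB2) => //.
  by rewrite volF B12.
split; last exact: ess_sub_trans F1 FE.
apply: (ess_sub_trans EF); apply: (ess_sub_eq_measure _ F1) => //.
  exact: measurable_closed_eball.
by rewrite volF.
Qed.

End rigidity.

(** * Set maps fixing symmetric pairs of balls *)

Section ball_geometry.
Variables (R : realType) (n : nat) (i0 : 'I_n).
Local Notation V := 'rV[R]_n.
Local Notation mu := (@lebesgue_outer R n).
Implicit Types (A B U : set V) (c x : V) (r : R).

Lemma convex_body_closed_eball c r : 0 < r -> is_convex_body (closed_eball c r).
Proof.
move=> r0; split; first exact: compact_closed_eball.
- move=> x y l; rewrite !inE => xr yr.
  change (enorm (l%:inum *: (x : V) + (1 - l%:inum) *: (y : V) - c) <= r).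
  have l0 : 0 <= l%:inum :> R by [].
  have l1 : l%:inum <= 1 :> R by [].
  move: xr yr; rewrite /closed_eball/=; move: (l%:inum) l0 l1 => t t0 t1 xr yr.
  have -> : t *: (x : V) + (1 - t) *: (y : V) - c =
      t *: ((x : V) - c) + (1 - t) *: ((y : V) - c).
    by apply/rowP => i; rewrite !mxE; ring.
  apply: le_trans (ler_enormD _ _) _; rewrite !enormZ !ger0_norm ?subr_ge0//.
  have := ler_wpM2l t0 xr; have t10 : 0 <= 1 - t by rewrite subr_ge0.
  by have := ler_wpM2l t10 yr; lra.
- exists c; change (nbhs c (closed_eball c r)).
  have o := @open_open_eball R n c r.
  have oc : open_eball c r c by rewrite /open_eball/= subrr enorm0.
  by apply: filterS (open_nbhs_nbhs (conj o oc)) => x /= /ltW.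
Qed.

Lemma open_closed_eball_sub U x (d : R) : 0 < d -> open U -> U x ->
  exists2 r, 0 < r < d & closed_eball x r `<=` U.
Proof.
move=> d0 oU Ux; have /nbhs_ballP[e /= e0 eU] := open_nbhs_nbhs (conj oU Ux).
exists (Num.min (d / 2) (e / 2)).
  rewrite lt_min !divr_gt0//= gt_min; apply/orP; left.
  by rewrite ltr_pdivrMr// mulr_natr mulr2n ltrDl.
move=> y yr; apply: eU; split => // k i; rewrite (ord1 k) /ball/= distrC.
have h := coord_le_enorm (y - x) i; rewrite !mxE in h.
apply: le_lt_trans (le_trans h yr) _; rewrite gt_min; apply/orP; right.
by rewrite ltr_pdivrMr// mulr_natr mulr2n ltrDl.
Qed.

Lemma measurable_open_slice u t : measurable_set [set x : V | t < dot x u].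
Proof.
apply: open_measurable_Rn.
apply: (@open_comp _ _ (fun x : V => dot x u) [set s | t < s]); last exact: open_gt.
move=> x _; have := @continuous_dot R n id (cst u); apply; first by move=> ?; exact: cvg_id.
exact: cst_continuous.
Qed.

Variables (u : V) (hu : enorm u = 1).

Lemma dot_le_enorm x : `|dot x u| <= enorm x.
Proof.
rewrite ler_norml; apply/andP; split.
  by rewrite lerNl -dotNl; have := cauchy_schwarz (- x) u; rewrite hu mulr1 enormN.
by have := cauchy_schwarz x u; rewrite hu mulr1.
Qed.

Lemma closed_eball_dot c r x : closed_eball c r x -> `|dot x u - dot c u| <= r.
Proof. by rewrite -dotBl => xr; exact: le_trans (dot_le_enorm _) xr. Qed.

Lemma refl_closed_eball c r :
  refl u @^-1` closed_eball c r = closed_eball (refl u c) r.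
Proof.
apply/seteqP; split => x; rewrite /closed_eball/= -(enorm_refl hu) reflB//.
  by rewrite reflK.
by rewrite reflK.
Qed.

(** A bounded piece of the hyperplane has infinitely many disjoint translates in
    a bounded set. *)
Lemma hyperplane_null : mu [set x : V | dot x u = 0] = 0%E.
Proof.
rewrite -(setIT [set x | _]); apply: locally_null => x _.
exists (open_eball x 1).
  apply: open_nbhs_nbhs; split; first exact: open_open_eball.
  by rewrite /open_eball/= subrr enorm0.
set S := _ `&` _.
have mS : measurable_set S.
  apply: (@measurableI _ (Rn R n)).
    apply: closed_measurable_Rn.
    apply: (@closed_comp _ _ (fun x : V => dot x u) [set 0]); last exact: closed_eq.
    move=> y _; have := @continuous_dot R n id (cst u); apply; first by move=> ?; exact: cvg_id.
    exact: cst_continuous.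
  exact/open_measurable_Rn/open_open_eball.
pose F (k : nat) : set (Rn R n) := [set y : V | S (y - k.+1%:R^-1 *: u)].
have mF k : [set: nat] k -> measurable (F k) by move=> _; exact: measurable_translate.
have tF : trivIset [set: nat] F.
  apply/trivIsetP => i j _ _ /eqP ij; apply/seteqP; split => // y [[h1 _] [h2 _]].
  apply: ij; move: h1 h2; rewrite /= !dotBl !dotZl (dot_unit hu) !mulr1 => h1 h2.
  have : j.+1%:R^-1 = i.+1%:R^-1 :> R := etrans (esym (subr0_eq h2)) (subr0_eq h1).
  by move=> /invr_inj/eqP; rewrite eqr_nat => /eqP [].
have := @measure_bigcup _ R (Rn R n) (@Leb R n) setT F mF tF.
have Foo : (@Leb R n (\bigcup_n F n) < +oo)%E.
  apply: le_lt_trans (outer_closed_eball_lty x 2); apply: le_outer_measure.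
  move=> y [k _ [_ /= h]]; rewrite /closed_eball/=.
  have -> : y - x = (y - k.+1%:R^-1 *: u - x) + k.+1%:R^-1 *: u.
    by apply/rowP => i; rewrite !mxE; ring.
  apply: le_trans (ler_enormD _ _) _; rewrite enormZ hu mulr1 ger0_norm//.
  have : k.+1%:R^-1 <= 1 :> R by rewrite invf_le1// ler1n.
  by move: h; rewrite /open_eball/=; move: (k.+1%:R^-1) => z; lra.
move=> E; rewrite E in Foo.
have Sfin : mu S \is a fin_num.
  rewrite ge0_fin_numE ?outer_measure_ge0//; apply: le_lt_trans (outer_closed_eball_lty x 1).
  by apply: le_outer_measure => y [_ /ltW].
have Nle N : N%:R * fine (mu S) <= fine (\sum_(0 <= i <oo | i \in [set: nat]) @Leb R n (F i))%E.
  rewrite -lee_fin fineK; last first.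
    by rewrite ge0_fin_numE//; apply: nneseries_ge0 => k _ _; exact: outer_measure_ge0.
  apply: le_trans (nneseries_lim_ge N _); last by move=> k _ _; exact: outer_measure_ge0.
  rewrite EFinM fineK// (eq_bigl xpredT) => [|k]; last by rewrite in_setT.
  rewrite (eq_bigr (fun=> mu S)) => [|k _].
    by rewrite mule_natl sumr_const_nat subn0 ?enatmulE.
  exact: outer_translate_preim.
apply/eqP; rewrite -fine_eq0// eq_le fine_ge0 ?outer_measure_ge0// andbT leNgt.
apply/negP => s0.
set q := fine (\sum_(0 <= _ <oo | _) _)%E in Nle.
have := Nle (Num.truncn (q / fine (mu S))).+1.
rewrite leNgt => /negP; apply; rewrite -ltr_pdivrMr//.
have q0 : 0 <= q by have := Nle 0%N; rewrite mul0r.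
by have := truncn_itv (divr_ge0 q0 (ltW s0)) => /andP[].
Qed.

(** Large balls inside the half-space, and close to its boundary, exhaust it. *)
Lemma common_ball c1 c2 (r1 r2 : R) : 0 < r1 -> 0 < r2 ->
  r1 < dot c1 u -> r2 < dot c2 u -> exists c r, [/\ 0 < r, r < dot c u,
    closed_eball c1 r1 `<=` closed_eball c r & closed_eball c2 r2 `<=` closed_eball c r].
Proof.
move=> r10 r20 h1 h2.
(* all points of the two balls have distance at least [dl] to the hyperplane
   and at most [K] to the origin *)
pose dl := Num.min (dot c1 u - r1) (dot c2 u - r2).
have dl0 : 0 < dl by rewrite lt_min !subr_gt0 h1 h2.
pose K := Num.max (enorm c1 + r1) (enorm c2 + r2).
have K0 : 0 <= K by rewrite le_max addr_ge0 ?enorm_ge0// ltW.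
(* [M] is chosen such that the sphere around [M *: u] of radius [M - dl / 2]
   leaves these points inside *)
pose M := K ^+ 2 / dl + dl.
have M1 : 0 <= K ^+ 2 / dl by rewrite divr_ge0 ?sqr_ge0// ltW.
have key c r : dl <= dot c u - r -> enorm c + r <= K ->
    closed_eball c r `<=` closed_eball (M *: u) (M - dl / 2).
  move=> hd hK x xr; rewrite /closed_eball/= enorm_leP; last by rewrite /M; lra.
  have xd : dl <= dot x u by have := closed_eball_dot xr; rewrite ler_norml; lra.
  have xK : enorm x <= K by have := ler_enormB x c; move: xr; rewrite /closed_eball/=; lra.
  have xx : dot x x <= K ^+ 2 by rewrite -enorm_leP.
  rewrite !dotE (dot_unit hu) (dotC u x).
  have MK : M * dl = K ^+ 2 + dl ^+ 2 by rewrite mulrDl divfK ?gt_eqF// expr2.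
  have M0 : 0 <= M by rewrite addr_ge0// ltW.
  have := ler_wpM2l M0 xd; nra.
exists (M *: u), (M - dl / 2); split.
- by rewrite /M; lra.
- by rewrite dotZl (dot_unit hu); lra.
- by apply: key; rewrite ?ge_min ?le_max lexx.
- by apply: key; rewrite ?ge_min ?le_max lexx ?orbT.
Qed.

End ball_geometry.

Section set_map.
Variables (R : realType) (n : nat) (i0 : 'I_n).
Local Notation V := 'rV[R]_n.
Local Notation mu := (@lebesgue_outer R n).
Implicit Types (A B U S : set V) (c x u : V) (r : R).

Definition fin_meas A := measurable_set A /\ (mu A < +oo)%E.

Lemma fin_meas_closed_eball c r : fin_meas (closed_eball c r).
Proof. by split; [exact: measurable_closed_eball|exact: outer_closed_eball_lty]. Qed.

Lemma fin_meas_sub A B : measurable_set A -> A `<=` B -> fin_meas B -> fin_meas A.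
Proof. by move=> mA AB [_ Boo]; split => //; apply: le_lt_trans Boo; exact: le_outer_measure. Qed.

Lemma fin_measI A B : fin_meas A -> measurable_set B -> fin_meas (A `&` B).
Proof.
move=> fA mB; have [mA _] := fA; apply: fin_meas_sub fA; last by move=> x [].
exact: (@measurableI _ (Rn R n)).
Qed.

Lemma fin_measU A B : fin_meas A -> fin_meas B -> fin_meas (A `|` B).
Proof.
move=> [mA Aoo] [mB Boo]; split; first exact: (@measurableU _ (Rn R n)).
by apply: le_lt_trans (outer_measureU2 _ _ _) _; rewrite lte_add_pinfty.
Qed.

(** By outer regularity, [A] is up to a null set a countable intersection of
    open sets. *)
Lemma open_superset_ess_sub A B : fin_meas A ->
  (forall U, open U -> fin_meas U -> A `<=` U -> ess_sub B U) -> ess_sub B A.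
Proof.
move=> [mA Aoo] BU.
have e0 k : 0 < k.+1%:R^-1 :> R by rewrite invr_gt0.
have fA : mu A \is a fin_num by rewrite ge0_fin_numE ?outer_measure_ge0.
pose P k U := [/\ open U, A `<=` U & (mu U <= mu A + (k.+1%:R^-1)%:E)%E].
have [U PU] : {U : nat -> set V & forall k, P k (U k)}.
  by apply: (@choice _ _ P) => k; exact: (outer_regular i0 Aoo (e0 k)).
pose G := \bigcap_k U k.
have mG : measurable_set G.
  by apply: bigcapT_measurable => k; apply: open_measurable_Rn; case: (PU k).
have AG : A `<=` G by move=> x Ax k _; have [_ + _] := PU k; apply.
have muG : mu A = mu G.
  apply/eqP; rewrite eq_le le_outer_measure//=; apply/lee_addgt0Pr => e ep.
  have [N _ hN] := near_infty_natSinv_lt (PosNum ep).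
  have [_ _ h] := PU N; apply: le_trans (le_outer_measure mu _ _ (bigcap_inf (i := N) _)) _ => //.
  apply: le_trans h _; rewrite leeD2l// lee_fin; apply: ltW; exact: (hN N (leqnn N)).
have Goo : (mu G < +oo)%E by rewrite -muG.
have GA : ess_sub G A := ess_sub_eq_measure mA (subset_ess_sub AG) muG Goo.
apply: (ess_sub_trans _ GA).
apply: (@outer_null_sub _ _ _ (\bigcup_k (B `\` U k))).
  by move=> x [Bx /existsNP[k /not_implyP[_ nU]]]; exists k.
apply: outer_null_bigcup => k; have [oU AU le] := PU k; apply: BU => //.
split; first exact: open_measurable_Rn.
by apply: le_lt_trans le _; rewrite lte_add_pinfty// ltry.
Qed.

Variable D : set V -> set V.
Hypothesis D_meas : forall A, fin_meas A -> measurable_set (D A).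
Hypothesis D_vol : forall A, fin_meas A -> mu (D A) = mu A.
Hypothesis D_sub : forall A B, fin_meas A -> fin_meas B -> ess_sub A B ->
  ess_sub (D A) (D B).

Let D_eq_of_sub A B : fin_meas A -> ess_sub (D A) B -> mu B = mu A ->
  ess_eq_set (D A) B.
Proof.
move=> fA DB BA; apply/ess_eq_setP; split => //.
by apply: (ess_sub_eq_measure (D_meas fA) DB); rewrite ?D_vol// BA; case: fA.
Qed.

Let D_eq_of_sup A B : fin_meas A -> measurable_set B -> ess_sub B (D A) -> mu B = mu A ->
  ess_eq_set (D A) B.
Proof.
move=> fA mB BD BA; apply/ess_eq_setP; split => //.
by apply: (ess_sub_eq_measure mB BD); rewrite ?D_vol//; case: fA.
Qed.

(** The image of an open set contains the images of its balls, and so all that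
    it can by volume. Other sets are squeezed between open ones. *)
Lemma set_map_of_balls u (tau : V -> V) : enorm u = 1 -> involutive tau ->
  (forall x y, enorm (tau x - tau y) = enorm (x - y)) ->
  (forall A, mu (tau @^-1` A) = mu A) ->
  (forall c r, 0 < r -> r < dot c u ->
    ess_eq_set (D (closed_eball c r)) (tau @^-1` closed_eball c r)) ->
  forall A, fin_meas A -> A `<=` [set x | 0 < dot x u] ->
  ess_eq_set (D A) (tau @^-1` A).
Proof.
move=> hu tauK tau_iso tau_mu Dball.
have opencase U : open U -> fin_meas U -> U `<=` [set x | 0 < dot x u] ->
    ess_eq_set (D U) (tau @^-1` U).
  move=> oU fU UH; apply: D_eq_of_sup => //.
    exact: (measurable_transport tauK tauK tau_mu (proj1 fU)).
  rewrite /ess_sub; have -> : (tau @^-1` U) `\` D U = ((tau @^-1` U) `\` D U) `&` (tau @^-1` U).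
    by apply/seteqP; split => x [].
  apply: locally_null => x Ux.
  have [r /andP[r0 rx] rU] := open_closed_eball_sub (UH _ Ux) oU Ux.
  exists (open_eball x r).
    apply: open_nbhs_nbhs; split; first exact: open_open_eball.
    by rewrite /open_eball/= subrr enorm0.
  have /ess_eq_setP[_ BD] := Dball _ _ r0 rx.
  have DB : ess_sub (D (closed_eball (tau x) r)) (D U).
    by apply: D_sub (fin_meas_closed_eball _ _) fU (subset_ess_sub rU).
  apply: outer_null_sub (ess_sub_trans BD DB) => y [[_ nD] /ltW xy]; split => //.
  by rewrite /closed_eball/= tau_iso.
move=> A fA AH; apply: D_eq_of_sub => //.
have tauA : ess_sub (tau @^-1` (D A)) A.
  apply: open_superset_ess_sub => // U oU fU AU.
  pose U' := U `&` [set x | 0 < dot x u].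
  have oU' : open U'.
    apply: openI => //; apply: (@open_comp _ _ (fun x : V => dot x u) [set s | 0 < s]); last exact: open_gt.
    move=> x _; have := @continuous_dot R n id (cst u); apply; first by move=> ?; exact: cvg_id.
    exact: cst_continuous.
  have fU' : fin_meas U' by apply: fin_measI => //; exact: measurable_open_slice.
  have AU' : A `<=` U' by move=> x Ax; split; [exact: AU|exact: AH].
  have /ess_eq_setP[DU' _] := opencase _ oU' fU' (fun x => @proj2 _ _).
  have DA := ess_sub_trans (D_sub fA fU' (subset_ess_sub AU')) DU'.
  rewrite /ess_sub -tau_mu; apply: outer_null_sub DA => x [/= h1 h2].
  split; first by move: h1; rewrite tauK.
  by move=> [Ux _]; apply: h2.
rewrite /ess_sub -tau_mu; apply: outer_null_sub tauA => x [/= h1 h2]; split => //.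
by rewrite tauK in h2.
Qed.

Hypothesis D_perim : forall c r, 0 < r ->
  perimeter (D (closed_eball c r)) = perimeter (closed_eball c r).

Section hyperplane.
Variable u : V.
Hypothesis hu : enorm u = 1.
Hypothesis D_inv : invariant_on_symmetric_two_balls u D.

Let ball_disj c r : 0 < r -> r < dot c u ->
  closed_eball c r `&` closed_eball (refl u c) r = set0.
Proof.
move=> r0 rc; apply/seteqP; split => // x [h1 h2].
have := closed_eball_dot hu h1; have := closed_eball_dot hu h2.
by rewrite dot_refl_u// !ler_norml => /andP[? ?] /andP[? ?]; lra.
Qed.

Let D_two_balls c r : 0 < r -> r < dot c u ->
  ess_eq_set (D (closed_eball c r `|` closed_eball (refl u c) r))
    (closed_eball c r `|` closed_eball (refl u c) r).
Proof.
move=> r0 rc; apply: D_inv => //; first exact: ball_disj.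
apply/seteqP; split => [_ [x xK <-]|x xK]; [|exists (refl u x); last exact: reflK].
  move: xK => [h|h]; [right|left]; move: h; rewrite -?(refl_closed_eball hu)//=.
  by rewrite reflK.
move: xK => [h|h]; [right|left]; move: h; rewrite -?(refl_closed_eball hu)//=.
by rewrite reflK.
Qed.

Let D_ball c r : 0 < r -> r < dot c u ->
  ess_eq_set (D (closed_eball c r)) (closed_eball c r) \/
  ess_eq_set (D (closed_eball c r)) (closed_eball (refl u c) r).
Proof.
move=> r0 rc; have fB := fin_meas_closed_eball c r; have fB' := fin_meas_closed_eball (refl u c) r.
apply: (two_balls_rigidity i0 (D_meas fB) r0).
- rewrite /refl opprB addrCA subrr addr0 enormZ hu mulr1 gtr0_norm ?mulr_gt0//; lra.
- have /ess_eq_setP[K1 _] := D_two_balls r0 rc.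
  apply: ess_sub_trans K1; apply: D_sub => //; first exact: fin_measU.
  by apply: subset_ess_sub => x; left.
- exact: D_vol.
- by rewrite D_perim.
Qed.

(** If one ball is reflected, then so is every other one, because a third ball
    contains both. *)
Let side_choice :
  (forall c r, 0 < r -> r < dot c u -> ess_eq_set (D (closed_eball c r)) (closed_eball c r)) \/
  (forall c r, 0 < r -> r < dot c u ->
    ess_eq_set (D (closed_eball c r)) (refl u @^-1` closed_eball c r)).
Proof.
have inner c r c' r' : 0 < r -> r < dot c u -> 0 < r' -> r' < dot c' u ->
    closed_eball c r `<=` closed_eball c' r' ->
    (ess_eq_set (D (closed_eball c' r')) (closed_eball c' r') ->
      ess_eq_set (D (closed_eball c r)) (closed_eball c r)) /\
    (ess_eq_set (D (closed_eball c' r')) (closed_eball (refl u c') r') ->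
      ess_eq_set (D (closed_eball c r)) (closed_eball (refl u c) r)).
  move=> r0 rc r0' rc' sub.
  have fB := fin_meas_closed_eball c r; have fB' := fin_meas_closed_eball c' r'.
  have DD := D_sub fB fB' (subset_ess_sub sub).
  have volB : mu (closed_eball (refl u c) r) = mu (closed_eball c r).
    by rewrite -(refl_closed_eball hu) outer_refl.
  have pos x : closed_eball c r x -> 0 < dot x u.
    by move=> /(closed_eball_dot hu); rewrite ler_norml => /andP[]; lra.
  have neg x : closed_eball (refl u c) r x -> dot x u < 0.
    move=> /(closed_eball_dot hu); rewrite dot_refl_u// ler_norml => /andP[]; lra.
  have pos' x : closed_eball c' r' x -> 0 < dot x u.
    by move=> /(closed_eball_dot hu); rewrite ler_norml => /andP[]; lra.
  have neg' x : closed_eball (refl u c') r' x -> dot x u < 0.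
    move=> /(closed_eball_dot hu); rewrite dot_refl_u// ler_norml => /andP[]; lra.
  have null A A' : ess_eq_set (D (closed_eball c r)) A -> mu A = mu (closed_eball c r) ->
      ess_sub (D (closed_eball c r)) A' -> A `&` A' `<=` set0 ->
      mu (closed_eball c r) = 0%E.
    move=> /ess_eq_setP[_ AD] <- DA' dis.
    apply: outer_null_sub (ess_sub_trans AD DA') => x Ax; split => // A'x.
    by case: (dis x).
  have conc A : mu (closed_eball c r) = 0%E -> mu A = mu (closed_eball c r) ->
      ess_eq_set (D (closed_eball c r)) A.
    move=> B0 AB; apply/ess_eq_setP; split.
      by apply: outer_null_sub (_ : mu (D (closed_eball c r)) = 0%E); [move=> x []|rewrite D_vol].
    by apply: outer_null_sub (_ : mu A = 0%E); [move=> x []|rewrite AB].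
  split=> /ess_eq_setP[D' _].
    have [//|h] := D_ball r0 rc; apply: conc => //.
    apply: (null _ _ h volB (ess_sub_trans DD D')) => x [/neg h1 /pos' h2].
    by have := lt_trans h1 h2; rewrite ltxx.
  have [h|//] := D_ball r0 rc; apply: conc => //.
  apply: (null _ _ h erefl (ess_sub_trans DD D')) => x [/pos h1 /neg' h2].
  by have := lt_trans h1 h2; rewrite ltxx.
have [|no] := pselect (forall c r, 0 < r -> r < dot c u ->
  ess_eq_set (D (closed_eball c r)) (closed_eball c r)); first by left.
right => c r r0 rc; rewrite refl_closed_eball//.
move: no => /existsNP[c1 /existsNP[r1 /not_implyP[r10 /not_implyP[rc1 no]]]].
have [c' [r' [r0' rc' sub sub1]]] := @common_ball R n u hu c c1 r r1 r0 r10 rc rc1.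
have [i1 i2] := inner _ _ _ _ r0 rc r0' rc' sub.
have [i3 _] := inner _ _ _ _ r10 rc1 r0' rc' sub1.
by have [/i3|/i2] := D_ball r0' rc'.
Qed.

Lemma set_map_half_space :
  (forall A, fin_meas A -> A `<=` [set x | 0 < dot x u] -> ess_eq_set (D A) A) \/
  (forall A, fin_meas A -> A `<=` [set x | 0 < dot x u] ->
    ess_eq_set (D A) (refl u @^-1` A)).
Proof.
have [h|h] := side_choice; [left|right].
  exact: (@set_map_of_balls u id).
apply: (@set_map_of_balls u (refl u)) => //.
- exact: reflK.
- by move=> x y; rewrite -reflB// enorm_refl.
- exact: outer_refl.
Qed.

(** Off the hyperplane, symmetric open sets are unions of symmetric pairs of
    disjoint balls, which are fixed. *)
Lemma set_map_symmetric S : fin_meas S -> (forall x, S x -> S (refl u x)) ->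
  ess_eq_set (D S) S.
Proof.
have opencase U : open U -> fin_meas U -> (forall x, U x -> U (refl u x)) ->
    ess_eq_set (D U) U.
  move=> oU fU symU; apply: D_eq_of_sup => //; first by case: fU.
  have pair c r : 0 < r -> r < dot c u -> closed_eball c r `<=` U ->
      ess_sub (closed_eball c r `|` closed_eball (refl u c) r) (D U).
    move=> r0 rc cU; have /ess_eq_setP[_ K] := D_two_balls r0 rc.
    apply: (ess_sub_trans K); apply: D_sub => //.
      by apply: fin_measU; exact: fin_meas_closed_eball.
    apply: subset_ess_sub => x [/cU//|]; rewrite -(refl_closed_eball hu) => /cU/symU.
    by rewrite reflK.
  have off : mu ((U `\` D U) `&` (U `&` [set x | dot x u != 0])) = 0%E.
    apply: locally_null => x [Ux /= x0].
    have nb r : 0 < r -> nbhs x (open_eball x r).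
      move=> r0; apply: open_nbhs_nbhs; split; first exact: open_open_eball.
      by rewrite /open_eball/= subrr enorm0.
    have [xp|xm] : 0 < dot x u \/ dot x u < 0.
      by move: x0; rewrite neq_lt => /orP[]; [right|left].
      have [r /andP[r0 rx] rU] := open_closed_eball_sub xp oU Ux.
      exists (open_eball x r); first exact: nb.
      apply: outer_null_sub (pair _ _ r0 rx rU) => y [[_ nD] /ltW xy].
      by split => //; left.
    have xp : 0 < dot (refl u x) u by rewrite dot_refl_u// oppr_gt0.
    have [r /andP[r0 rx] rU] := open_closed_eball_sub xp oU (symU _ Ux).
    exists (open_eball x r); first exact: nb.
    apply: outer_null_sub (pair _ _ r0 rx rU) => y [[_ nD] /ltW xy].
    by split => //; right; rewrite reflK.
  have h0 : mu [set x : V | dot x u = 0] = 0%E by exact: hyperplane_null.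
  apply: outer_null_sub (outer_null_setU off h0) => x [Ux nD].
  by have [x0|x0] := eqVneq (dot x u) 0; [right|left].
move=> fS symS; apply: D_eq_of_sub => //.
apply: open_superset_ess_sub => // U oU fU SU.
pose U' := U `&` refl u @^-1` U.
have oU' : open U'.
  by apply: openI => //; apply: open_comp => // x _; exact: continuous_refl.
have fU' : fin_meas U'.
  by apply: fin_measI => //; apply: measurable_refl => //; case: fU.
have symU' x : U' x -> U' (refl u x) by move=> [h1 h2]; split => //=; rewrite reflK.
have /ess_eq_setP[DU' _] := opencase _ oU' fU' symU'.
apply: (ess_sub_trans (D_sub fS fU' _)); last first.
  by apply: (ess_sub_trans DU'); apply: subset_ess_sub => x [].
by apply: subset_ess_sub => x Sx; split; [exact: SU|exact/SU/symS].
Qed.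

(** The polarization of a set, that is, of its indicator function. *)
Definition polarset A : set V :=
  [set x | if 0 <= dot x u then A x \/ A (refl u x) else A x /\ A (refl u x)].

Lemma measurable_polarset A : measurable_set A -> measurable_set (polarset A).
Proof.
move=> mA; have mA' := measurable_refl i0 hu mA.
have mH : measurable_set [set x : V | dot x u < 0].
  have := measurable_open_slice (- u) 0; congr measurable_set.
  by apply/seteqP; split => x /=; rewrite dotNr oppr_gt0.
have -> : polarset A = ((A `|` refl u @^-1` A) `\` [set x | dot x u < 0]) `|`
    ((A `&` refl u @^-1` A) `&` [set x | dot x u < 0]).
  apply/seteqP; split => x; rewrite /polarset/=.
    case: ifPn => [x0 h|]; first by left; split => //; apply/negP; rewrite -leNgt.
    by rewrite -ltNge => x0 h; right.
  by move=> [[h /negP h2]|[h h2]]; [move: h2; rewrite -leNgt => ->|rewrite leNgt h2].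
apply: (@measurableU _ (Rn R n)).
  by apply: (@measurableD _ (Rn R n)) => //; exact: (@measurableU _ (Rn R n)).
by apply: (@measurableI _ (Rn R n)) => //; exact: (@measurableI _ (Rn R n)).
Qed.

(** On one side the polarization is the union of [A] and its mirror image, on
    the other their intersection, mirrored back to the first side; the measures
    of union and intersection add up to those of the two sets. *)
Lemma outer_polarset A : measurable_set A -> mu (polarset A) = mu A.
Proof.
move=> mA; have mA' := measurable_refl i0 hu mA.
have mP := measurable_polarset mA.
have mHp : measurable_set [set x : V | 0 < dot x u] by exact: measurable_open_slice.
pose Hp := [set x : V | 0 < dot x u]; pose Hm := [set x : V | dot x u < 0].
have split (X : set V) : mu X = (mu (X `&` Hp) + mu (X `&` Hm))%E.
  rewrite (mHp X); congr (_ + _)%E; apply: ess_sub_outer_eq.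
    have h0 : mu [set x : V | dot x u = 0] = 0%E by exact: hyperplane_null.
    apply: outer_null_sub h0 => x [[Xx /negP x0] h].
    apply/eqP; rewrite eq_le; move: x0; rewrite -leNgt => -> /=.
    by rewrite leNgt; apply/negP => h2; apply: h.
  by apply: subset_ess_sub => x [Xx /ltW h]; split => //; apply/negP; rewrite -leNgt.
have rHm (X : set V) : mu (X `&` Hm) = mu (refl u @^-1` X `&` Hp).
  rewrite -(outer_refl i0 hu (X `&` Hm)); congr (mu _).
  by apply/seteqP; split => x [h1 h2]; split => //; move: h2; rewrite /Hp/Hm/= dot_refl_u// oppr_lt0.
rewrite (split (polarset A)) (split A) !rHm.
have -> : polarset A `&` Hp = (A `|` refl u @^-1` A) `&` Hp.
  by apply/seteqP; split => x [h1 h2]; split => //; move: h1; rewrite /polarset/= (ltW h2).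
have -> : refl u @^-1` polarset A `&` Hp = (A `&` refl u @^-1` A) `&` Hp.
  apply/seteqP; split => x [h1 h2]; split => //; move: h1;
    by rewrite /polarset/= dot_refl_u// oppr_ge0 leNgt h2/= reflK// => -[].
have e1 : mu ((A `|` refl u @^-1` A) `&` Hp) =
    (mu (refl u @^-1` A `&` Hp) + mu (A `&` Hp `\` refl u @^-1` A))%E.
  rewrite (mA' ((A `|` refl u @^-1` A) `&` Hp)); congr (mu _ + mu _)%E.
    by apply/seteqP; split => x; [move=> [[_ h] h']|move=> [h h']; split => //; split => //; right].
  by apply/seteqP; split => x; [move=> [[[h|h] h'] h2]|move=> [[h h'] h2]; split => //; split => //; left].
have e2 : mu (A `&` Hp) = (mu ((A `&` refl u @^-1` A) `&` Hp) +
    mu (A `&` Hp `\` refl u @^-1` A))%E.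
  rewrite [LHS](mA' (A `&` Hp)); congr (mu _ + mu _)%E.
  by apply/seteqP; split => x; [move=> [[h h'] h2]|move=> [[h h'] h2]].
rewrite e1 e2 -addeA addeC; congr (_ + _)%E; exact: addeC.
Qed.

End hyperplane.

(** The image contains the union of [A] and its mirror image on the side of [u],
    from the two half-spaces, and their intersection, which is symmetric. By
    volume it contains nothing else. *)
Lemma set_map_polarset u : enorm u = 1 -> invariant_on_symmetric_two_balls u D ->
  (forall A, fin_meas A -> A `<=` [set x | 0 < dot x u] -> ess_eq_set (D A) A) ->
  (forall A, fin_meas A -> A `<=` [set x | 0 < dot x (- u)] ->
    ess_eq_set (D A) (refl u @^-1` A)) ->
  forall A, fin_meas A -> ess_eq_set (D A) (polarset u A).
Proof.
move=> hu D_inv Dp Dm A fA; have [mA _] := fA.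
apply: D_eq_of_sup => //; [exact: measurable_polarset| |exact: outer_polarset].
have DpA := fin_measI fA (measurable_open_slice u 0).
have DmA := fin_measI fA (measurable_open_slice (- u) 0).
have fS := fin_measI fA (measurable_refl i0 hu mA).
have /ess_eq_setP[_ p1] := Dp _ DpA (fun x => @proj2 _ _).
have /ess_eq_setP[_ m1] := Dm _ DmA (fun x => @proj2 _ _).
have /ess_eq_setP[_ s1] : ess_eq_set (D (A `&` refl u @^-1` A)) (A `&` refl u @^-1` A).
  by apply: (set_map_symmetric hu D_inv fS) => x [h1 h2]; split => //=; rewrite reflK.
have sub B : fin_meas B -> B `<=` A -> ess_sub (D B) (D A).
  by move=> fB BA; apply: D_sub => //; exact: subset_ess_sub.
have p2 := ess_sub_trans p1 (sub _ DpA (fun x => @proj1 _ _)).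
have m2 := ess_sub_trans m1 (sub _ DmA (fun x => @proj1 _ _)).
have s2 := ess_sub_trans s1 (sub _ fS (fun x => @proj1 _ _)).
apply: ess_sub_trans (ess_subU p2 (ess_subU m2 s2)).
have h0 : mu [set x : V | dot x u = 0] = 0%E by exact: hyperplane_null.
apply: outer_null_sub h0 => x [h h']; apply/eqP/negPn/negP; rewrite neq_lt => /orP[xu|xu]; apply: h'.
  by move: h; rewrite /polarset/= leNgt xu/= => h; right; right.
move: h; rewrite /polarset/= (ltW xu) => -[h|h]; first by left.
by right; left; split => //=; rewrite dotNr dot_refl_u// opprK.
Qed.

Lemma reflN u : refl (- u) = refl u.
Proof. by apply/funext => x; rewrite /refl dotNr mulrN scalerN scaleNr opprK. Qed.

(** The two sides of the hyperplane are treated separately, with [- u] in place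
    of [u] for the second one. *)
Lemma set_map_classification u : enorm u = 1 -> invariant_on_symmetric_two_balls u D ->
  [\/ forall A, fin_meas A -> ess_eq_set (D A) A,
      forall A, fin_meas A -> ess_eq_set (D A) (refl u @^-1` A),
      forall A, fin_meas A -> ess_eq_set (D A) (polarset u A) |
      forall A, fin_meas A -> ess_eq_set (D A) (polarset (- u) A)].
Proof.
move=> hu D_inv.
have hNu : enorm (- u) = 1 by rewrite enormN.
have D_invN : invariant_on_symmetric_two_balls (- u) D.
  by rewrite /invariant_on_symmetric_two_balls reflN.
have halves A : ess_sub A ((A `&` [set x | 0 < dot x u]) `|` (A `&` [set x | 0 < dot x (- u)])).
  have h0 : mu [set x : V | dot x u = 0] = 0%E by exact: hyperplane_null.
  apply: outer_null_sub h0 => x [Ax h]; apply/eqP/negPn/negP; rewrite neq_lt => /orP[xu|xu]; apply: h.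
    by right; split => //=; rewrite dotNr oppr_gt0.
  by left.
have sub A B : fin_meas A -> measurable_set B -> ess_sub (D (A `&` B)) (D A).
  move=> fA mB; apply: D_sub => //; first exact: fin_measI.
  by apply: subset_ess_sub => x [].
have mp v : measurable_set [set x : V | 0 < dot x v] by exact: measurable_open_slice.
have [hp|hp] := set_map_half_space hu D_inv; have [hm|hm] := set_map_half_space hNu D_invN.
- apply: Or41 => A fA; apply: D_eq_of_sup => //; first by case: fA.
  apply: (ess_sub_trans (halves A)); apply: ess_subU.
    have /ess_eq_setP[_ h] := hp _ (fin_measI fA (mp u)) (fun x => @proj2 _ _).
    exact: ess_sub_trans h (sub _ _ fA (mp _)).
  have /ess_eq_setP[_ h] := hm _ (fin_measI fA (mp (- u))) (fun x => @proj2 _ _).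
  exact: ess_sub_trans h (sub _ _ fA (mp _)).
- apply: Or43; apply: set_map_polarset => //.
  by rewrite reflN in hm.
- apply: Or44; apply: set_map_polarset => //.
  by rewrite opprK reflN.
- apply: Or42 => A fA; rewrite reflN in hm; have [mA _] := fA.
  apply: D_eq_of_sup => //; [exact: measurable_refl| |exact: outer_refl].
  have hA : ess_sub (refl u @^-1` A) (refl u @^-1` ((A `&` [set x | 0 < dot x u]) `|`
      (A `&` [set x | 0 < dot x (- u)]))).
    by have := halves A; rewrite /ess_sub -[X in X = _ -> _](outer_refl i0 hu).
  apply: (ess_sub_trans hA); apply: ess_subU.
    have /ess_eq_setP[_ h] := hp _ (fin_measI fA (mp u)) (fun x => @proj2 _ _).
    exact: ess_sub_trans h (sub _ _ fA (mp _)).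
  have /ess_eq_setP[_ h] := hm _ (fin_measI fA (mp (- u))) (fun x => @proj2 _ _).
  exact: ess_sub_trans h (sub _ _ fA (mp _)).
Qed.

End set_map.

(** * Level sets of rearrangements *)

Section level_sets.
Variables (R : realType) (n : nat).
Local Notation V := 'rV[R]_n.
Local Notation mu := (@lebesgue_outer R n).
Implicit Types (A B : set V) (f g : V -> R) (s t : R).

Lemma outer_null_forall_rat (P : rat -> V -> Prop) :
  (forall q, mu [set x | ~ P q x] = 0%E) -> mu [set x | ~ forall q, P q x] = 0%E.
Proof.
move=> h.
apply: (@outer_null_sub _ _ _ (\bigcup_k [set x | exists2 q, unpickle k = Some q & ~ P q x])).
  by move=> x /existsNP[q nP]; exists (pickle q) => //; exists q => //; exact: pickleK.
apply: outer_null_bigcup => k; case: (unpickle k) => [q|].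
  by apply: outer_null_sub (h q) => x [q' [<-]].
by apply: outer_null_sub (outer_measure0 mu) => x [].
Qed.

(** Rational levels separate any two values. The second alternative serves the
    levels up to the essential infimum, where level sets may have infinite
    measure: there a common lower bound excludes values on different sides. *)
Lemma ess_eq_of_level_sets f g :
  (forall t, ess_eq_set [set x | t < f x] [set x | t < g x] \/
    forall s, s < t -> ess_le (cst s) f /\ ess_le (cst s) g) ->
  ess_eq f g.
Proof.
move=> lev; apply/ae_outer.
pose Q1 (q : rat) x := ess_eq_set [set x | ratr q < f x] [set x | ratr q < g x] ->
  (ratr q < f x <-> ratr q < g x).
pose Q2 (q : rat) x := ess_le (cst (ratr q)) f /\ ess_le (cst (ratr q)) g ->
  ratr q <= f x /\ ratr q <= g x.
have Q1_0 q : mu [set x | ~ Q1 q x] = 0%E.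
  have [/[dup] h /ae_outer|nh] :=
      pselect (ess_eq_set [set x | ratr q < f x] [set x | ratr q < g x]).
    by apply: outer_null_sub => x nQ hx; apply: nQ.
  by apply: outer_null_sub (outer_measure0 mu) => x; apply.
have Q2_0 q : mu [set x | ~ Q2 q x] = 0%E.
  have [[/ae_outer h1 /ae_outer h2]|nh] :=
      pselect (ess_le (cst (ratr q)) f /\ ess_le (cst (ratr q)) g).
    apply: outer_null_sub (outer_null_setU h1 h2) => x nQ.
    have [fx|] := boolP (ratr q <= f x); last by move/negP; left.
    by right => gx; apply: nQ.
  by apply: outer_null_sub (outer_measure0 mu) => x; apply.
have := outer_null_setU (outer_null_forall_rat Q1_0) (outer_null_forall_rat Q2_0).
apply: outer_null_sub => x fg; apply: contrapT => /not_orP[/contrapT h1 /contrapT h2].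
have key (a b : R) : a < b ->
    exists q q' : rat, [/\ a < ratr q, ratr q < ratr q' :> R & ratr q' < b].
  move=> ab; have [q' /[!in_itv]/= /andP[aq' q'b]] := rat_in_itvoo ab.
  have [q /[!in_itv]/= /andP[aq qq']] := rat_in_itvoo aq'.
  by exists q, q'.
apply: fg; apply/eqP; rewrite eq_le !leNgt.
apply/andP; split; apply/negP => /key[q [q' [h3 h4 h5]]].
  have [/h1[h _]|/(_ _ h4)/h2[_ h]] := lev (ratr q'); last by move: h; rewrite leNgt h3.
  by have := lt_trans (lt_trans h3 h4) (h h5); rewrite ltxx.
have [/h1[_ h]|/(_ _ h4)/h2[h _]] := lev (ratr q'); last by move: h; rewrite leNgt h3.
by have := lt_trans (lt_trans h3 h4) (h h5); rewrite ltxx.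
Qed.

(** Equal to [s] on [A] and to [t] elsewhere; in this form it is measurable by
    arithmetic, and indicator functions are special cases. *)
Definition step A s t x : R := t + (s - t) * \1_A x.

Lemma step_in A s t x : A x -> step A s t x = s.
Proof. by move=> Ax; rewrite /step indicE mem_set// mulr1 addrC subrK. Qed.

Lemma step_out A s t x : ~ A x -> step A s t x = t.
Proof. by move=> Ax; rewrite /step indicE memNset// mulr0 addr0. Qed.

Lemma measurable_step A s t : measurable_set A -> Mfun (step A s t).
Proof.
move=> mA; rewrite /Mfun/= /step.
apply: measurable_funD; first exact: measurable_cst.
apply: measurable_funM; [exact: measurable_cst|exact: measurable_indic].
Qed.

Lemma level_step A s t r : t <= r -> r < s -> [set x | r < step A s t x] = A.
Proof.
move=> tr rs; apply/seteqP; split => x /=.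
  by move=> h; apply: contrapT => Ax; move: h; rewrite step_out// ltNge tr.
by move=> Ax; rewrite step_in.
Qed.

Lemma measurable_level f t : Mfun f -> measurable_set [set x | t < f x].
Proof.
move=> mf; have := mf measurableT _ (measurable_itv `]t, +oo[%R).
rewrite setTI; congr measurable_set.
by apply/seteqP; split => x /=; rewrite in_itv/= andbT.
Qed.

(** Both function classes are of the form below, with [P] either trivial or
    nonnegativity. *)
Variables (P : R -> Prop) (X : set (V -> R)) (T : (V -> R) -> V -> R).
Hypothesis P0 : P 0.
Hypothesis P_up : forall s t, P s -> s <= t -> P t.
Hypothesis XE : X = [set f | Mfun f /\ forall x, P (f x)].
Hypothesis hT : rearrangement X T.

Let XT f : X f -> X (T f).
Proof. by case: hT => h _ _; exact: h. Qed.

Let T_level f t : X f -> mu [set x | t < T f x] = mu [set x | t < f x].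
Proof. by case: hT => _ h _ Xf; exact: h. Qed.

Let T_mono f g : X f -> X g -> ess_le f g -> ess_le (T f) (T g).
Proof. by case: hT => _ _ h; exact: h. Qed.

Let X_meas f : X f -> Mfun f.
Proof. by rewrite XE => -[]. Qed.

Let X_step A s t : measurable_set A -> P s -> P t -> X (step A s t).
Proof.
move=> mA Ps Pt; rewrite XE; split; first exact: measurable_step.
by move=> x; have [Ax|Ax] := pselect (A x); [rewrite step_in|rewrite step_out].
Qed.

Let ess_le_level f g t : ess_le f g -> ess_sub [set x | t < f x] [set x | t < g x].
Proof.
move=> /ae_outer; apply: outer_null_sub => x /= [fx ngx] fg; apply: ngx.
exact: lt_le_trans fx fg.
Qed.

Let ess_eq_of_sub_volume A B : measurable_set A -> ess_sub A B -> mu A = mu B ->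
  (mu B < +oo)%E -> ess_eq_set A B.
Proof.
by move=> mA AB vol Boo; apply/ess_eq_setP; split => //; exact: ess_sub_eq_measure.
Qed.

Let ess_eq_set_sym A B : ess_eq_set A B -> ess_eq_set B A.
Proof. by move=> /ess_eq_setP[h1 h2]; apply/ess_eq_setP. Qed.

Let ess_eq_set_trans A B C : ess_eq_set A B -> ess_eq_set B C -> ess_eq_set A C.
Proof.
move=> /ess_eq_setP[h1 h2] /ess_eq_setP[h3 h4]; apply/ess_eq_setP; split.
  exact: ess_sub_trans h1 h3.
exact: ess_sub_trans h4 h2.
Qed.

(** The minimum of the two functions has the same level set, and monotonicity
    compares it with both; nested sets of equal finite measure agree. *)
Let level_set_local f g t : X f -> X g -> [set x | t < f x] = [set x | t < g x] ->
  (mu [set x | (t < f x)%R] < +oo)%E ->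
  ess_eq_set [set x | t < T f x] [set x | t < T g x].
Proof.
move=> Xf Xg fg foo; pose h x := Num.min (f x) (g x).
have Xh : X h.
  rewrite XE; split; first exact: measurable_minr (X_meas Xf) (X_meas Xg).
  by move: Xf Xg; rewrite XE => -[_ Pf] [_ Pg] x; rewrite /h minEle; case: ifP.
have hE : [set x | t < h x] = [set x | t < f x].
  apply/seteqP; split => x /=; rewrite /h lt_min; first by case/andP.
  move=> fx; rewrite fx/=; have : [set x | t < f x] x by [].
  by rewrite fg.
have main k : X k -> (forall x, h x <= k x) -> [set x | t < k x] = [set x | t < f x] ->
    ess_eq_set [set x | t < T h x] [set x | t < T k x].
  move=> Xk hk kE; apply: ess_eq_of_sub_volume.
  - exact/measurable_level/X_meas/XT.
  - by apply/ess_le_level/T_mono => //; exact: aeW.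
  - by rewrite !T_level// hE kE.
  - by rewrite T_level// kE.
apply: (ess_eq_set_trans (B := [set x | t < T h x])).
  by apply/ess_eq_set_sym/main => // x; rewrite /h ge_min lexx.
by apply: main => // x; rewrite /h ge_min lexx orbT.
Qed.

Let step_levels A s t r r' : fin_meas A -> P s -> P t -> t <= r -> r <= r' -> r' < s ->
  ess_eq_set [set x | r' < T (step A s t) x] [set x | r < T (step A s t) x].
Proof.
move=> [mA Aoo] Ps Pt tr rr' rs; have XA := X_step mA Ps Pt.
have rs' := le_lt_trans rr' rs; have tr' := le_trans tr rr'.
apply: ess_eq_of_sub_volume.
- exact/measurable_level/X_meas/XT.
- by apply: subset_ess_sub => x /=; exact: le_lt_trans.
- by rewrite !T_level// !level_step.
- by rewrite T_level// level_step.
Qed.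

Let P1 : P 1.
Proof. exact: P_up P0 ler01. Qed.

Let indic_step A : \1_A = step A 1 0 :> (V -> R).
Proof. by apply/funext => x; rewrite /step add0r subr0 mul1r. Qed.

(** The level sets of the image of an indicator function at levels from zero to
    below one are nested and have the same measure, and the one at level one is
    null. *)
Let induced_level A : fin_meas A ->
  ess_eq_set (induced_map T A) [set x | 0 < T (step A 1 0) x].
Proof.
move=> fA; have [mA Aoo] := fA; have XA := X_step mA P1 P0.
rewrite /induced_map indic_step; apply/ess_eq_setP; split.
  by apply: subset_ess_sub => x /= ->.
have le1 : mu [set x | 1 < T (step A 1 0) x] = 0%E.
  rewrite T_level//; apply: outer_null_sub (outer_measure0 mu) => x /=.
  by have [Ax|Ax] := pselect (A x); [rewrite step_in// ltxx|rewrite step_out// ltr10].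
have ge1 : mu (\bigcup_k ([set x | 0 < T (step A 1 0) x] `\`
    [set x | 1 - k.+1%:R^-1 < T (step A 1 0) x])) = 0%E.
  apply: outer_null_bigcup => k.
  have k1 : k.+1%:R^-1 <= 1 :> R by rewrite invf_le1// ler1n.
  have k0 : 0 < k.+1%:R^-1 :> R by rewrite invr_gt0.
  have r0 : 0 <= 1 - k.+1%:R^-1 :> R by rewrite subr_ge0.
  have r1 : 1 - k.+1%:R^-1 < 1 :> R by rewrite ltrBlDr ltrDl.
  by have /ess_eq_setP[_ h] := step_levels fA P1 P0 (lexx 0) r0 r1.
apply: outer_null_sub (outer_null_setU le1 ge1) => x /= [T0 T1].
have [T1'|T1'] := ltP 1 (T (step A 1 0) x); first by left.
right; have e0 : 0 < 1 - T (step A 1 0) x.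
  by rewrite subr_gt0 lt_neqAle T1' andbT; apply/eqP.
have [N _ hN] := near_infty_natSinv_lt (PosNum e0); exists N => //; split => //=.
have := hN N (leqnn N); rewrite /=; move: (N.+1%:R^-1) => z; lra.
Qed.

Lemma measurable_induced_map A : measurable_set A -> measurable_set (induced_map T A).
Proof.
move=> mA; have mT := X_meas (XT (X_step mA P1 P0)).
have := mT measurableT _ (measurable_set1 1); rewrite setTI; congr measurable_set.
by rewrite /induced_map indic_step.
Qed.

Lemma outer_induced_map A : fin_meas A -> mu (induced_map T A) = mu A.
Proof.
move=> fA; have /ess_eq_setP[h1 h2] := induced_level fA; have [mA _] := fA.
by rewrite (ess_sub_outer_eq h1 h2) T_level ?level_step//; exact: X_step.
Qed.

Lemma ess_sub_induced_map A B : fin_meas A -> fin_meas B -> ess_sub A B ->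
  ess_sub (induced_map T A) (induced_map T B).
Proof.
move=> fA fB AB; have /ess_eq_setP[h1 _] := induced_level fA.
have /ess_eq_setP[_ h2] := induced_level fB.
apply: ess_sub_trans h1 (ess_sub_trans _ h2); apply/ess_le_level/T_mono.
- by case: fA => mA _; exact: X_step.
- by case: fB => mB _; exact: X_step.
apply/ae_outer; apply: outer_null_sub AB => x /= h; apply: contrapT => /not_andP nh.
apply: h; have [Ax|Ax] := pselect (A x).
  by case: nh => // /contrapT Bx; rewrite !step_in.
by rewrite (step_out _ _ Ax); have [Bx|Bx] := pselect (B x); [rewrite step_in|rewrite step_out].
Qed.

(** The same set may be a level set at different levels. A step function that
    has it as its level set both at [t] and at zero relates them. *)
Lemma level_set_induced f t : X f -> P t -> (mu [set x | (t < f x)%R] < +oo)%E ->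
  ess_eq_set [set x | t < T f x] (induced_map T [set x | t < f x]).
Proof.
move=> Xf Pt foo; set A := [set x | t < f x].
have mA : measurable_set A by exact/measurable_level/X_meas.
have fA : fin_meas A by [].
pose s1 := Num.max t 0 + 1; pose s0 := Num.min t 0.
have Ps0 : P s0 by rewrite /s0 minEle; case: ifP.
have Ps1 : P s1 by apply: P_up P0 _; rewrite addr_ge0// le_max lexx orbT.
have s0t : s0 <= t by rewrite ge_min lexx.
have s00 : s0 <= 0 by rewrite ge_min lexx orbT.
have ts1 : t < s1 by apply: le_lt_trans (_ : t <= Num.max t 0) _; rewrite ?le_max ?lexx// ltrDl.
have s10 : 0 < s1 by apply: le_lt_trans (_ : 0 <= Num.max t 0) _; rewrite ?le_max ?lexx ?orbT// ltrDl.
have XA := X_step mA Ps1 Ps0.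
have e1 : ess_eq_set [set x | t < T f x] [set x | t < T (step A s1 s0) x].
  by apply: level_set_local => //; rewrite level_step.
have e2 : ess_eq_set [set x | t < T (step A s1 s0) x] [set x | 0 < T (step A s1 s0) x].
  by have [t0|/ltW t0] := leP 0 t; [|apply: ess_eq_set_sym]; exact: step_levels.
have e3 : ess_eq_set [set x | 0 < T (step A s1 s0) x] [set x | 0 < T (step A 1 0) x].
  by apply: level_set_local; rewrite ?level_step//; exact: X_step.
apply: (ess_eq_set_trans e1 (ess_eq_set_trans e2 (ess_eq_set_trans e3 _))).
exact/ess_eq_set_sym/induced_level.
Qed.

(** Below [f] lie the step functions with values [s] on a ball and [t] elsewhere;
    their images exceed [t] on the image of the ball, and these images exhaust
    the space. *)
Lemma ess_le_cst_rearrangement f s t : X f -> P t -> t < s -> ess_le (cst s) f ->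
  (forall k : nat, ess_sub (closed_eball 0 k.+1%:R) (induced_map T (closed_eball 0 k.+1%:R))) ->
  ess_le (cst t) (T f).
Proof.
move=> Xf Pt ts sf exh; have Ps := P_up Pt (ltW ts).
apply/ae_outer; apply: (@outer_null_sub _ _ _
  (\bigcup_(k : nat) (closed_eball 0 k.+1%:R `\` [set x | t < T f x]))).
  move=> x /= /negP; rewrite -ltNge => Tx; exists (Num.truncn (enorm x)) => //; split => /=.
    rewrite /closed_eball/= subr0; apply: ltW.
    by have := truncn_itv (enorm_ge0 x) => /andP[].
  by apply/negP; rewrite -leNgt ltW.
apply: outer_null_bigcup => k; set B := closed_eball _ _.
have fB : fin_meas B := fin_meas_closed_eball _ _.
have mB : measurable_set B by case: fB.
have XB := X_step mB Ps Pt.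
have BE : [set x | t < step B s t x] = B by rewrite level_step.
have Boo : (mu [set x | (t < step B s t x)%R] < +oo)%E by rewrite BE; case: fB.
have /ess_eq_setP[_ h] := level_set_induced XB Pt Boo; rewrite BE in h.
apply: (ess_sub_trans (exh k)); apply: (ess_sub_trans h); apply/ess_le_level/T_mono => //.
move/ae_outer: sf => sf; apply/ae_outer; apply: outer_null_sub sf => x /= nle h'; apply: nle.
by have [Bx|Bx] := pselect (B x); [rewrite step_in|rewrite step_out//; apply: le_trans h'; exact: ltW].
Qed.

(** Where level sets are finite, they follow [Psi]; elsewhere the image and
    [Phi f] inherit the lower bound of [f]. *)
Lemma rearrangement_of_set_map (i0 : 'I_n) (u : V) (Phi : (V -> R) -> V -> R)
    (Psi : set V -> set V) : enorm u = 1 ->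
  (forall A, fin_meas A -> ess_eq_set (induced_map T A) (Psi A)) ->
  (forall f t, [set x | t < Phi f x] = Psi [set x | t < f x]) ->
  (forall f x, Phi f x = f x \/ Phi f x = f (refl u x)) ->
  (forall r, closed_eball 0 r `<=` Psi (closed_eball 0 r)) ->
  forall f, X f ->
  (forall t, P t /\ (mu [set x | (t < f x)%R] < +oo)%E \/ ess_le (cst t) f) ->
  ess_eq (T f) (Phi f).
Proof.
move=> hu TPsi PhiPsi PhiE Psi_ball f Xf levf.
apply: ess_eq_of_level_sets => t; have [[Pt foo]|tf] := levf t; [left|right => s st].
  rewrite PhiPsi; apply: ess_eq_set_trans (level_set_induced Xf Pt foo) _.
  by apply: TPsi; split => //; exact/measurable_level/X_meas.
split; last first.
  move: tf => /ae_outer h1; have h2 := h1; rewrite -(outer_refl i0 hu) in h2.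
  apply/ae_outer; apply: outer_null_sub (outer_null_setU h1 h2) => x nle.
  by have [e|e] := PhiE f x; [left|right] => h; apply: nle; rewrite /= e (le_trans (ltW st)).
have [Ps|nPs] := pselect (P s).
  apply: (ess_le_cst_rearrangement Xf Ps st tf) => k.
  have /ess_eq_setP[_ h] := TPsi _ (fin_meas_closed_eball 0 k.+1%:R).
  by apply: ess_sub_trans h; exact: subset_ess_sub.
apply: aeW => x; rewrite /= leNgt; apply/negP => /ltW Tx; apply: nPs; apply: P_up Tx.
by have := XT Xf; rewrite XE => -[_]; apply.
Qed.

End level_sets.

Section polarization_levels.
Variables (R : realType) (n : nat) (u : 'rV[R]_n).
Implicit Types (f : 'rV[R]_n -> R) (t : R).

Lemma level_polar f t :
  [set x | t < polar u f x] = polarset u [set x | t < f x].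
Proof.
apply/seteqP; split => x; rewrite /polar /polarset/=; case: ifP => _.
- by rewrite lt_max => /orP.
- by rewrite lt_min => /andP.
- by rewrite lt_max => /orP.
- by rewrite lt_min => /andP.
Qed.

Lemma polar_choice f x : polar u f x = f x \/ polar u f x = f (refl u x).
Proof. by rewrite /polar maxEle minEle; do 2 case: ifP => _; [right|left|left|right]. Qed.

Lemma polarset_closed_eball0 (hu : enorm u = 1) r :
  closed_eball 0 r `<=` polarset u (closed_eball 0 r).
Proof.
move=> x; rewrite /closed_eball /polarset/= !subr0 enorm_refl// => h.
by case: ifP => _; [left|].
Qed.

Hypothesis hu : enorm u = 1.

(** Reflecting a polarization exchanges the roles of the two half-spaces. *)
Lemma polar_daggerE f : polar_dagger u f = polar (- u) f.
Proof.
apply/funext => x; rewrite /polar_dagger /dagger /polar reflN reflK// dotNr dot_refl_u//.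
by rewrite maxC minC.
Qed.

End polarization_levels.

Theorem theorem6p22 (R : realType) (n : nat) (hn : (2 <= n)%N)
    (u : 'rV[R]_n) (hu : enorm u = 1)
    (X Y : set ('rV[R]_n -> R))
    (hXY : (X = @Mfun R n /\ Y = @Sfun R n) \/
           (X = @Mfun_plus R n /\ Y = @Vfun R n))
    (T : ('rV[R]_n -> R) -> 'rV[R]_n -> R) :
  rearrangement X T ->
  perimeter_preserving_convex_bodies (induced_map T) ->
  invariant_on_symmetric_two_balls u (induced_map T) ->
  ess_eq_map Y T id \/ ess_eq_map Y T (dagger u) \/
  ess_eq_map Y T (polar u) \/ ess_eq_map Y T (polar_dagger u).
Proof.
move=> hT perimT invT.
pose i0 : 'I_n := Ordinal (ltnW hn).
(* both cases at once: [P] is the condition on the values of functions in [X] *)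
have [P [P0 [P_up [XE Y_levels]]]] : exists P : R -> Prop, P 0 /\
    (forall s t, P s -> s <= t -> P t) /\
    X = [set f | Mfun f /\ forall x, P (f x)] /\
    forall f, Y f -> X f /\ forall t,
      P t /\ (@lebesgue_outer R n [set x | (t < f x)%R] < +oo)%E \/ ess_le (cst t) f.
  case: hXY => -[-> ->]; [exists (fun=> True)|exists (fun t => 0 <= t)].
    do 3 split => //; first by apply/seteqP; split => f //= -[].
    move=> f [mf foo]; split=> // t.
    have [h|h] := ltP (ess_inf (@Leb R n) (EFin \o f)) t%:E; first by left; split => //; exact: foo.
    right; have /ess_infP := h; apply: filterS => x /=; rewrite lee_fin; exact.
  split => //; split; first by move=> s t; exact: le_trans.
  split => // f [Xf foo]; split => // t; have [t0|t0] := ltP 0 t.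
    by left; split; [exact: ltW|exact: foo].
  by right; apply: aeW => x; apply: le_trans t0 _; case: Xf.
have D_meas A : fin_meas A -> measurable_set (induced_map T A).
  by move=> [mA _]; exact: (measurable_induced_map P0 P_up XE hT).
have D_vol := outer_induced_map P0 P_up XE hT.
have D_sub := ess_sub_induced_map P0 P_up XE hT.
have D_perim c r : 0 < r ->
    perimeter (induced_map T (closed_eball c r)) = perimeter (closed_eball c r).
  by move=> r0; have [] := perimT _ (convex_body_closed_eball c r0).
have hNu : enorm (- u) = 1 by rewrite enormN.
have refl0 r x : closed_eball 0 r x -> closed_eball 0 r (refl u x).
  by rewrite /closed_eball/= !subr0 enorm_refl.
have concl := rearrangement_of_set_map P0 P_up XE hT i0.
have [h|h|h|h] := set_map_classification i0 D_meas D_vol D_sub D_perim hu invT.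
- left => f /Y_levels[Xf levf].
  by apply: (concl u id id) => //; [move=> g x; left|move=> r x].
- right; left => f /Y_levels[Xf levf].
  by apply: (concl u (dagger u) (fun A => refl u @^-1` A)) => //; move=> g x; right.
- right; right; left => f /Y_levels[Xf levf].
  apply: (concl u (polar u) (polarset u)) => //.
  + exact: level_polar.
  + exact: polar_choice.
  + by move=> r; exact: polarset_closed_eball0.
- right; right; right => f /Y_levels[Xf levf]; rewrite polar_daggerE//.
  apply: (concl (- u) (polar (- u)) (polarset (- u))) => //.
  + exact: level_polar.
  + exact: polar_choice.
  + by move=> r; exact: polarset_closed_eball0.
Qed.
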